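(* Let $(M,\varphi,\xi_i,\eta^j,g)$ be a compact CR-integrable almost $\mathcal{S}$-manifold equipped with the generalized Tanaka–Webster connection $\nabla^{LP}$, and let $\nabla^{\mathcal{S}}$ be the connection induced by $\nabla^{LP}$ on $\mathcal{S}=\Lambda E_{0,1}^*$. Let $\mathsf{D}=\mathbf{c}\circ\pi_{E^*}\circ\nabla^{\mathcal{S}}$ be the first-order differential operator on $\Gamma(M,\mathcal{S})$ given by the composition $$\Gamma(M,\mathcal{S})\xrightarrow{\nabla^{\mathcal{S}}}\Gamma(M,T^*M\otimes\mathcal{S})\xrightarrow{\pi_{E^*}}\Gamma(M,E^*\otimes\mathcal{S})\xrightarrow{\mathbf{c}}\Gamma(M,\mathcal{S}),$$ and let $\mathsf{D}_b=\sqrt{2}\,(\overline{\partial}_b+\overline{\partial}_b^* ):\Gamma(M,\mathcal{S})\to\Gamma(M,\mathcal{S})$. Then $$\mathsf{D}_b=\mathsf{D}.$$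
   Context: **Almost $\mathcal{S}$-manifolds.** $M$ is a smooth compact manifold without boundary of dimension $2n+k$. A metric $f\cdot$pk-structure $(\varphi,\xi_i,\eta^j,g)$ on $M$ consists of $\varphi\in\Gamma(M,\mathrm{End}(TM))$ of rank $2n$ with $\varphi^3+\varphi=0$, a global frame $\xi_1,\dots,\xi_k$ of $T:=\ker\varphi$, 1-forms $\eta^1,\dots,\eta^k$ with $\eta^i(\xi_j)=\delta^i_j$, $\eta^j\circ\varphi=0$, $\varphi^2=-\mathrm{Id}+\sum_i\eta^i\otimes\xi_i$, and a Riemannian metric $g$ with $g(X,Y)=g(\varphi X,\varphi Y)+\sum_i\eta^i(X)\eta^i(Y)$. Put $E=\mathrm{im}\,\varphi$, so $TM=E\oplus T$ orthogonally. The fundamental 2-form is $\Phi(X,Y)=g(\varphi X,Y)$. The structure is an almost $\mathcal{S}$-structure if $\Phi=-d\eta^i$ for every $i$, where in this condition $d\eta(X,Y)=\tfrac12\big(X\eta(Y)-Y\eta(X)-\eta([X,Y])\big)$. Let $E\otimes\mathbb{C}=E_{1,0}\oplus E_{0,1}$ be the splitting into the $\pm i$-eigenbundles of $\varphi$. The structure is CR-integrable if $\Gamma(M,E_{1,0})$ is closed under the Lie bracket. **Generalized Tanaka–Webster connection.** On a CR-integrable almost $\mathcal{S}$-manifold there is a unique linear connection $\nabla^{LP}$ on $TM$ with $\nabla\varphi=\nabla g=\nabla\eta^i=0$ for all $i$, and torsion $T_\nabla$ satisfying: $T_\nabla(X,Y)=-2\Phi(X,Y)\sum_i\xi_i$ for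 $X,Y\in\Gamma(M,E)$; $T_\nabla(\xi_i,\varphi X)=-\varphi T_\nabla(\xi_i,X)$ for all $X\in\Gamma(M,TM)$; $T_\nabla(\xi_i,\xi_j)=0$ for all $i,j$. It preserves $E_{1,0}$, $E_{0,1}$ and $T$. **Clifford action.** Extend $g$ complex-bilinearly to $T_{\mathbb{C}}M=TM\otimes\mathbb{C}$ and to the dual. The dual splitting is $T^*_{\mathbb{C}}M=E_{1,0}^*\oplus E_{0,1}^*\oplus(T^*\otimes\mathbb{C})$; $\pi_{E^*}:T^*M\to E^*$ is the orthogonal projection. For $\alpha\in\Gamma(M,E^* )$, written $\alpha=\alpha^{1,0}+\alpha^{0,1}$ with $\alpha^{1,0}\in E_{1,0}^*$, $\alpha^{0,1}\in E_{0,1}^*$, and $\zeta\in\Gamma(M,\mathcal{S})$, $\mathbf{c}(\alpha)\zeta=\sqrt{2}\,(\alpha^{0,1}\wedge\zeta-\iota(\alpha^{1,0})\zeta)$, where $\iota(\alpha^{1,0})(\beta^1\wedge\cdots\wedge\beta^l)=\sum_i(-1)^{i-1}g(\alpha^{1,0},\beta^i)\,\beta^1\wedge\cdots\widehat{\beta^i}\cdots\wedge\beta^l$. **Tangential Cauchy–Riemann operator.** Let $T_{1,0}^*M=E_{1,0}^*\oplus(T^*\otimes\mathbb{C})$, $T_{0,1}^*M=E_{0,1}^*$, and $\mathcal{A}^{p,q}(M,E_{1,0})=\Gamma(M,\Lambda^pT_{1,0}^*M\wedge\Lambda^qT_{0,1}^*M)$, so that $\Gamma(M,\mathcal{S})=\bigoplus_q\mathcal{A}^{0,q}(M,E_{1,0})$.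 Then $\overline{\partial}_b=\pi^{0,q+1}\circ d:\mathcal{A}^{0,q}(M,E_{1,0})\to\mathcal{A}^{0,q+1}(M,E_{1,0})$, where $d$ is the usual exterior derivative and $\pi^{0,q+1}$ is the projection of complex $(q+1)$-forms onto type $(0,q+1)$. The adjoint $\overline{\partial}_b^*$ is the formal adjoint with respect to $(\psi,\zeta)=\int_M\langle\psi,\zeta\rangle\,\mu$, where $\langle\cdot,\cdot\rangle$ is the Hermitian pairing on forms induced by $\langle Z,W\rangle=g(Z,\overline{W})$ (conjugate-linear in the first entry on forms; if $\overline{\theta}^1,\dots,\overline{\theta}^n$ is dual to a local orthonormal frame of $E_{0,1}$, the $\overline{\theta}^{i_1}\wedge\cdots\wedge\overline{\theta}^{i_q}$, $i_1<\cdots<i_q$, are orthonormal), and $\mu=\eta^1\wedge\cdots\wedge\eta^k\wedge\Phi^n$ is the volume form (used also to orient $M$). *)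

(* Defs.v *)
From HB Require Import structures.
From mathcomp Require Import all_boot all_order all_algebra all_fingroup.
From mathcomp Require Import complex.
From mathcomp Require Import all_classical all_reals all_analysis.
Set Implicit Arguments.
Unset Strict Implicit.
Unset Printing Implicit Defensive.
Import Order.TTheory GRing.Theory Num.Theory numFieldNormedType.Exports.
Local Open Scope classical_set_scope.
Local Open Scope ring_scope.
Local Open Scope complex_scope.

(* Row vectors 'rV are tangent vectors and endomorphisms act on the right;
   column vectors 'cV are covectors, alpha(v) being the entry of v *m alpha.
   A q-linear form is a function of the q x d matrix whose rows are its
   arguments; wedge products follow the determinant convention
   (b1 /\ .. /\ bq)(v1, .., vq) = det (bi(vj)), to which the formula for d
   below also conforms. *)

Section MultilinearAlgebra.
Variables (K : fieldType) (d : nat).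

Definition mform (q : nat) := 'M[K]_(q, d) -> K.

Definition set_row q (j : 'I_q) (w : 'rV[K]_d) (A : 'M[K]_(q, d)) : 'M[K]_(q, d) :=
  \matrix_i (if i == j then w else row i A).

Definition multilinear q (w : mform q) : Prop :=
  forall A j (a : K) u v,
    w (set_row j (a *: u + v) A) = a * w (set_row j u A) + w (set_row j v A).

Definition alternating q (w : mform q) : Prop :=
  forall A i j, i != j -> row i A = row j A -> w A = 0.

Definition wedge p q (a : mform p) (b : mform q) : mform (p + q) := fun A =>
  ((p`! * q`!)%N%:R)^-1 *
  \sum_(s : 'S_(p + q))
    (-1) ^+ s * (a (usubmx (row_perm s A)) * b (dsubmx (row_perm s A))).

Definition covform (alpha : 'cV[K]_d) : mform 1 := fun A => (A *m alpha) 0 0.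

Fixpoint wedge_pow (a : mform 2) (r : nat) {struct r} : mform (r * 2) :=
  match r return mform (r * 2) with
  | 0 => fun=> 1
  | r'.+1 => @wedge 2 (r' * 2) a (@wedge_pow a r')
  end.

End MultilinearAlgebra.
Arguments wedge_pow {K d} a r _.

Section Calculus.
Variable R : realType.

Fixpoint Ck d (r : nat) (U : set 'rV[R]_d) (f : 'rV[R]_d -> R) : Prop :=
  (forall x, U x -> {for x, continuous f}) /\
  if r is r'.+1 then
    forall i : 'I_d, (forall x, U x -> derivable f x (delta_mx 0 i)) /\
      Ck r' U (fun x => 'D_(delta_mx 0 i) f x)
  else True.

Definition Cinfty d (U : set 'rV[R]_d) (f : 'rV[R]_d -> R) : Prop :=
  forall r, Ck r U f.

(* The integral over R^d, as an iterated Lebesgue integral; it is only applied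
   to continuous compactly supported functions. *)
Fixpoint integral_Rn d : ('rV[R]_d -> R) -> R :=
  match d with
  | 0 => fun F => F 0
  | d'.+1 => fun F =>
      \int[lebesgue_measure]_t integral_Rn (fun x : 'rV[R]_d' => F (row_mx t%:M x))
  end.

End Calculus.

Record chart (R : realType) (d : nat) (M : topologicalType) := Chart {
  cdom : set M;
  cmap : M -> 'rV[R]_d;
  cinv : 'rV[R]_d -> M }.

Section Charts.
Variables (R : realType) (d : nat) (M : topologicalType).
Implicit Types c : chart R d M.

Definition cimg c : set 'rV[R]_d := cmap c @` cdom c.

Definition is_chart c : Prop :=
  [/\ open (cdom c), open (cimg c),
      forall p, cdom c p -> cinv c (cmap c p) = p,
      forall p, cdom c p -> {for p, continuous (cmap c)} &
      forall x, cimg c x -> {for x, continuous (cinv c)}].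

Definition smooth_transition c c' : Prop :=
  forall i, Cinfty (cmap c @` (cdom c `&` cdom c'))
                   (fun x => cmap c' (cinv c x) 0 i).

End Charts.

(* The atlas is indexed by the points: [chart_at p] is a chart around p. *)
Record manifold (R : realType) (d : nat) := Manifold {
  points :> topologicalType;
  points_hausdorff : hausdorff_space points;
  points_second_countable : @second_countable points;
  chart_at : points -> chart R d points;
  chart_atP : forall p, is_chart (chart_at p);
  mem_chart_at : forall p, cdom (chart_at p) p;
  chart_at_compat : forall p q, smooth_transition (chart_at p) (chart_at q) }.

Section Manifolds.
Variables (R : realType) (d : nat) (M : manifold R d).
Local Notation C := R[i].

Definition in_maximal_atlas (c : chart R d M) : Prop :=
  is_chart c /\
  forall p, smooth_transition c (chart_at p) /\ smooth_transition (chart_at p) c.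

Definition smooth_fun (f : M -> R) : Prop :=
  forall p, Cinfty (cimg (chart_at p)) (f \o cinv (chart_at p)).

(* T_pM is R^d, the coordinates being those of the chart [chart_at p]; [vder]
   is the directional derivative of a function defined near p. *)
Definition vder (p : M) (v : 'rV[R]_d) (f : M -> R) : R :=
  'D_v (f \o cinv (chart_at p)) (cmap (chart_at p) p).

Definition coord (p : M) (i : 'I_d) (q : M) : R := cmap (chart_at p) q 0 i.

Definition vfield := M -> 'rV[R]_d.

Definition smooth_vf (X : vfield) : Prop :=
  forall p i, Cinfty (cimg (chart_at p))
    ((fun q => vder q (X q) (coord p i)) \o cinv (chart_at p)).

Definition lie (X Y : vfield) : vfield := fun p =>
  \row_i (vder p (X p) (fun q => vder q (Y q) (coord p i)) -
          vder p (Y p) (fun q => vder q (X q) (coord p i))).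

(* The rows are the coordinate vectors of c at q, as elements of T_qM. *)
Definition coord_frame (c : chart R d M) (q : M) : 'M[R]_d :=
  \matrix_(i, j)
    'D_(delta_mx 0 i) (fun x => cmap (chart_at q) (cinv c x) 0 j) (cmap c q).

Definition cplx a b (A : 'M[R]_(a, b)) : 'M[C]_(a, b) := map_mx (fun x => x%:C) A.
Definition Remx a b (A : 'M[C]_(a, b)) : 'M[R]_(a, b) := map_mx (fun z => complex.Re z) A.
Definition Immx a b (A : 'M[C]_(a, b)) : 'M[R]_(a, b) := map_mx (fun z => complex.Im z) A.

Definition smooth_cfun (f : M -> C) : Prop :=
  smooth_fun (fun p => complex.Re (f p)) /\ smooth_fun (fun p => complex.Im (f p)).

Definition cvfield := M -> 'rV[C]_d.

Definition Revf (Z : cvfield) : vfield := fun p => Remx (Z p).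
Definition Imvf (Z : cvfield) : vfield := fun p => Immx (Z p).

Definition smooth_cvf (Z : cvfield) : Prop := smooth_vf (Revf Z) /\ smooth_vf (Imvf Z).

Definition vderC (p : M) (v : 'rV[R]_d) (f : M -> C) : C :=
  vder p v (fun q => complex.Re (f q)) +i* vder p v (fun q => complex.Im (f q)).

Definition cvderC (p : M) (z : 'rV[C]_d) (f : M -> C) : C :=
  vderC p (Remx z) f + 'i%C * vderC p (Immx z) f.

Definition clie (Z W : cvfield) : cvfield := fun p =>
  cplx (lie (Revf Z) (Revf W) p - lie (Imvf Z) (Imvf W) p) +
  'i%C *: cplx (lie (Revf Z) (Imvf W) p + lie (Imvf Z) (Revf W) p).

(* d w (v_0, .., v_q) = sum_j (-1)^j V_j (w (V_0, .., no V_j, .., V_q)) at p, where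
   V_j is the field extending v_j with constant coefficients in [chart_at p]
   (the brackets [V_i, V_j] of the invariant formula vanish). *)
Definition extd q (w : M -> mform C d q) : M -> mform C d q.+1 := fun p A =>
  \sum_(j < q.+1) (-1) ^+ j *
    cvderC p (row j A)
      (fun r => w r (row' j A *m cplx (coord_frame (chart_at p) r))).

Definition topform (w : M -> mform R d d) : Prop :=
  [/\ forall p, multilinear (w p), forall p, alternating (w p) &
      forall W : 'I_d -> vfield, (forall i, smooth_vf (W i)) ->
        smooth_fun (fun p => w p (\matrix_i W i p))].

(* [I] is the integral of top-degree forms over the compact manifold M oriented
   by the nowhere vanishing top-degree form [mu]: the linear functional given, on
   forms supported in a positively oriented chart, by the integral in that
   chart. *)
Definition is_integral (mu : M -> mform R d d) (I : (M -> mform R d d) -> R) : Prop :=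
  (forall (a : R) w1 w2, topform w1 -> topform w2 ->
     I (fun p A => a * w1 p A + w2 p A) = a * I w1 + I w2) /\
  (forall (c : chart R d M) (S : set M) w,
     in_maximal_atlas c ->
     (forall q, cdom c q -> 0 < mu q (coord_frame c q)) ->
     compact S -> S `<=` cdom c ->
     topform w -> (forall q A, ~ S q -> w q A = 0) ->
     I w = integral_Rn (fun x : 'rV[R]_d =>
       if x \in cimg c then w (cinv c x) (coord_frame c (cinv c x)) else 0)).

(* [nabla p v Y] is the covariant derivative of Y at p along v in T_pM. *)
Definition connection := forall p : M, 'rV[R]_d -> vfield -> 'rV[R]_d.

Definition is_connection (nabla : connection) : Prop :=
  [/\ forall p (a : R) u v Y, smooth_vf Y ->
        nabla p (a *: u + v) Y = a *: nabla p u Y + nabla p v Y,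
      forall p v Y Y', smooth_vf Y -> smooth_vf Y' ->
        nabla p v (fun q => Y q + Y' q) = nabla p v Y + nabla p v Y',
      forall p v f Y, smooth_fun f -> smooth_vf Y ->
        nabla p v (fun q => f q *: Y q) = vder p v f *: Y p + f p *: nabla p v Y &
      forall X Y, smooth_vf X -> smooth_vf Y -> smooth_vf (fun p => nabla p (X p) Y)].

Definition torsion (nabla : connection) (X Y : vfield) : vfield := fun p =>
  nabla p (X p) Y - nabla p (Y p) X - lie X Y p.

Definition nablaC (nabla : connection) (p : M) (v : 'rV[R]_d) (Z : cvfield) : 'rV[C]_d :=
  cplx (nabla p v (Revf Z)) + 'i%C *: cplx (nabla p v (Imvf Z)).

End Manifolds.

(* The dimension 2n + k is written k + n * 2, which is syntactically the degree of
    the form eta^1 /\ .. /\ eta^k /\ Phi^n. *)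

Section AlmostS.
Variables (R : realType) (n k : nat).
Local Notation m := (k + n * 2)%N.
Variable M : manifold R m.
Local Notation C := R[i].

Record fpk_data := FpkData {
  phi : M -> 'M[R]_m;
  xi : 'I_k -> M -> 'rV[R]_m;
  eta : 'I_k -> M -> 'cV[R]_m;
  metric : M -> 'M[R]_m }.

Variable St : fpk_data.

Definition pair_eta (j : 'I_k) (p : M) (v : 'rV[R]_m) : R := (v *m eta St j p) 0 0.
Definition gprod (p : M) (u v : 'rV[R]_m) : R := (u *m metric St p *m v^T) 0 0.

Definition Phi (p : M) (u v : 'rV[R]_m) : R := gprod p (u *m phi St p) v.

Definition is_metric : Prop :=
  [/\ forall X Y, smooth_vf X -> smooth_vf Y -> smooth_fun (fun p => gprod p (X p) (Y p)),
      forall p, (metric St p)^T = metric St p &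
      forall p v, v != 0 -> 0 < gprod p v v].

Definition is_metric_fpk : Prop :=
  [/\ forall X, smooth_vf X -> smooth_vf (fun p => X p *m phi St p),
      forall i, smooth_vf (xi St i),
      forall j X, smooth_vf X -> smooth_fun (fun p => pair_eta j p (X p)),
      is_metric &
   [/\ forall p, \rank (phi St p) = (2 * n)%N,
      forall p, phi St p *m phi St p *m phi St p + phi St p = 0,
      forall p, (\matrix_i xi St i p == kermx (phi St p))%MS /\
                row_free (\matrix_i xi St i p) &
   [/\ forall p i j, pair_eta i p (xi St j p) = (i == j)%:R,
      forall p j, phi St p *m eta St j p = 0,
      forall p, phi St p *m phi St p = - 1%:M + \sum_i eta St i p *m xi St i p &
      forall p u v, gprod p u v = gprod p (u *m phi St p) (v *m phi St p) +
                                  \sum_i pair_eta i p u * pair_eta i p v]]].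

Definition d_eta (j : 'I_k) (X Y : vfield M) (p : M) : R :=
  2^-1 * (vder p (X p) (fun q => pair_eta j q (Y q)) -
          vder p (Y p) (fun q => pair_eta j q (X q)) -
          pair_eta j p (lie X Y p)).

Definition almost_S : Prop :=
  is_metric_fpk /\
  forall j X Y, smooth_vf X -> smooth_vf Y ->
    forall p, Phi p (X p) (Y p) = - d_eta j X Y p.

Definition phiC (p : M) : 'M[C]_m := cplx (phi St p).

Definition inE (p : M) (v : 'rV[R]_m) : Prop := (v <= phi St p)%MS.
Definition inE10 (p : M) (z : 'rV[C]_m) : Prop := z *m phiC p = 'i%C *: z.
Definition inE01 (p : M) (z : 'rV[C]_m) : Prop := z *m phiC p = - 'i%C *: z.
Definition inTC (p : M) (z : 'rV[C]_m) : Prop := z *m phiC p = 0.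

Definition CR_integrable : Prop :=
  forall Z W, smooth_cvf Z -> smooth_cvf W ->
    (forall p, inE10 p (Z p)) -> (forall p, inE10 p (W p)) ->
    forall p, inE10 p (clie Z W p).

Definition is_tanaka_webster (nabla : connection M) : Prop :=
  [/\ is_connection nabla,
   [/\ forall p v Y, smooth_vf Y ->
        nabla p v (fun q => Y q *m phi St q) = nabla p v Y *m phi St p,
      forall p v Y Y', smooth_vf Y -> smooth_vf Y' ->
        vder p v (fun q => gprod q (Y q) (Y' q)) =
        gprod p (nabla p v Y) (Y' p) + gprod p (Y p) (nabla p v Y') &
      forall p v j Y, smooth_vf Y ->
        vder p v (fun q => pair_eta j q (Y q)) = pair_eta j p (nabla p v Y)] &
   [/\ forall X Y, smooth_vf X -> smooth_vf Y ->
        (forall p, inE p (X p)) -> (forall p, inE p (Y p)) ->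
        forall p, torsion nabla X Y p =
                  - (2 * Phi p (X p) (Y p)) *: \sum_i xi St i p,
      forall i X, smooth_vf X -> forall p,
        torsion nabla (xi St i) (fun q => X q *m phi St q) p =
        - (torsion nabla (xi St i) X p *m phi St p) &
      forall i j p, torsion nabla (xi St i) (xi St j) p = 0]].

(* Projections of the complexified tangent space onto E_{1,0}, E_{0,1} and E
   (phi has eigenvalues i, -i and 0). *)
Definition proj10 (p : M) : 'M[C]_m := 2^-1 *: (- 'i%C *: phiC p - phiC p *m phiC p).
Definition proj01 (p : M) : 'M[C]_m := 2^-1 *: ('i%C *: phiC p - phiC p *m phiC p).
Definition projE (p : M) : 'M[C]_m := - (phiC p *m phiC p).

(* The family (s q)_q stands for the sum over q of the Lambda^q E_{0,1}^*
   components; E_{0,1}^* is the annihilator of E_{1,0} + T, and s q = 0 for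
   q > n, as E_{0,1} has rank n. *)
Definition cform := forall q : nat, mform C m q.

Definition in_spinor (p : M) (s : cform) : Prop :=
  forall q, [/\ multilinear (s q), alternating (s q) &
    forall A j, inE10 p (row j A) \/ inTC p (row j A) -> s q A = 0].

Definition csection := M -> cform.

Definition spinor_section (zeta : csection) : Prop :=
  (forall p, in_spinor p (zeta p)) /\
  forall q (W : 'I_q -> cvfield M), (forall i, smooth_cvf (W i)) ->
    smooth_cfun (fun p => zeta p q (\matrix_i W i p)).

Definition sharp (p : M) (alpha : 'cV[C]_m) : 'rV[C]_m :=
  alpha^T *m cplx (invmx (metric St p)).

(* Contraction with the vector g-dual to alpha: on a decomposable form, expanding
   the determinant along the first argument, it is
   sum_i (-1)^(i-1) g(alpha, beta^i) beta^1 /\ .. omit beta^i .. /\ beta^l. *)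
Definition iota_g (p : M) (alpha : 'cV[C]_m) q (s : mform C m q.+1) : mform C m q :=
  fun A => s (col_mx (sharp p alpha) A).

(* The (0,1) part of the covector alpha is alpha precomposed with proj01. *)
Definition clifford (p : M) (alpha : 'cV[C]_m) (s : cform) : cform := fun q A =>
  (Num.sqrt 2)%:C *
  ((match q return mform C m q with
    | 0 => fun=> 0
    | q'.+1 => wedge (covform (proj01 p *m alpha)) (s q')
    end) A
   - iota_g p (proj10 p *m alpha) (s q.+1) A).
Arguments clifford : clear implicits.

(* [nablaS p v zeta] is the covariant derivative of zeta at p along v. *)
Definition spinor_connection := forall p : M, 'rV[R]_m -> csection -> cform.

Definition is_induced (nabla : connection M) (nablaS : spinor_connection) : Prop :=
  forall zeta, spinor_section zeta -> forall p v,
    in_spinor p (nablaS p v zeta) /\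
    forall q (W : 'I_q -> cvfield M),
      (forall i, smooth_cvf (W i)) -> (forall i r, inE01 r (W i r)) ->
      nablaS p v zeta q (\matrix_i W i p) =
      vderC p v (fun r => zeta r q (\matrix_i W i r)) -
      \sum_(j < q) zeta p q (set_row j (nablaC nabla p v (W j)) (\matrix_i W i p)).

(* c o pi_{E^*} o nablaS: nablaS zeta is the sum over j of dx^j (x) (nabla_j zeta)
   for the standard basis of T_pM = R^m. *)
Definition Dirac (nablaS : spinor_connection) (zeta : csection) : csection := fun p q A =>
  \sum_(j < m) clifford p (projE p *m delta_mx j 0)
                        (nablaS p (delta_mx 0 j) zeta) q A.

Definition dbarb (zeta : csection) : csection := fun p q =>
  match q return mform C m q with
  | 0 => fun=> 0
  | q'.+1 => fun A => extd (fun r => zeta r q') p (A *m proj01 p)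
  end.
Arguments dbarb : clear implicits.

(* The Hermitian pairing of q-forms is
   1/q! sum g^{i_1 j_1} .. g^{i_q j_q} conj(psi_{i_1 .. i_q}) zeta_{j_1 .. j_q}. *)
Definition hpair (p : M) (s t : cform) : C :=
  \sum_(q < n.+1) (q`!%:R)^-1 *
    \sum_(I : {ffun 'I_q -> 'I_m}) \sum_(J : {ffun 'I_q -> 'I_m})
      (\prod_(a < q) (invmx (metric St p) (I a) (J a))%:C) *
      ((s q (\matrix_a delta_mx 0 (I a)))^* * t q (\matrix_a delta_mx 0 (J a))).

Definition volume (p : M) : mform R m m :=
  wedge (fun A : 'M[R]_(k, m) => \det (\matrix_(i, j) pair_eta i p (row j A)))
        (wedge_pow (fun A : 'M[R]_(2, m) => Phi p (row 0 A) (row 1 A)) n).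

Definition L2pair (I : (M -> mform R m m) -> R) (psi zeta : csection) : C :=
  I (fun p A => complex.Re (hpair p (psi p) (zeta p)) * volume p A) +i*
  I (fun p A => complex.Im (hpair p (psi p) (zeta p)) * volume p A).

Definition is_formal_adjoint (I : (M -> mform R m m) -> R)
    (P Pstar : csection -> csection) : Prop :=
  (forall zeta, spinor_section zeta -> spinor_section (Pstar zeta)) /\
  forall psi zeta, spinor_section psi -> spinor_section zeta ->
    L2pair I (P psi) zeta = L2pair I psi (Pstar zeta).

Definition D_b (dbarb_star : csection -> csection) (zeta : csection) : csection :=
  fun p q A => (Num.sqrt 2)%:C * (dbarb zeta p q A + dbarb_star zeta p q A).

End AlmostS.

(* Main.v *)
(* Let D'' zeta = - sum_l (nabla_l zeta)(e^l, ..) be the contraction half of the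
   Clifford operator. Its exterior half is dbarb, since the torsion of nabla
   vanishes on E_{0,1}. For sections psi and zeta let V be the real field with
   g(V, Y) = Re <psi, iota_Y zeta>; computing in a frame parallel at a point,
     tr nabla V = Re <dbarb psi, zeta> - Re <psi, D'' zeta>.
   The volume form is parallel and, V being tangent to E, T(., V) is traceless,
   so tr nabla V is the divergence of V, and its integral vanishes when V is
   supported in a chart. With psi = chi * delta for a cutoff chi and
   delta = dbarb^* zeta - D'' zeta, the integral of chi |delta|^2 is zero, hence
   delta = 0. *)

From HB Require Import structures.
Require Import Defs.
From mathcomp Require Import all_boot all_order all_algebra all_fingroup.
From mathcomp Require Import complex.
From mathcomp Require Import all_classical all_reals all_analysis.
From mathcomp Require Import ring lra zify.
Set Implicit Arguments.
Unset Strict Implicit.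
Unset Printing Implicit Defensive.
Import Order.TTheory GRing.Theory Num.Theory numFieldNormedType.Exports.
Local Open Scope classical_set_scope.
Local Open Scope ring_scope.

(** * Calculus on R^d *)

(** On $E_{0,1}$ the torsion vanishes because Phi is of type (1,1). The map T(., V) is traceless
    because it exchanges the two summands of TM: on E its values are multiples of the sum of the
    xi_i, and on the xi_i, writing V = phi V', the rule T(xi_i, phi X) = - phi T(xi_i, X) puts its
    values in E. The field V is tangent to E because spinors annihilate T. The integral is
    characterised only on forms supported in a positively oriented chart, and the adjoint only by
    its defining identity; hence the localisation by chi and a conclusion by positivity instead of a
    formula for the adjoint. A second obstacle is that tangent vectors at r are written in the chart
    attached to r, which varies with r without any continuity. Matrices of fields are therefore
    never differentiated: smoothness is tested on genuine functions such as the Gram entries g(X_a,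
    X_b), and derivatives are read off from frames whose covariant derivative vanishes at the point
    under study. *)

Lemma differentiable_of_small (R : realType) (V W : normedModType R)
    (f : V -> W) (df : {linear V -> W}) (x : V) : continuous df ->
  (forall e : R, 0 < e -> \forall h \near (0 : V),
    `|f (h + x) - f x - df h| <= e * `|h|) -> differentiable f x.
Proof.
move=> cdf small.
have key : f \o shift x = cst (f x) + df +o_ 0 id.
  apply/eqaddoP => _/posnumP[e]; have := small e%:num ltac:(by []).
  apply: filterS => h; apply: le_trans.
  by rewrite /= /shift/= !fctE opprD addrA.
by apply/diff_locallyP; rewrite (diff_unique cdf key).
Qed.

Section Differentiability.
Variables (R : realType) (d : nat).
Implicit Types (F : 'rV[R]_d -> R) (x y v : 'rV[R]_d).

Lemma is_derive_line F y v (t : R) : derivable F (y + t *: v) v ->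
  is_derive t 1 (fun s : R => F (y + s *: v)) ('D_v F (y + t *: v)).
Proof.
have E : (fun h : R => h^-1 *: ((F (y + (h *: 1 + t) *: v)) - F (y + t *: v))) =
         (fun h : R => h^-1 *: ((F (h *: v + (y + t *: v))) - F (y + t *: v))).
  by apply/funext => h; rewrite [h *: 1]mulr1 scalerDl addrCA.
by move=> dF; apply: DeriveDef; rewrite /derivable /derive/= E.
Qed.

(** The symmetric bound [|c| <= |a|] spares later uses a case distinction on the sign of [a]. *)
Lemma MVT_line F y v (a : R) :
  (forall t : R, `|t| <= `|a| -> derivable F (y + t *: v) v) ->
  exists2 c, `|c| <= `|a| & F (y + a *: v) - F y = a * 'D_v F (y + c *: v).
Proof.
move=> dF; pose phi (s : R) := F (y + s *: v).
have dphi (t : R) : `|t| <= `|a| -> is_derive t 1 phi ('D_v F (y + t *: v)).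
  by move=> /dF; exact: is_derive_line.
have cphi (t : R) : `|t| <= `|a| -> {for t, continuous phi}.
  move=> /dphi h; apply: differentiable_continuous; apply/derivable1_diffP.
  exact: ex_derive.
have -> : F y = phi 0 by rewrite /phi scale0r addr0.
have [a0|a0] := lerP 0 a.
- have [||c] := @MVT_segment _ phi (fun t => 'D_v F (y + t *: v)) 0 a a0.
  + move=> t; rewrite in_itv/= => /andP[t0 ta]; apply: dphi.
    by rewrite !ger0_norm// ltW.
  + apply: continuous_in_subspaceT => t; rewrite inE/= in_itv/= => /andP[t0 ta].
    by apply: cphi; rewrite !ger0_norm.
  + rewrite in_itv/= subr0 => /andP[c0 ca] E; exists c; first by rewrite !ger0_norm.
    by rewrite -/(phi a) E mulrC.
- have [||c] := @MVT_segment _ phi (fun t => 'D_v F (y + t *: v)) a 0 (ltW a0).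
  + move=> t; rewrite in_itv/= => /andP[t0 ta]; apply: dphi.
    by rewrite !ltr0_norm// lerN2 ltW.
  + apply: continuous_in_subspaceT => t; rewrite inE/= in_itv/= => /andP[t0 ta].
    by apply: cphi; rewrite !ler0_norm ?lerN2// ltW.
  + rewrite in_itv/= sub0r => /andP[c0 ca] E; exists c.
      by rewrite !ler0_norm ?lerN2// ltW.
    by rewrite -/(phi a) -opprB E mulrN opprK mulrC.
Qed.

Lemma normrV_le v (b : R) : 0 <= b -> (forall i, `|v 0 i| <= b) -> `|v| <= b.
Proof.
move=> b0 h; rewrite /Num.norm/= mx_normrE; apply/bigmax_leP; split => //= -[i j] _.
by rewrite ord1.
Qed.

Lemma coord_le_norm v i : `|v 0 i| <= `|v|.
Proof. by rewrite [leRHS]/Num.norm/= mx_normrE; apply/bigmax_geP; right => /=; exists (0, i). Qed.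

Lemma C1_differentiable F x :
  (\forall y \near x, forall i, derivable F y (delta_mx 0 i)) ->
  (forall i, {for x, continuous ('D_(delta_mx 0 i) F)}) ->
  differentiable F x.
Proof.
move=> dF cF.
pose df0 (h : 'rV[R]_d) : R := \sum_i h 0 i * 'D_(delta_mx 0 i) F x.
have lin : linear df0.
  move=> a u w; rewrite /df0 scaler_sumr -big_split/=; apply: eq_bigr => i _.
  by rewrite !mxE mulrDl [a *: _]mulrA.
pose dfM := GRing.isLinear.Build _ _ _ _ df0 lin.
pose df : {linear 'rV[R]_d -> R} := HB.pack df0 dfM.
have cdf : continuous df.
  move=> u; apply: differentiable_continuous.
  have -> : (df : 'rV[R]_d -> R) =
     (\sum_i (fun h : 'rV[R]_d => h 0 i * 'D_(delta_mx 0 i) F x)).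
    by apply/funext => h; rewrite fct_sumE.
  apply: differentiable_sum => i; apply: differentiableM => //.
  exact: differentiable_coord.
have small (e : R) : 0 < e -> \forall h \near (0 : 'rV[R]_d),
    `|F (h + x) - F x - df h| <= e * `|h|.
  move=> e0.
  (* The tolerance is shared among the [d] coordinates; [d.+1] keeps the quotient meaningful when
     [d = 0]. *)
  have near_i : \forall y \near x, forall i,
     `|'D_(delta_mx 0 i) F x - 'D_(delta_mx 0 i) F y| <= e / d.+1%:R.
    pose f i := [set y | `|'D_(delta_mx 0 i) F x - 'D_(delta_mx 0 i) F y| <= e / d.+1%:R].
    apply: (@filter_forall _ _ f (nbhs x) (nbhs_filter x)) => i.
    by have /cvgrPdist_le := cF i; apply; rewrite divr_gt0.
  have /nbhs_ballP[r /= r0 hr] : \forall y \near x,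
     (forall i, derivable F y (delta_mx 0 i)) /\
     (forall i, `|'D_(delta_mx 0 i) F x - 'D_(delta_mx 0 i) F y| <= e / d.+1%:R).
    by apply: filterI.
  apply/nbhs_ballP; exists r => //= h; rewrite -ball_normE /ball_/= sub0r normrN => hh.
  (* [hk k] keeps the first [k] coordinates of [h], so the increments of [F], each along one axis,
     telescope from [hk 0 = 0] to [hk d = h]. *)
  pose hk (k : nat) : 'rV[R]_d := \row_j (if (j < k)%N then h 0 j else 0).
  have hkb k (t : R) (i : 'I_d) : `|t| <= `|h 0 i| -> i = k :> nat ->
      `|hk k + t *: delta_mx 0 i| <= `|h|.
    move=> th ik; apply: normrV_le => // j; rewrite !mxE eqxx/=.
    have [->|ji] := eqVneq j i; first by rewrite ik ltnn add0r mulr1 (le_trans th)// coord_le_norm.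
    rewrite mulr0 addr0; case: ifP => _; [exact: coord_le_norm|by rewrite normr0].
  have step (i : 'I_d) : `|F (x + hk i.+1) - F (x + hk i) - h 0 i * 'D_(delta_mx 0 i) F x|
      <= e / d.+1%:R * `|h|.
    have E : hk i.+1 = hk i + h 0 i *: delta_mx 0 i.
      apply/rowP => j; rewrite !mxE eqxx/= ltnS leq_eqVlt.
      have [->|ji] := eqVneq j i; first by rewrite eqxx ltnn mulr1 add0r.
      by rewrite (_ : (j == i :> nat) = false) ?mulr0 ?addr0 //; apply/negbTE.
    have inb t : `|t| <= `|h 0 i| -> ball x r (x + hk i + t *: delta_mx 0 i).
      move=> th; rewrite -ball_normE /ball_/= -addrA opprD addNKr normrN.
      exact: le_lt_trans (hkb _ _ _ th _) hh.
    have [t /inb/hr [dt _]|c cb Ec] := @MVT_line F (x + hk i) (delta_mx 0 i) (h 0 i).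
      exact: dt.
    rewrite E addrA Ec -mulrBr normrM mulrC; apply: ler_pM => //.
      by rewrite distrC; have /inb/hr [_ ] := cb; exact.
    exact: coord_le_norm.
  have hk0 : hk 0%N = 0 by apply/rowP => j; rewrite !mxE.
  have hkd : hk d = h by apply/rowP => j; rewrite !mxE ltn_ord.
  have -> : F (h + x) - F x - df h = \sum_(i < d)
     (F (x + hk i.+1) - F (x + hk i) - h 0 i * 'D_(delta_mx 0 i) F x).
    rewrite sumrB (_ : df h = \sum_(i < d) h 0 i * 'D_(delta_mx 0 i) F x)//.
    congr (_ - _).
    rewrite -(big_mkord xpredT (fun i => F (x + hk i.+1) - F (x + hk i))).
    by rewrite telescope_sumr// hk0 hkd addr0 [x + h]addrC.
  apply: le_trans (ler_norm_sum _ _ _) _.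
  apply: (@le_trans _ _ (\sum_(i < d) (e / d.+1%:R * `|h|))).
    by apply: ler_sum => i _; exact: step.
  rewrite sumr_const card_ord -[leLHS]mulr_natl mulrA; apply: ler_wpM2r => //.
  by rewrite mulrA ler_pdivrMr// mulrC ler_pM2l// ler_nat.
exact: (differentiable_of_small cdf small).
Qed.

End Differentiability.

(** * Symmetry of second derivatives and the chain rule *)

Section Differentiability.
Variables (R : realType) (d : nat).
Implicit Types (F : 'rV[R]_d -> R) (x y v : 'rV[R]_d).

Lemma is_derive_translate F w y v (D : R) : is_derive (y + w) v F D ->
  is_derive y v (fun z => F (z + w)) D.
Proof.
have E : (fun h : R => h^-1 *: (F (h *: v + y + w) - F (y + w))) =
         (fun h : R => h^-1 *: (F (h *: v + (y + w)) - F (y + w))).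
  by apply/funext => h; rewrite addrA.
move=> [dF <-]; split; [by rewrite /derivable/= E|by rewrite /derive/= E].
Qed.

(** Two applications of the mean value theorem: along [v] to [z |-> F (z + h w) - F z], then along
    [w] to ['D_v F]. *)
Lemma second_difference F x (v w : 'rV[R]_d) (h r : R) :
  0 < h -> h * (`|v| + `|w|) < r ->
  (forall y, ball x r y -> derivable F y v /\ derivable ('D_v F) y w) ->
  exists2 y, `|y - x| <= h * (`|v| + `|w|) &
    F (x + h *: v + h *: w) - F (x + h *: v) - F (x + h *: w) + F x =
    h * h * 'D_w ('D_v F) y.
Proof.
move=> h0 hr dF.
have inb (s t : R) : `|s| <= `|h| -> `|t| <= `|h| ->
    `|x + s *: v + t *: w - x| <= h * (`|v| + `|w|).
  rewrite (ger0_norm (ltW h0)) => sh th.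
  rewrite -[x + _ + _]addrA [x + _]addrC addrK (le_trans (ler_normD _ _))// !normrZ mulrDr.
  by rewrite lerD// ler_wpM2r.
have inB y : `|y - x| <= h * (`|v| + `|w|) -> ball x r y.
  by rewrite -ball_normE /ball_/= distrC => /le_lt_trans; apply.
pose G z := F (z + h *: w) - F z.
have dG (s : R) : `|s| <= `|h| -> is_derive (x + s *: v) v G
    ('D_v F (x + s *: v + h *: w) - 'D_v F (x + s *: v)).
  move=> sh; apply: is_deriveB.
    apply: is_derive_translate; apply: DeriveDef => //.
    by apply: (dF _ _).1; apply: inB; exact: inb.
  apply: DeriveDef => //; apply: (dF _ _).1; apply: inB.
  by rewrite -[x + _]addr0 -(scale0r w); apply: inb; rewrite ?normr0.
have [c cb Ec] := @MVT_line _ _ G x v h (fun s hs => @ex_derive _ _ _ _ _ _ _ (dG s hs)).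
have [c' cb' Ec'] := @MVT_line _ _ ('D_v F) (x + c *: v) w h
  (fun s hs => (dF _ (inB _ (inb c s cb hs))).2).
exists (x + c *: v + c' *: w); first exact: inb.
rewrite -mulrA -Ec' -(@derive_val _ _ _ _ _ _ _ (dG c cb)) -Ec /G.
by rewrite opprB addrA addrAC.
Qed.

Lemma continuous_near_le F x (e : R) : {for x, continuous F} -> 0 < e ->
  \forall y \near x, `|F x - F y| <= e.
Proof. by move=> /cvgrPdist_le cF /cF. Qed.

(** The second difference is symmetric in [v] and [w], so divided by [h * h] it is a value near [x]
    of either mixed derivative; continuity at [x] then identifies the two. *)
Lemma schwarz F x v w :
  (\forall y \near x, derivable F y v /\ derivable ('D_v F) y w) ->
  (\forall y \near x, derivable F y w /\ derivable ('D_w F) y v) ->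
  {for x, continuous ('D_w ('D_v F))} -> {for x, continuous ('D_v ('D_w F))} ->
  'D_w ('D_v F) x = 'D_v ('D_w F) x.
Proof.
move=> d1 d2 c1 c2; apply/eqP; rewrite -subr_eq0 -normr_le0.
apply/ler_addgt0Pl => e e0; rewrite addr0.
have e20 : 0 < e / 2 by rewrite divr_gt0.
have n1 := continuous_near_le c1 e20.
have n2 := continuous_near_le c2 e20.
have /nbhs_ballP[r /= r0 hr] : \forall y \near x,
    ((derivable F y v /\ derivable ('D_v F) y w) /\
     (derivable F y w /\ derivable ('D_w F) y v)) /\
    (`|'D_w ('D_v F) x - 'D_w ('D_v F) y| <= e / 2 /\
     `|'D_v ('D_w F) x - 'D_v ('D_w F) y| <= e / 2).
  have d12 := @filterI _ (nbhs x) (nbhs_filter x) _ _ d1 d2.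
  have n12 := @filterI _ (nbhs x) (nbhs_filter x) _ _ n1 n2.
  exact: (@filterI _ (nbhs x) (nbhs_filter x) _ _ d12 n12).
(* The [+ 1] keeps the denominator positive even when both directions are zero. *)
pose h := r / 2 / (`|v| + `|w| + 1).
have s0 : 0 < `|v| + `|w| + 1 by rewrite ltr_wpDl// addr_ge0.
have h0 : 0 < h by rewrite !divr_gt0.
have hb : h * (`|v| + `|w|) < r.
  apply: (@le_lt_trans _ _ (h * (`|v| + `|w| + 1))).
    by rewrite ler_pM2l// lerDl.
  by rewrite /h divfK ?gt_eqF// ltr_pdivrMr// ltr_pMr// ltr1n.
have [y1 b1 E1] := second_difference h0 hb (fun y hy => (hr y hy).1.1).
have [y2 b2 E2] : exists2 y, `|y - x| <= h * (`|w| + `|v|) &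
    F (x + h *: v + h *: w) - F (x + h *: v) - F (x + h *: w) + F x =
    h * h * 'D_v ('D_w F) y.
  have hb' : h * (`|w| + `|v|) < r by rewrite [`|w| + _]addrC.
  have [y yb E] := second_difference h0 hb' (fun y hy => (hr y hy).1.2).
  exists y; first exact: yb.
  by rewrite -E (addrAC x) (addrAC _ (- F (x + h *: v))).
have inB y : `|y - x| <= h * (`|v| + `|w|) -> ball x r y.
  rewrite -ball_normE /ball_/= distrC => /le_lt_trans; apply; exact: hb.
have E : 'D_w ('D_v F) y1 = 'D_v ('D_w F) y2.
  have hh0 : h * h != 0 by rewrite mulf_neq0// gt_eqF.
  by apply: (mulfI hh0); apply: etrans (esym E1) _; exact: E2.
have B1 := (hr y1 (inB _ b1)).2.1.
have B2 : `|'D_v ('D_w F) x - 'D_v ('D_w F) y2| <= e / 2.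
  by apply: (hr y2 _).2.2; apply: inB; rewrite [`|v| + _]addrC.
have -> : 'D_w ('D_v F) x - 'D_v ('D_w F) x =
  ('D_w ('D_v F) x - 'D_w ('D_v F) y1) - ('D_v ('D_w F) x - 'D_v ('D_w F) y2).
  by rewrite E opprB addrA addrNK.
by apply: le_trans (ler_normB _ _) _; rewrite [e]splitr; apply: lerD; [exact: B1|exact: B2].
Qed.

Lemma chain_partial e (F : 'rV[R]_e -> R) (g : 'rV[R]_d -> 'rV[R]_e) x v :
  differentiable F (g x) -> (forall j, differentiable (fun y => g y 0 j) x) ->
  differentiable (F \o g) x /\
  'D_v (F \o g) x = \sum_j 'D_(delta_mx 0 j) F (g x) * 'D_v (fun y => g y 0 j) x.
Proof.
move=> dF dg.
have gE : g = (\sum_j (fun y => g y 0 j *: delta_mx 0 j)).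
  by apply/funext => y; rewrite fct_sumE -row_sum_delta.
have dg' : differentiable g x.
  by rewrite gE; apply: differentiable_sum => j; apply: differentiableZl.
split; first exact: differentiable_comp.
rewrite deriveE; last exact: differentiable_comp.
rewrite diff_comp//=.
have -> : 'd g x v = \sum_j 'D_v (fun y => g y 0 j) x *: delta_mx 0 j.
  rewrite -deriveE//; apply/rowP => j; rewrite derive_mx ?mxE; last exact: diff_derivable.
  rewrite summxE (bigD1 j)//= !mxE !eqxx mulr1 big1 ?addr0// => i ij.
  by rewrite !mxE eqxx/= eq_sym (negbTE ij) mulr0.
rewrite linear_sum/=; apply: eq_bigr => j _.
by rewrite linearZ/= -deriveE// mulrC.
Qed.

Lemma derive_sum_coord (F : 'rV[R]_d -> R) x v : differentiable F x ->
  'D_v F x = \sum_j v 0 j * 'D_(delta_mx 0 j) F x.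
Proof.
move=> dF; rewrite deriveE// {1}(row_sum_delta v) linear_sum; apply: eq_bigr => j _.
by rewrite linearZ/= deriveE.
Qed.

End Differentiability.

(** * Closure properties of functions of class C^r *)

Section Ck.
Variables (R : realType) (d : nat).
Implicit Types (f g : 'rV[R]_d -> R) (U : set 'rV[R]_d) (x : 'rV[R]_d).

Lemma near_open U x (P : 'rV[R]_d -> Prop) : open U -> U x ->
  (forall y, U y -> P y) -> \forall y \near x, P y.
Proof. by move=> oU Ux UP; apply: filterS UP _; exact: open_nbhs_nbhs. Qed.

Lemma for_continuous_near f g x : (\forall y \near x, f y = g y) ->
  {for x, continuous f} -> {for x, continuous g}.
Proof.
move=> fg cf; have E : f x = g x by exact: (nbhs_singleton fg).
have : g @ x --> f x by apply: cvg_trans (near_eq_cvg fg) cf.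
by rewrite E.
Qed.

Lemma Ck_ext r U f g : open U -> (forall x, U x -> f x = g x) -> Ck r U f -> Ck r U g.
Proof.
move=> oU; elim: r f g => [|r IH] f g fg [cf]/=; split=> //.
- move=> x Ux; apply: for_continuous_near (cf x Ux); exact: (near_open oU Ux).
- move=> x Ux; apply: for_continuous_near (cf x Ux); exact: (near_open oU Ux).
- move=> i; have [df df'] := b i; split.
    by move=> x Ux; apply: near_eq_derivable (df x Ux); exact: (near_open oU Ux).
  by apply: IH df' => x Ux; apply: near_eq_derive; exact: (near_open oU Ux).
Qed.

Lemma Ck_sub r U V f : V `<=` U -> Ck r U f -> Ck r V f.
Proof.
move=> VU; elim: r f => [|r IH] f [cf]/=; first by split => // x /VU; exact: cf.
move=> df; split => [x /VU|i]; first exact: cf.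
by have [dfi /IH] := df i; split => // x /VU; exact: dfi.
Qed.

Lemma CkW r U f : Ck r.+1 U f -> Ck r U f.
Proof.
elim: r f => [|r IH] f [cf df]; first by [].
by split => // i; have [? /IH] := df i.
Qed.

Lemma Ck_cst r U (c : R) : Ck r U (fun=> c).
Proof.
elim: r c => [|r IH] c; split=> //; try by move=> x _; exact: cst_continuous.
move=> i; split.
  by move=> x _; exact: derivable_cst.
have -> : (fun x => 'D_(delta_mx 0 i) (fun=> c) x) = (fun=> 0 : R).
  by apply/funext => x; exact: derive_cst.
exact: IH.
Qed.

Lemma CkD r U f g : open U -> Ck r U f -> Ck r U g -> Ck r U (fun x => f x + g x).
Proof.
move=> oU; elim: r f g => [|r IH] f g [cf df] [cg dg]; split=> //.
- by move=> x Ux; exact: (continuousD (cf x Ux) (cg x Ux)).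
- by move=> x Ux; exact: (continuousD (cf x Ux) (cg x Ux)).
- move=> i; have [fi fi'] := df i; have [gi gi'] := dg i; split.
    by move=> x Ux; apply: derivableD; [exact: fi|exact: gi].
  apply: (Ck_ext oU) (IH _ _ fi' gi') => x Ux.
  by rewrite [RHS]deriveD//; [exact: fi|exact: gi].
Qed.

Lemma CkM r U f g : open U -> Ck r U f -> Ck r U g -> Ck r U (fun x => f x * g x).
Proof.
move=> oU; elim: r f g => [|r IH] f g; [move=> [cf _] [cg _]|move=> Cf Cg]; split=> //.
- by move=> x Ux; exact: (continuousM (cf x Ux) (cg x Ux)).
- by move=> x Ux; exact: (continuousM (Cf.1 x Ux) (Cg.1 x Ux)).
- move=> i; have [fi fi'] := Cf.2 i; have [gi gi'] := Cg.2 i; split.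
    by move=> x Ux; apply: derivableM; [exact: fi|exact: gi].
  have := CkD oU (IH _ _ (CkW Cf) gi') (IH _ _ (CkW Cg) fi').
  apply: (Ck_ext oU) => x Ux; rewrite [RHS]deriveM//; [exact: fi|exact: gi].
Qed.

Lemma Ck_sum r U (I : Type) (s : seq I) (P : pred I) (f : I -> 'rV[R]_d -> R) :
  open U -> (forall i, Ck r U (f i)) -> Ck r U (fun x => \sum_(i <- s | P i) f i x).
Proof.
move=> oU Cf; rewrite -(_ : (\sum_(i <- s | P i) f i) = (fun x => \sum_(i <- s | P i) f i x)).
  elim/big_ind : _ => //; [exact: Ck_cst|by move=> a b; exact: CkD].
by apply/funext => x; rewrite fct_sumE.
Qed.

Lemma Ck1_differentiable U f x : open U -> Ck 1 U f -> U x -> differentiable f x.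
Proof.
move=> oU [cf df] Ux; apply: C1_differentiable.
  by apply: (near_open oU Ux) => y Uy i; exact: (df i).1.
by move=> i; exact: (df i).2.1.
Qed.

Lemma CkV r U f : open U -> (forall x, U x -> f x != 0) -> Ck r U f ->
  Ck r U (fun x => (f x)^-1).
Proof.
move=> oU f0; elim: r => [|r IH] Cf; split=> //.
- by move=> x Ux; exact: (continuousV (f0 x Ux) (Cf.1 x Ux)).
- by move=> x Ux; exact: (continuousV (f0 x Ux) (Cf.1 x Ux)).
- move=> i; have [fi fi'] := Cf.2 i; have {IH}Cv := IH (CkW Cf); split.
    by move=> x Ux; apply: derivableV; [exact: f0|exact: fi].
  have := CkM oU (CkM oU (Ck_cst r U (-1)) (CkM oU Cv Cv)) fi'.
  apply: (Ck_ext oU) => x Ux; rewrite [RHS]deriveV//; [|exact: f0|exact: fi].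
  by rewrite mulN1r -expr2 exprVn.
Qed.

Lemma Ck_coord r U (i : 'I_d) : open U -> Ck r U (fun x => x 0 i).
Proof.
move=> oU; case: r => [|r]; split=> //; try by move=> x _; exact: coord_continuous.
move=> j; split; first by move=> x _; apply: diff_derivable; exact: differentiable_coord.
apply: (Ck_ext oU) (Ck_cst r U ((delta_mx 0 j : 'rV[R]_d) 0 i)) => x Ux.
rewrite -[RHS](mxE matrix_key (fun a b => 'D_(delta_mx 0 j) (fun y : 'rV[R]_d => y a b) x) 0 i).
by rewrite -(derive_mx (M:=id))// derive_id.
Qed.

End Ck.

Lemma for_continuous_row (R : realType) (T : topologicalType) e (g : T -> 'rV[R]_e) (x : T) :
  (forall j, {for x, continuous (fun y => g y 0 j)}) -> {for x, continuous g}.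
Proof.
move=> cg; apply/cvgrPdist_le => e1 e10.
have : \forall y \near x, forall j, `|g x 0 j - g y 0 j| <= e1.
  pose f j := [set y | `|g x 0 j - g y 0 j| <= e1].
  apply: (@filter_forall _ _ f (nbhs x) (nbhs_filter x)) => j.
  by have /cvgrPdist_le := cg j; apply.
apply: filterS => y h; apply: normrV_le; first exact: ltW.
by move=> j; rewrite !mxE; exact: h.
Qed.

Section Comp.
Variables (R : realType) (d e : nat).

Lemma Ck_comp r (U : set 'rV[R]_d) (W : set 'rV[R]_e) (f : 'rV[R]_e -> R)
    (g : 'rV[R]_d -> 'rV[R]_e) : open U -> open W ->
  (forall x, U x -> W (g x)) ->
  (forall j, Ck r U (fun x => g x 0 j)) -> Ck r W f -> Ck r U (f \o g).
Proof.
move=> oU oW UW; elim: r f => [|r IH] f Cg Cf; split=> //.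
- move=> x Ux; apply: continuous_comp (Cf.1 _ (UW _ Ux)).
  by apply: for_continuous_row => j; exact: (Cg j).1.
- move=> x Ux; apply: continuous_comp (Cf.1 _ (UW _ Ux)).
  by apply: for_continuous_row => j; exact: (Cg j).1.
have dg x : U x -> forall j, differentiable (fun y => g y 0 j) x.
  move=> Ux j; apply: (Ck1_differentiable oU) Ux.
  have := Cg j; elim: (r) => // s IHs /CkW; exact: IHs.
have df x : U x -> differentiable f (g x).
  move=> Ux; apply: (Ck1_differentiable oW) (UW _ Ux).
  by have := Cf; elim: (r) => // s IHs /CkW; exact: IHs.
move=> i; split.
  by move=> x Ux; apply: diff_derivable; exact: (chain_partial 0 (df x Ux) (dg x Ux)).1.
have Cs : Ck r U (fun x => \sum_j ('D_(delta_mx 0 j) f \o g) x *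
                                 'D_(delta_mx 0 i) (fun y => g y 0 j) x).
  apply: Ck_sum => // j; apply: CkM => //; last exact: ((Cg j).2 i).2.
  by apply: IH => [k|]; [exact: CkW|exact: (Cf.2 j).2].
apply: (Ck_ext oU) Cs => x Ux.
by rewrite (chain_partial _ (df x Ux) (dg x Ux)).2.
Qed.

End Comp.

(** * Flat functions and smooth bumps *)

Section Flat.
Variable R : realType.

(** For [k = 0] this is the classical function exp(-1/t). The powers of 1/t make the family closed
    under differentiation, so that smoothness becomes an induction on the order. *)
Definition flat_exp (k : nat) (t : R) : R :=
  if 0 < t then t^-1 ^+ k * expR (- t^-1) else 0.

Lemma flat_exp_ge0 k t : 0 <= flat_exp k t.
Proof.
rewrite /flat_exp; case: ifPn => // t0.
by rewrite mulr_ge0 ?expR_ge0// exprn_ge0// invr_ge0 ltW.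
Qed.

(** With u = 1/t this is the exponential series estimate u^(k+1) / (k+1)! <= exp u. *)
Lemma flat_exp_bound k (t : R) : `|flat_exp k t| <= k.+1`!%:R * `|t|.
Proof.
rewrite (ger0_norm (flat_exp_ge0 _ _)) /flat_exp; case: ifPn => [t0|_]; last first.
  by rewrite mulr_ge0.
have u0 : 0 < t^-1 by rewrite invr_gt0.
rewrite (gtr0_norm t0) -[in leRHS](invrK t); move: (t^-1) u0 => u u0.
have f0 : 0 < k.+1`!%:R :> R by rewrite ltr0n fact_gt0.
rewrite expRN ler_pdivrMr ?expR_gt0// mulrAC ler_pdivlMr// -exprSr mulrC.
rewrite -ler_pdivrMr//; apply: le_trans (expR_ge1Dxn k (ltW u0)).
by rewrite lerDr.
Qed.

Lemma is_derive_flat_exp k (t : R) :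
  is_derive t 1 (flat_exp k) (- k%:R * flat_exp k.+1 t + flat_exp k.+2 t).
Proof.
have [t0|t0|->] := ltgtP t 0.
- have -> : - k%:R * flat_exp k.+1 t + flat_exp k.+2 t = 0.
    by rewrite /flat_exp !ltNge (ltW t0)/= mulr0 addr0.
  apply: (@near_eq_is_derive _ _ _ (cst 0)).
  by near=> s; rewrite /flat_exp ltNge (_ : s <= 0)//; near: s; exact: lt_le_nbhsl.
- have dV : is_derive t 1 (fun s : R => s^-1) (- (t^-1 ^+ 2)).
    apply: DeriveDef; first by apply: derivableV; [rewrite gt_eqF|exact: derivable_id].
    rewrite (@deriveV _ _ id) ?derive_id//; last by rewrite gt_eqF.
    by rewrite exprVn [_ *: _]mulr1.
  have dE : is_derive t 1 (fun s : R => expR (- s^-1)) (expR (- t^-1) * t^-1 ^+ 2).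
    have dN : is_derive t 1 (fun s : R => - s^-1) (t^-1 ^+ 2).
      by apply: (is_derive_eq (is_deriveN dV)); rewrite opprK.
    exact: (is_derive1_comp (is_derive_expR _) dN).
  apply: (@near_eq_is_derive _ _ _ (fun s : R => s^-1 ^+ k * expR (- s^-1))).
    by near=> s; rewrite /flat_exp ifT//; near: s; exact: lt_nbhsr.
  have dX : is_derive t 1 (fun s : R => s^-1 ^+ k) (- k%:R * t^-1 ^+ k.+1).
    case: k => [|k]; first by rewrite oppr0 mul0r; exact: is_derive_cst.
    have -> : (fun s : R => s^-1 ^+ k.+1) = (fun s : R => s^-1) ^+ k.+1.
      by apply/funext => s; rewrite exprfctE.
    apply: (is_derive_eq (is_deriveX k.+1 dV)).
    by rewrite /GRing.scale/= mulrN -mulrA -exprD addn2 mulNr.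
  apply: (is_derive_eq (is_deriveM dX dE)).
  rewrite /flat_exp t0 /GRing.scale/= !exprS expr0.
  by set E := expR _; set P := _ ^+ k; set u := t^-1; set K := (- _); ring.
- have -> : - k%:R * flat_exp k.+1 0 + flat_exp k.+2 0 = 0.
    by rewrite /flat_exp ltxx mulr0 addr0.
  have l0 : h^-1 *: (flat_exp k (h *: 1 + 0) - flat_exp k 0) @[h --> 0^'] --> (0 : R).
    (* At 0 the difference quotient of [flat_exp k] is [flat_exp k.+1], which tends to 0 by the
       linear bound. *)
    have E : \forall h \near 0^', flat_exp k.+1 h =
        h^-1 *: (flat_exp k (h *: 1 + 0) - flat_exp k 0).
      near=> h; have hn0 : h != 0 by near: h; exact: nbhs_dnbhs_neq.
      rewrite addr0 /flat_exp ltxx subr0 /GRing.scale/= mulr1.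
      by case: ifPn => _; rewrite ?mulr0// mulrA -exprS.
    apply: cvg_trans (near_eq_cvg E) _.
    apply/cvgrPdist_le => e e0; near=> h.
    rewrite sub0r normrN (le_trans (flat_exp_bound _ _))//.
    rewrite -ler_pdivlMl ?ltr0n ?fact_gt0//.
    near: h; apply: dnbhs0_le; rewrite mulr_gt0// invr_gt0 ltr0n fact_gt0//.
  by apply: DeriveDef; [apply/cvg_ex; exists 0|exact: cvg_lim l0].
Unshelve. all: by end_near. Qed.

Lemma Ck_flat_exp d r (U : set 'rV[R]_d) u k : open U -> Ck r U u ->
  Ck r U (fun x => flat_exp k (u x)).
Proof.
move=> oU; have cont x j : {for x, continuous (flat_exp j)}.
  apply: differentiable_continuous; apply/derivable1_diffP.
  by have [] := is_derive_flat_exp j x.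
elim: r k => [|r IH] k Cu; split => //.
- by move=> x Ux; apply: continuous_comp (Cu.1 x Ux) (cont _ _).
- by move=> x Ux; apply: continuous_comp (Cu.1 x Ux) (cont _ _).
have du x : U x -> differentiable u x.
  move=> Ux; apply: (Ck1_differentiable oU) Ux.
  by have := Cu; elim: (r) => // s IHs /CkW; exact: IHs.
have df x j : differentiable (flat_exp j) x.
  by apply/derivable1_diffP; have [] := is_derive_flat_exp j x.
have dc x : U x -> differentiable (flat_exp k \o u) x.
  by move=> Ux; apply: differentiable_comp; [exact: du|exact: df].
move=> i; split; first by move=> x Ux; apply: diff_derivable; exact: dc.
have Cu' := CkW Cu.
have := CkM oU (CkD oU (CkM oU (Ck_cst r U (- k%:R)) (IH k.+1 Cu')) (IH k.+2 Cu')) (Cu.2 i).2.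
apply: (Ck_ext oU) => x Ux.
rewrite [RHS]deriveE; last exact: dc.
rewrite (diff_comp (du x Ux) (df (u x) k))/=.
rewrite -[X in 'd _ _ X]mulr1 [RHS]linearZ/= -!deriveE//; last exact: du.
by rewrite (@derive_val _ _ _ _ _ _ _ (is_derive_flat_exp k (u x))) mulrC.
Qed.

End Flat.

Section Bump.
Variable R : realType.

(** A smooth transition from 0 on t <= 0 to 1 on t >= 1/2; the two summands of the denominator never
    vanish together. *)
Definition smooth_step (t : R) : R :=
  flat_exp 0 t * (flat_exp 0 t + flat_exp 0 (2^-1 - t))^-1.

Lemma flat_exp_gt0 k (t : R) : 0 < t -> 0 < flat_exp k t.
Proof.
by move=> t0; rewrite /flat_exp t0 mulr_gt0 ?expR_gt0// exprn_gt0// invr_gt0.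
Qed.

Lemma smooth_step_den (t : R) : 0 < flat_exp 0 t + flat_exp 0 (2^-1 - t).
Proof.
have [t0|t0] := ltP 0 t.
  by rewrite ltr_wpDr ?flat_exp_ge0 ?flat_exp_gt0.
by rewrite ltr_wpDl ?flat_exp_ge0 ?flat_exp_gt0// subr_gt0 (le_lt_trans t0).
Qed.

Lemma smooth_step_ge0 t : 0 <= smooth_step t.
Proof. by rewrite mulr_ge0 ?flat_exp_ge0// invr_ge0 ltW// smooth_step_den. Qed.

Lemma smooth_step0 t : t <= 0 -> smooth_step t = 0.
Proof. by move=> t0; rewrite /smooth_step {1}/flat_exp ltNge t0/= mul0r. Qed.

Lemma smooth_step1 t : 2^-1 <= t -> smooth_step t = 1.
Proof.
move=> t0; rewrite /smooth_step [flat_exp 0 (_ - _)]/flat_exp subr_gt0 ltNge t0/= addr0.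
by rewrite mulfV// gt_eqF// flat_exp_gt0// (lt_le_trans _ t0).
Qed.

Lemma Ck_smooth_step d r (U : set 'rV[R]_d) u : open U -> Ck r U u ->
  Ck r U (fun x => smooth_step (u x)).
Proof.
move=> oU Cu; apply: CkM => //; first exact: Ck_flat_exp.
apply: CkV => //; first by move=> x _; rewrite gt_eqF// smooth_step_den.
apply: CkD => //; first exact: Ck_flat_exp.
apply: Ck_flat_exp => //; apply: CkD => //; first exact: Ck_cst.
apply: (Ck_ext oU) (CkM oU (Ck_cst r U (-1)) Cu) => x _.
by rewrite mulN1r.
Qed.

Lemma bump_function d (x0 : 'rV[R]_d) (e : R) : 0 < e -> exists b : 'rV[R]_d -> R,
  [/\ Cinfty setT b, forall x, 0 <= b x, \forall x \near x0, b x = 1 &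
      forall x, e <= `|x - x0| -> b x = 0].
Proof.
(* [u] is 1 minus the squared Euclidean distance divided by e^2. It equals 1 at [x0] and is
   nonpositive once the max norm of [x - x0] reaches [e]; the max norm itself would not be
   smooth. *)
move=> e0; pose u (x : 'rV[R]_d) := 1 + (- (e ^+ 2)^-1) * \sum_i (x 0 i + - x0 0 i) * (x 0 i + - x0 0 i).
have Cu r : Ck r setT u.
  have oT : open [set: 'rV[R]_d] by exact: openT.
  apply: CkD => //; first exact: Ck_cst.
  apply: CkM => //; first exact: Ck_cst.
  by apply: Ck_sum => // i; apply: CkM => //; apply: CkD => //;
    by [exact: Ck_coord|exact: Ck_cst].
exists (fun x => smooth_step (u x)); split.
- by move=> r; apply: Ck_smooth_step => //; exact: openT.
- by move=> x; exact: smooth_step_ge0.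
- have cu : {for x0, continuous u} by exact: (Cu 0%N).1.
  have h0 : 0 < 2^-1 :> R by rewrite invr_gt0.
  have := continuous_near_le cu h0; apply: filterS => x.
  have -> : u x0 = 1.
    rewrite /u big1 ?mulr0 ?addr0// => i _.
    by rewrite subrr mulr0.
  rewrite ler_norml => /andP[_ h]; apply: smooth_step1; lra.
- move=> x ex.
  apply: smooth_step0; rewrite /u mulNr subr_le0 mulrC ler_pdivlMr ?exprn_gt0// mul1r.
  have [[i j]] : exists ij, mx_norm (x - x0) = `|(x - x0) ij.1 ij.2|.
    by apply: mx_norm_neq0; rewrite gt_eqF// (lt_le_trans e0).
  rewrite (ord1 i)/= => E; have {E}h : e <= `|(x - x0) 0 j| by rewrite -E.
  rewrite (bigD1 j)//= ler_wpDr//.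
    by apply: sumr_ge0 => k _; rewrite -expr2 sqr_ge0.
  move: h; rewrite !mxE => h; rewrite -expr2 -[leRHS]real_normK ?num_real//.
  by rewrite ler_pXn2r ?nnegrE ?(ltW e0).
Qed.

End Bump.

(** * Iterated integrals of compactly supported functions *)

(* Unlike continuity with compact support, this class is visibly stable under
   slicing and under integration in one variable. *)
Definition lip_supp (R : realType) (V : normedModType R) (B : R) (f : V -> R) :=
  (exists2 L, 0 <= L & forall x y, `|f x - f y| <= L * `|x - y|) /\
  forall x, B < `|x| -> f x = 0.

Section LipSupp.
Variables (R : realType) (V : normedModType R).
Implicit Types f g : V -> R.

Lemma lip_suppZD (B a : R) f g : lip_supp B f -> lip_supp B g ->
  lip_supp B (fun x => a * f x + g x).
Proof.
move=> [[L L0 Lf] sf] [[K K0 Kg] sg]; split; last first.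
  by move=> x Bx; rewrite sf// sg// mulr0 addr0.
exists (`|a| * L + K); first by rewrite addr_ge0// mulr_ge0.
move=> x y; have -> : a * f x + g x - (a * f y + g y) = a * (f x - f y) + (g x - g y) by ring.
rewrite (le_trans (ler_normD _ _))// normrM mulrDl lerD//.
by rewrite -mulrA ler_wpM2l.
Qed.

Lemma lip_supp0 (B : R) : lip_supp B (fun _ : V => 0 : R).
Proof. by split=> //; exists 0 => // x y; rewrite subrr normr0 mul0r. Qed.

Lemma lip_suppW (B B' : R) f : B <= B' -> lip_supp B f -> lip_supp B' f.
Proof. by move=> BB [lf sf]; split => // x Bx; apply: sf; exact: le_lt_trans Bx. Qed.

Lemma lip_supp_shift (B : R) f (w : V) : lip_supp B f ->
  lip_supp (B + `|w|) (fun x => f (x + w)).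
Proof.
move=> [[L L0 Lf] sf]; split.
  by exists L => // x y; apply: le_trans (Lf _ _) _; rewrite opprD addrACA subrr addr0.
move=> x h; apply: sf; rewrite -(ltrD2r `|w|) (lt_le_trans h)//.
by rewrite -{1}[x](addrK w) (le_trans (ler_normB _ _)).
Qed.

Lemma lip_supp_continuous (B : R) f : lip_supp B f -> continuous f.
Proof.
move=> [[L L0 Lf] _] x; apply/cvgrPdist_le => e e0.
have L1 : 0 < L + 1 by rewrite ltr_wpDl.
near=> y; apply: le_trans (Lf _ _) _.
apply: (@le_trans _ _ ((L + 1) * `|x - y|)).
  by rewrite ler_wpM2r// lerDl.
rewrite -ler_pdivlMl//; near: y; apply: cvgr_dist_le => //.
by rewrite mulr_gt0// invr_gt0.
Unshelve. all: by end_near. Qed.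

End LipSupp.

Section OneDim.
Variable R : realType.
Implicit Types (f g : R -> R) (B : R).
Local Notation mu := (@lebesgue_measure R).

Lemma lip_supp_integrable B f : lip_supp B f -> mu.-integrable setT (EFin \o f).
Proof.
move=> lf; have cf := lip_supp_continuous lf.
have -> : EFin \o f = (EFin \o f) \_ `[- B, B]%classic.
  apply/funext => x; rewrite patchE; case: ifPn => //=.
  rewrite notin_setE/= in_itv/= => /negP; rewrite -ler_norml -ltNge => /lf.2 ->.
  by [].
apply/integrable_restrict => //; rewrite setTI.
apply: continuous_compact_integrable; first exact: segment_compact.
exact: continuous_subspaceT.
Qed.

Lemma Rintegral_lip_supp B B' f : lip_supp B f -> B <= B' ->
  \int[mu]_x f x = \int[mu]_(x in `[- B', B']) f x.
Proof.
move=> lf BB; rewrite [RHS]Rintegral_mkcond; congr Rintegral.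
apply/funext => x; rewrite patchE; case: ifPn => //=.
rewrite notin_setE/= in_itv/= => /negP; rewrite -ler_norml -ltNge => Bx.
by apply: lf.2; exact: le_lt_trans Bx.
Qed.

Lemma Rintegral_lip_bound B f (C : R) : 0 <= B -> lip_supp B f ->
  (forall x, `|f x| <= C) -> `|\int[mu]_x f x| <= C * (B *+ 2).
Proof.
move=> B0 lf fC; rewrite (Rintegral_lip_supp lf (lexx B)).
have il : mu.-integrable `[- B, B] (EFin \o f).
  apply: continuous_compact_integrable; first exact: segment_compact.
  exact/continuous_subspaceT/(lip_supp_continuous lf).
apply: le_trans (le_normr_Rintegral _ il) _ => //.
have <- : \int[mu]_(x in `[- B, B]) C = C * (B *+ 2).
  rewrite Rintegral_cst//= lebesgue_measure_itv/= lte_fin.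
  case: ifPn => [_|]; first by rewrite /= opprK mulr2n.
  rewrite -leNgt lerNr -subr_ge0 -opprD oppr_ge0 => B2.
  have -> : B = 0 by apply/eqP; rewrite eq_le B0 andbT; lra.
  by rewrite mul0rn !mulr0.
apply: le_Rintegral => //.
- apply: continuous_compact_integrable; first exact: segment_compact.
  apply: continuous_subspaceT => x; apply: (@continuous_comp _ _ _ f Num.norm).
    exact: (lip_supp_continuous lf).
  exact: norm_continuous.
- apply: continuous_compact_integrable; first exact: segment_compact.
  by apply: continuous_subspaceT => x; exact: cvg_cst.
Qed.

Lemma Rintegral_lip_shift B f (h : R) : 0 <= B -> lip_supp B f ->
  \int[mu]_x f (x + h) = \int[mu]_x f x.
Proof.
move=> B0 lf; have cf := lip_supp_continuous lf.
have lfh := lip_supp_shift h lf.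
have cfh := lip_supp_continuous lfh.
(* [[a, b]] contains the support of the shifted function and [[a + h, b + h]] that of [f], so the
   substitution formula on segments applies. *)
pose a := - (B + `|h|); pose b := B + `|h|.
have ab : a <= b by rewrite /a /b; have := normr_ge0 h; lra.
rewrite (Rintegral_lip_supp lfh (lexx _)) -/a -/b.
have -> : \int[mu]_x f x = \int[mu]_(x in `[a + h, b + h]) f x.
  rewrite [RHS]Rintegral_mkcond; congr Rintegral.
  apply/funext => x; rewrite patchE; case: ifPn => //=.
  rewrite notin_setE/= in_itv/= => /negP H; apply: lf.2.
  rewrite ltNge; apply/negP => xB. move/negP: H; apply; move: xB; rewrite /a /b ler_norml.
  move=> /andP[x1 x2]; have := ler_norm h; have := ler_norm (- h); rewrite normrN => h1 h2.
  by apply/andP; split; lra.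
pose F (x : R) := x + h.
have dF x : is_derive x (1 : R) F 1.
  by apply: (is_derive_eq (is_deriveD (is_derive_id x 1) (is_derive_cst h x 1))); rewrite addr0.
have F' : derive1 F = cst 1.
  by apply/funext => x; rewrite derive1E derive_val.
rewrite /Rintegral (@integration_by_substitution_increasing _ F f a b)//.
- congr fine; apply: eq_integral => x _ /=; rewrite F'.
  by rewrite [in RHS]/GRing.mul/= mulr1.
- by move=> x y _ _ xy; rewrite /F ltrD2r.
- by rewrite F' => x _; exact: cvg_cst.
- by rewrite F'; apply/cvg_ex; exists 1; exact: cvg_cst.
- by rewrite F'; apply/cvg_ex; exists 1; exact: cvg_cst.
- have cF : continuous F.
    by move=> x; apply: cvgD; [exact: cvg_id|exact: cvg_cst].
  split.
  + by move=> x _.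
  + exact: cvg_at_right_filter (cF _).
  + exact: cvg_at_left_filter (cF _).
- exact: continuous_subspaceT.
Qed.

Lemma Rintegral_lip_eq0 B f : lip_supp B f -> (forall x, 0 <= f x) ->
  \int[mu]_x f x = 0 -> forall x, f x = 0.
Proof.
move=> lf f0 If0 x; apply/eqP; rewrite eq_le f0 andbT leNgt; apply/negP => fx.
have cf := lip_supp_continuous lf.
have fx2 : 0 < f x / 2 by rewrite divr_gt0.
have /cvgrPdist_le/(_ _ fx2)/nbhs_ballP[r/= r0 hr] := cf x.
(* Near [x] the function stays above [f x / 2], so [[x, x + r / 2]] alone would contribute this
   positive amount. *)
have : f x / 2 * (r / 2) <= 0.
  rewrite -If0.
  have <- : \int[mu]_(_ in `[x, x + r / 2]) (f x / 2) = f x / 2 * (r / 2).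
    rewrite Rintegral_cst//= lebesgue_measure_itv/= lte_fin ltrDl divr_gt0//=.
    by rewrite addrAC subrr add0r.
  rewrite Rintegral_mkcond; apply: le_Rintegral => //.
  - have := @continuous_compact_integrable R (cst (f x / 2)) `[x, x + r / 2]%classic.
    rewrite -restrict_EFin => h; apply/integrable_restrict => //; rewrite setTI.
    apply: h; first exact: segment_compact.
    by apply: continuous_subspaceT => z; exact: cvg_cst.
  - exact: (lip_supp_integrable lf).
  - move=> y _; rewrite patchE; case: ifPn => [|_]; last exact: f0.
    rewrite inE/= in_itv/= => /andP[y1 y2].
    have /hr/= : ball x r y.
      by rewrite -ball_normE /ball_/= distrC ger0_norm ?subr_ge0//; lra.
    by rewrite ler_norml => /andP[_]; lra.
by rewrite leNgt mulr_gt0// divr_gt0.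
Qed.

End OneDim.

Section RowMx.
Variables (R : realType) (d : nat).
Implicit Types (t s : R) (x y : 'rV[R]_d).
Local Notation "t :: x" := (row_mx t%:M x : 'rV[R]_(d.+1)).

Lemma row_mx_coord0 t x : (t :: x) 0 0 = t.
Proof.
by rewrite mxE; case: splitP => // j _; rewrite ord1 mxE eqxx mulr1n.
Qed.

Lemma row_mx_coordS t x i : (t :: x) 0 (lift ord0 i) = x 0 i.
Proof.
rewrite mxE; case: splitP => [j|j [/val_inj ->]//].
by rewrite ord1.
Qed.

Lemma row_mx_eta (z : 'rV[R]_d.+1) : z = (z 0 0 :: \row_i z 0 (lift ord0 i)).
Proof.
apply/rowP => i; case: (unliftP ord0 i) => [j ->|->].
  by rewrite row_mx_coordS mxE.
by rewrite row_mx_coord0.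
Qed.

Lemma row_mxB t s x y : (t :: x) - (s :: y) = (t - s :: x - y).
Proof.
apply/rowP => i; rewrite mxE [X in _ + X]mxE; case: (unliftP ord0 i) => [j ->|->].
  by rewrite !row_mx_coordS !mxE.
by rewrite !row_mx_coord0.
Qed.

Lemma row_mxDl t s x y : (t :: x) + (s :: y) = (t + s :: x + y).
Proof.
apply/rowP => i; rewrite mxE; case: (unliftP ord0 i) => [j ->|->].
  by rewrite !row_mx_coordS !mxE.
by rewrite !row_mx_coord0.
Qed.

Lemma norm_row_mx_le t x (b : R) : 0 <= b -> `|t| <= b -> `|x| <= b -> `|t :: x| <= b.
Proof.
move=> b0 tb xb; apply: normrV_le => // i; case: (unliftP ord0 i) => [j ->|->].
  by rewrite row_mx_coordS (le_trans (coord_le_norm _ _)).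
by rewrite row_mx_coord0.
Qed.

Lemma norm_row_mx_ge1 t x : `|t| <= `|t :: x|.
Proof. by have := coord_le_norm (t :: x) 0; rewrite row_mx_coord0. Qed.

Lemma norm_row_mx_ge2 t x : `|x| <= `|t :: x|.
Proof.
apply: normrV_le => // i.
by have := coord_le_norm (t :: x) (lift ord0 i); rewrite row_mx_coordS.
Qed.

Lemma lip_supp_slice (B : R) (F : 'rV[R]_d.+1 -> R) t : lip_supp B F ->
  lip_supp B (fun x => F (t :: x)).
Proof.
move=> [[L L0 LF] sF]; split; last first.
  by move=> x Bx; apply: sF; exact: lt_le_trans Bx (norm_row_mx_ge2 _ _).
exists L => // x y; apply: le_trans (LF _ _) _; rewrite ler_wpM2l// row_mxB subrr.
by apply: norm_row_mx_le; rewrite ?normr0.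
Qed.

Lemma slice0 (B : R) (F : 'rV[R]_d.+1 -> R) t : lip_supp B F -> B < `|t| ->
  (fun x => F (t :: x)) = (fun=> 0).
Proof.
move=> [_ sF] Bt; apply/funext => x; apply: sF.
exact: lt_le_trans Bt (norm_row_mx_ge1 _ _).
Qed.

End RowMx.

Section IntegralRn.
Variable R : realType.
Implicit Type B : R.

Lemma integral_Rn0 d : integral_Rn (fun _ : 'rV[R]_d => 0 : R) = 0.
Proof.
elim: d => //= d IH; rewrite IH.
by rewrite Rintegral_cst// mul0r.
Qed.

(** Linearity and the sup bound go through the induction on the dimension together: in dimension [d]
    both are needed to see that integrating the slices gives a Lipschitz function of the first
    variable, which is then integrable. *)
Let P d := forall B, 0 <= B ->
  (forall (F G : 'rV[R]_d -> R) (a : R), lip_supp B F -> lip_supp B G ->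
    integral_Rn (fun x => a * F x + G x) = a * integral_Rn F + integral_Rn G) /\
  (forall (F : 'rV[R]_d -> R) (C : R), 0 <= C -> lip_supp B F ->
    (forall x, `|F x| <= C) -> `|integral_Rn F| <= C * (B *+ 2) ^+ d).

Let Pslice d B (F : 'rV[R]_d.+1 -> R) : P d -> 0 <= B -> lip_supp B F ->
  lip_supp B (fun t : R => integral_Rn (fun x : 'rV[R]_d => F (row_mx t%:M x))).
Proof.
move=> Pd B0 lF; have [lin bd] := Pd B B0; split; last first.
  by move=> t Bt; rewrite (slice0 lF Bt) integral_Rn0.
have [[L L0 LF] sF] := lF; exists (L * (B *+ 2) ^+ d).
  by rewrite mulr_ge0// exprn_ge0// mulrn_wge0.
move=> t s.
have E := lin _ _ (-1) (lip_supp_slice s lF) (lip_supp_slice t lF).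
have -> : integral_Rn (fun x : 'rV[R]_d => F (row_mx t%:M x)) -
          integral_Rn (fun x : 'rV[R]_d => F (row_mx s%:M x)) =
  integral_Rn (fun x : 'rV[R]_d => -1 * F (row_mx s%:M x) + F (row_mx t%:M x)).
  by rewrite E mulN1r addrC.
rewrite mulrAC; apply: bd; first by rewrite mulr_ge0.
  by apply: lip_suppZD; exact: lip_supp_slice.
move=> x; rewrite mulN1r addrC; apply: le_trans (LF _ _) _; rewrite ler_wpM2l//.
by rewrite row_mxB subrr; apply: norm_row_mx_le; rewrite ?normr0.
Qed.

Let Pall d : P d.
Proof.
elim: d => [|d IH] B B0.
  split=> [F G a _ _|F C C0 _ FC]/=; first by [].
  by rewrite expr0 mulr1.
have [lin bd] := IH B B0; split=> [F G a lF lG|F C C0 lF FC]/=.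
- under eq_Rintegral do rewrite (lin _ _ _ (lip_supp_slice _ lF) (lip_supp_slice _ lG)).
  have iF := lip_supp_integrable (Pslice IH B0 lF).
  have iG := lip_supp_integrable (Pslice IH B0 lG).
  have la : lip_supp B (fun t : R => a * integral_Rn (fun x : 'rV[R]_d => F (row_mx t%:M x)) + 0).
    by apply: lip_suppZD; [exact: Pslice|exact: lip_supp0].
  have iaF : lebesgue_measure.-integrable setT (EFin \o
       (fun t : R => a * integral_Rn (fun x : 'rV[R]_d => F (row_mx t%:M x)))).
    have := lip_supp_integrable la.
    by congr (_.-integrable _ _); apply/funext => t /=; rewrite addr0.
  by rewrite RintegralD// RintegralZl.
- rewrite exprSr mulrA; apply: Rintegral_lip_bound => //; first exact: Pslice.
  by move=> t; apply: bd => //; exact: lip_supp_slice.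
Qed.

Lemma integral_RnZD d B (F G : 'rV[R]_d -> R) (a : R) : 0 <= B ->
  lip_supp B F -> lip_supp B G ->
  integral_Rn (fun x => a * F x + G x) = a * integral_Rn F + integral_Rn G.
Proof. by move=> B0; exact: (Pall d B0).1. Qed.

Lemma integral_Rn_bound d B (F : 'rV[R]_d -> R) (C : R) : 0 <= B -> 0 <= C ->
  lip_supp B F -> (forall x, `|F x| <= C) -> `|integral_Rn F| <= C * (B *+ 2) ^+ d.
Proof. by move=> B0; exact: (Pall d B0).2. Qed.

Lemma integral_Rn_slice d B (F : 'rV[R]_d.+1 -> R) : 0 <= B -> lip_supp B F ->
  lip_supp B (fun t : R => integral_Rn (fun x : 'rV[R]_d => F (row_mx t%:M x))).
Proof. by apply: Pslice; exact: Pall. Qed.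

Lemma integral_Rn_ge0 d (F : 'rV[R]_d -> R) : (forall x, 0 <= F x) -> 0 <= integral_Rn F.
Proof.
elim: d F => [|d IH] F F0 //=.
by apply: Rintegral_ge0 => t _; exact: IH.
Qed.

Lemma integral_Rn_eq0 d B (F : 'rV[R]_d -> R) : 0 <= B -> lip_supp B F ->
  (forall x, 0 <= F x) -> integral_Rn F = 0 -> forall x, F x = 0.
Proof.
move=> B0; elim: d F => [|d IH] F lF F0 /=; first by move=> F00 x; rewrite (thinmx0 x).
move=> I0 x; rewrite (row_mx_eta x).
apply: (IH (fun y => F (row_mx (x 0 0)%:M y))) => //; first exact: lip_supp_slice.
apply: (Rintegral_lip_eq0 (integral_Rn_slice B0 lF)) => //.
by move=> t; exact: integral_Rn_ge0.
Qed.

Lemma integral_Rn_shift d B (F : 'rV[R]_d -> R) (w : 'rV[R]_d) : 0 <= B ->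
  lip_supp B F -> integral_Rn (fun x => F (x + w)) = integral_Rn F.
Proof.
move=> B0; elim: d F w => [|d IH] F w lF /=; first by rewrite (thinmx0 (0 + w)).
rewrite -[RHS](Rintegral_lip_shift (w 0 0) B0 (integral_Rn_slice B0 lF)).
congr Rintegral; apply/funext => t.
rewrite -(IH _ (\row_i w 0 (lift ord0 i)) (lip_supp_slice _ lF)).
congr integral_Rn; apply/funext => x; congr F.
by rewrite {1}(row_mx_eta w) row_mxDl.
Qed.

(** The difference quotient of [F] along [v] has integral 0 by translation invariance, and it
    differs from ['D_v F] by at most [h * L * |v|] on a fixed bounded set. Letting [h] tend to 0
    gives the claim for an arbitrary direction. *)
Lemma integral_Rn_derive d B (F : 'rV[R]_d -> R) (v : 'rV[R]_d) : 0 <= B ->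
  lip_supp B F -> (forall x, derivable F x v) -> lip_supp B ('D_v F) ->
  integral_Rn ('D_v F) = 0.
Proof.
move=> B0 lF dF lD; have [[L L0 LD] sD] := lD.
pose B1 := B + `|v|; have B10 : 0 <= B1 by rewrite addr_ge0.
pose C := L * `|v| * (B1 *+ 2) ^+ d.
have C0 : 0 <= C by rewrite !mulr_ge0// exprn_ge0// mulrn_wge0.
have bound (h : R) : 0 < h -> h <= 1 -> `|integral_Rn ('D_v F)| <= h * C.
  move=> h0 h1.
  have BB : B <= B1 by rewrite lerDl.
  have lF1 := lip_suppW BB lF; have lD1 := lip_suppW BB lD.
  have lFh : lip_supp B1 (fun x => F (x + h *: v)).
    apply: lip_suppW (lip_supp_shift (h *: v) lF).
    by rewrite lerD2l normrZ gtr0_norm// ler_piMl.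
  (* The difference quotient; the final [+ 0] gives it the shape [a * f + g] handled by
     [lip_suppZD]. *)
  pose Q x := h^-1 * (-1 * F x + F (x + h *: v)) + 0.
  have lQ0 := lip_suppZD (-1) lF1 lFh.
  have lQ : lip_supp B1 Q by apply: lip_suppZD => //; exact: lip_supp0.
  have IQ : integral_Rn Q = 0.
    rewrite (integral_RnZD _ B10)//; last exact: lip_supp0.
    rewrite integral_Rn0 addr0 (integral_RnZD _ B10)//.
    by rewrite (integral_Rn_shift _ B0)// mulN1r addrC subrr mulr0.
  have <- : integral_Rn (fun x => -1 * Q x + 'D_v F x) = integral_Rn ('D_v F).
    by rewrite (integral_RnZD _ B10)// IQ mulr0 add0r.
  rewrite /C mulrA; apply: integral_Rn_bound => //.
  - by rewrite !mulr_ge0// ltW.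
  - exact: lip_suppZD.
  - move=> x; have [c cb E] := @MVT_line _ _ F x v h (fun t _ => dF _).
    have -> : Q x = 'D_v F (x + c *: v).
      by rewrite /Q addr0 mulN1r [_ + F _]addrC E mulKf// gt_eqF.
    rewrite mulN1r addrC; apply: le_trans (LD _ _) _.
    rewrite opprD addrA subrr sub0r normrN normrZ mulrCA ler_wpM2r ?mulr_ge0//.
    by rewrite (le_trans cb)// gtr0_norm.
apply/eqP; rewrite -normr_le0 leNgt; apply/negP => I0.
set I := `|_| in I0 bound.
have C1 : 0 < C + 1 by rewrite ltr_wpDl.
(* Since h <= I / (2 (C + 1)), the bound would give I <= h C < I; adding 1 to [C] avoids a zero
   denominator. *)
have := bound (Num.min 1 (I / (C + 1) / 2)).
rewrite lt_min ge_min !lexx ltr01/= !divr_gt0// => /(_ isT isT).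
apply/negP; rewrite -ltNge.
apply: (@le_lt_trans _ _ (I / (C + 1) / 2 * C)).
  by rewrite ler_wpM2r// ge_min lexx orbT.
have E : I = I / (C + 1) * (C + 1) by rewrite divfK// gt_eqF.
by rewrite [ltRHS]E -mulrA ltr_pM2l ?divr_gt0//; lra.
Qed.

End IntegralRn.

Section CompactSupport.
Variables (R : realType) (d : nat).

(** The Lipschitz constant is the sum of the maxima of the partial derivatives over a compact ball
    containing the support. *)
Lemma C1_lip_supp (B : R) (F : 'rV[R]_d -> R) : 0 <= B -> Ck 1 setT F ->
  (forall x, B < `|x| -> F x = 0) -> lip_supp B F.
Proof.
move=> B0 [cF dF] sF; split => //.
have sD i x : B < `|x| -> 'D_(delta_mx 0 i) F x = 0.
  move=> Bx; rewrite -(derive_cst (0 : R) x (delta_mx 0 i)); apply: near_eq_derive.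
  have := @norm_continuous _ _ x => /cvgrPdist_lt/(_ (`|x| - B)).
  rewrite subr_gt0 => /(_ Bx); apply: filterS => y /=.
  by rewrite ltr_norml => /andP[_ h]; apply: sF; lra.
have bnd i : exists2 K, 0 <= K & forall x, `|'D_(delta_mx 0 i) F x| <= K.
  (* The enlarged radius is positive even when [B = 0]. *)
  pose A : set 'rV[R]_d := closed_ball 0 (B + 1).
  have B1 : 0 < B + 1 by rewrite ltr_wpDl.
  have cA : compact A.
    apply: bounded_closed_compact; last exact: closed_ball_closed.
    exists (B + 1); split; first exact: num_real.
    move=> m Bm x; rewrite /A closed_ballE// /closed_ball_/= sub0r normrN => xB.
    exact: le_trans xB (ltW Bm).
  have A0 : A !=set0 by exists 0; exact: closed_ballxx.
  have cD : {within A, continuous (fun x => `|'D_(delta_mx 0 i) F x|)}.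
    apply: continuous_subspaceT => x.
    apply: (@continuous_comp _ _ _ ('D_(delta_mx 0 i) F) Num.norm).
      exact: (dF i).2.1.
    exact: norm_continuous.
  have [c cA' cmax] := EVT_max_rV A0 cA cD.
  exists `|'D_(delta_mx 0 i) F c| => // x.
  have [xB|xB] := lerP `|x| B; last by rewrite sD// normr0.
  apply: cmax; rewrite inE /A closed_ballE// /closed_ball_/= sub0r normrN.
  by rewrite (le_trans xB)// lerDl.
pose K i := sval (cid2 (bnd i)).
have [K0 KD] : (forall i, 0 <= K i) /\ forall i x, `|'D_(delta_mx 0 i) F x| <= K i.
  by split=> i; rewrite /K; case: cid2.
exists (\sum_i K i); first exact: sumr_ge0.
move=> x y.
have dfF z : differentiable F z.
  by apply: (Ck1_differentiable (U := setT)) => //; exact: openT.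
have dvF z : derivable F z (x - y) by apply: diff_derivable; exact: dfF.
have [c _] := @MVT_line _ _ F y (x - y) 1 (fun t _ => dvF _).
rewrite scale1r mul1r [y + _]addrC subrK => ->.
rewrite derive_sum_coord//; apply: le_trans (ler_norm_sum _ _ _) _.
rewrite mulr_suml; apply: ler_sum => i _; rewrite normrM mulrC ler_pM//.
exact: coord_le_norm.
Qed.

Lemma integral_Rn_partial (B : R) (F : 'rV[R]_d -> R) i : 0 <= B -> Ck 2 setT F ->
  (forall x, B < `|x| -> F x = 0) ->
  lip_supp B ('D_(delta_mx 0 i) F) /\ integral_Rn ('D_(delta_mx 0 i) F) = 0.
Proof.
move=> B0 CF sF; have lF := C1_lip_supp B0 (CkW CF) sF.
have lD : lip_supp B ('D_(delta_mx 0 i) F).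
  apply: C1_lip_supp => //; first exact: (CF.2 i).2.
  move=> x Bx; rewrite -(derive_cst (0 : R) x (delta_mx 0 i)); apply: near_eq_derive.
  have := @norm_continuous _ _ x => /cvgrPdist_lt/(_ (`|x| - B)).
  rewrite subr_gt0 => /(_ Bx); apply: filterS => y /=.
  by rewrite ltr_norml => /andP[_ h]; apply: sF; lra.
split => //; apply: (integral_Rn_derive B0 lF) => // x.
exact: (CF.2 i).1.
Qed.

End CompactSupport.
Lemma open_setI_preimage (S T : topologicalType) (A : set S) (W : set T) (g : S -> T) :
  open A -> (forall x, A x -> {for x, continuous g}) -> open W -> open (A `&` g @^-1` W).
Proof.
move=> oA cg oW; rewrite openE => x [Ax Wgx]; apply: filterI.
  exact: open_nbhs_nbhs.
by apply: (cg x Ax); exact: open_nbhs_nbhs.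
Qed.

(** [Ck] asks for ambient continuity and ambient derivatives at the points of [U], so it is a
    pointwise condition and makes sense on a singleton. *)
Lemma Ck_pointwise (R : realType) d r (U : set 'rV[R]_d) (f : 'rV[R]_d -> R) :
  (forall x, U x -> Ck r [set x] f) -> Ck r U f.
Proof.
elim: r f => [|r IH] f Cf.
  by split => // x Ux; exact: (Cf x Ux).1.
split; first by move=> x Ux; exact: (Cf x Ux).1.
move=> i; split; first by move=> x Ux; exact: ((Cf x Ux).2 i).1.
by apply: IH => x Ux; exact: ((Cf x Ux).2 i).2.
Qed.

(** * Germs of smooth functions on R^d *)

Section SmoothR.
Variables (R : realType) (d : nat).
Implicit Types (f g : 'rV[R]_d -> R) (x : 'rV[R]_d).

Definition smoothR f x := exists2 U : set 'rV[R]_d, open U /\ U x & Cinfty U f.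

Lemma smoothR_near f x : smoothR f x -> \forall y \near x, smoothR f y.
Proof.
move=> [U [oU Ux] Cf]; apply: (near_open oU Ux) => y Uy; by exists U.
Qed.

Lemma smoothR_Cinfty (U : set 'rV[R]_d) f : (forall x, U x -> smoothR f x) -> Cinfty U f.
Proof.
move=> h r; apply: Ck_pointwise => x /h[V [_ Vx] Cf].
by apply: Ck_sub (Cf r) => y ->.
Qed.

Lemma smoothR_continuous f x : smoothR f x -> {for x, continuous f}.
Proof. by move=> [U [_ Ux] Cf]; exact: (Cf 0%N).1. Qed.

Lemma smoothR_diff f x : smoothR f x -> differentiable f x.
Proof. by move=> [U [oU Ux] Cf]; exact: (Ck1_differentiable oU (Cf 1%N)). Qed.

Lemma smoothR_partial f x i : smoothR f x -> smoothR ('D_(delta_mx 0 i) f) x.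
Proof.
move=> [U oU Cf]; exists U => // r.
by have [_ /(_ i) []] := Cf r.+1.
Qed.

Lemma smoothR_near_eq f g x : (\forall y \near x, f y = g y) -> smoothR f x -> smoothR g x.
Proof.
move=> /nbhs_interior/nbhs_singleton fg [U [oU Ux] Cf].
have oV : open (U `&` [set y | f y = g y]^°) by apply: openI => //; exact: open_interior.
exists (U `&` [set y | f y = g y]^°) => [|r]; first by [].
apply: (Ck_ext oV) (Ck_sub _ (Cf r)); first by move=> y [_ /interior_subset].
by move=> y [].
Qed.

Let smoothR2 f g x (h : R -> R -> R) : smoothR f x -> smoothR g x ->
  (forall r U, open U -> Ck r U f -> Ck r U g -> Ck r U (fun y => h (f y) (g y))) ->
  smoothR (fun y => h (f y) (g y)) x.
Proof.
move=> [U [oU Ux] Cf] [V [oV Vx] Cg] H; exists (U `&` V) => [|r].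
  by split => //; exact: openI.
by apply: H; [exact: openI|apply: Ck_sub (Cf r) => y []|apply: Ck_sub (Cg r) => y []].
Qed.

Lemma smoothRD f g x : smoothR f x -> smoothR g x -> smoothR (fun y => f y + g y) x.
Proof. by move=> sf sg; apply: smoothR2 sf sg _ => r U; exact: CkD. Qed.

Lemma smoothRM f g x : smoothR f x -> smoothR g x -> smoothR (fun y => f y * g y) x.
Proof. by move=> sf sg; apply: smoothR2 sf sg _ => r U; exact: CkM. Qed.

Lemma smoothR_cst c x : smoothR (fun=> c) x.
Proof. by exists setT => [|r]; [split => //; exact: openT|exact: Ck_cst]. Qed.

Lemma smoothR_coord i x : smoothR (fun y => y 0 i) x.
Proof. by exists setT => [|r]; [split => //; exact: openT|apply: Ck_coord; exact: openT]. Qed.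

Lemma smoothRV f x : smoothR f x -> f x != 0 -> smoothR (fun y => (f y)^-1) x.
Proof.
move=> [U [oU Ux] Cf] fx0.
have oV : open (U `&` f @^-1` [set t | t != 0]).
  by apply: open_setI_preimage oU (Cf 0%N).1 _; exact: open_neq.
exists (U `&` f @^-1` [set t | t != 0]) => [|r]; first by [].
by apply: CkV => //; [move=> y []|apply: Ck_sub (Cf r) => y []].
Qed.

Lemma schwarz_smoothR f x i j : smoothR f x ->
  'D_(delta_mx 0 i) ('D_(delta_mx 0 j) f) x = 'D_(delta_mx 0 j) ('D_(delta_mx 0 i) f) x.
Proof.
move=> [U [oU Ux] Cf]; have [_ Cf2] := Cf 2%N.
apply: schwarz.
- by apply: (near_open oU Ux) => y Uy; split; [exact: (Cf2 j).1|exact: ((Cf2 j).2.2 i).1].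
- by apply: (near_open oU Ux) => y Uy; split; [exact: (Cf2 i).1|exact: ((Cf2 i).2.2 j).1].
- exact: ((Cf2 j).2.2 i).2.1.
- exact: ((Cf2 i).2.2 j).2.1.
Qed.

End SmoothR.

Lemma smoothR_comp (R : realType) d e (f : 'rV[R]_e -> R) (g : 'rV[R]_d -> 'rV[R]_e) x :
  (forall j, smoothR (fun y => g y 0 j) x) -> smoothR f (g x) -> smoothR (f \o g) x.
Proof.
move=> sg [W [oW Wgx] Cf].
have : \forall y \near x, forall j, smoothR (fun y => g y 0 j) y.
  apply: (@filter_forall _ _ (fun j y => smoothR (fun y => g y 0 j) y) (nbhs x) (nbhs_filter x)).
  by move=> j; apply: smoothR_near.
move=> /nbhs_interior/nbhs_singleton; set A := _^° => Ax.
have Ag y : A y -> forall j, smoothR (fun y => g y 0 j) y by move=> /interior_subset.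
have oV : open (A `&` g @^-1` W).
  apply: open_setI_preimage => //; first exact: open_interior.
  by move=> y /Ag h; apply: for_continuous_row => j; exact: smoothR_continuous.
exists (A `&` g @^-1` W) => [|r]; first by [].
apply: (Ck_comp oV oW) => //; first by move=> y [].
by move=> j; apply: smoothR_Cinfty => y [/Ag].
Qed.

(** * Functions and vector fields on a manifold *)

Lemma derive_coordinate (R : realType) d (x v : 'rV[R]_d) i :
  'D_v (fun y : 'rV[R]_d => y 0 i) x = v 0 i.
Proof.
have E : 'D_v id x = \matrix_(a, b) 'D_v (fun y : 'rV[R]_d => y a b) x.
  by apply: derive_mx; exact: derivable_id.
by rewrite derive_id in E; rewrite [in RHS]E mxE.
Qed.

Section Manifold.
Variables (R : realType) (d : nat) (M : manifold R d).
Implicit Types (c : chart R d M) (p q r : M) (f g : M -> R) (v : 'rV[R]_d).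
Local Notation e_ i := (delta_mx 0 i).

Definition smooth_at f q := smoothR (f \o cinv (chart_at q)) (cmap (chart_at q) q).

Definition ccoord c (i : 'I_d) q : R := cmap c q 0 i.

Lemma atlas_chart_at p : in_maximal_atlas (chart_at p).
Proof. by split; [exact: chart_atP|move=> q; split; exact: chart_at_compat]. Qed.

Lemma smooth_transition_chart_at c q : in_maximal_atlas c ->
  smooth_transition c (chart_at q) /\ smooth_transition (chart_at q) c.
Proof. by move=> [_]; apply. Qed.

Section TwoCharts.
Variables c c' : chart R d M.
Hypotheses (ic : is_chart c) (ic' : is_chart c').

Lemma cmap_nearP q (P : M -> Prop) : cdom c q ->
  (\forall r \near q, P r) <-> (\forall x \near cmap c q, P (cinv c x)).
Proof.
have [od oi cK cm ci] := ic => cq; split => h.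
- have : cinv c @ cmap c q --> cinv c (cmap c q) by apply: ci; exists q.
  by rewrite cK// => /(_ _ h).
- have : \forall r \near q, P (cinv c (cmap c r)) by exact: cm h.
  apply: filterS2 (open_nbhs_nbhs (conj od cq)) => r cr.
  by rewrite cK.
Qed.

Lemma cdom_near q : cdom c q -> \forall r \near q, cdom c r.
Proof. by have [od _ _ _ _] := ic => cq; exact: open_nbhs_nbhs. Qed.

Lemma transition_smoothR q i : smooth_transition c c' -> cdom c q -> cdom c' q ->
  smoothR (ccoord c' i \o cinv c) (cmap c q).
Proof.
have [od oi cK cm ci] := ic; have [od' _ _ _ _] := ic' => tr cq cq'.
exists (cmap c @` (cdom c `&` cdom c')); last exact: tr.
split; last by exists q.
suff -> : cmap c @` (cdom c `&` cdom c') = cimg c `&` cinv c @^-1` cdom c'.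
  exact: open_setI_preimage.
apply/seteqP; split => x /=.
  by move=> [r [cr cr']] <-; split; [exists r|rewrite cK].
by move=> [[r cr <-]]; rewrite cK// => cr'; exists r.
Qed.

Lemma transition_near q : cdom c q -> cdom c' q ->
  \forall x \near cmap c q, cmap c' (cinv c x) = (cmap c' \o cinv c) x /\
    cinv c' (cmap c' (cinv c x)) = cinv c x.
Proof.
move=> cq cq'; have [od' _ cK' _ _] := ic'.
apply: (cmap_nearP (fun r => cmap c' r = cmap c' r /\ cinv c' (cmap c' r) = r) cq).1.
by apply: filterS (open_nbhs_nbhs (conj od' cq')) => r cr'; rewrite cK'.
Qed.

Lemma comp_cinv_near f q : cdom c q -> cdom c' q ->
  \forall x \near cmap c q,
   ((f \o cinv c') \o (cmap c' \o cinv c)) x = (f \o cinv c) x.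
Proof. by move=> cq cq'; apply: filterS (transition_near cq cq') => x [_ /= ->]. Qed.

Lemma smoothR_transition f q : smooth_transition c c' -> cdom c q -> cdom c' q ->
  smoothR (f \o cinv c') (cmap c' q) -> smoothR (f \o cinv c) (cmap c q).
Proof.
have [_ _ cK _ _] := ic => tr cq cq' sf.
apply: smoothR_near_eq (comp_cinv_near f cq cq') _.
apply: smoothR_comp => [j|]; first exact: transition_smoothR.
by rewrite /= cK.
Qed.

Lemma chain_charts f q v : smooth_transition c c' -> cdom c q -> cdom c' q ->
  smoothR (f \o cinv c') (cmap c' q) ->
  'D_v (f \o cinv c) (cmap c q) =
  \sum_j 'D_(e_ j) (f \o cinv c') (cmap c' q) * 'D_v (ccoord c' j \o cinv c) (cmap c q).
Proof.
have [_ _ cK _ _] := ic => tr cq cq' sf.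
rewrite -(near_eq_derive v (comp_cinv_near f cq cq')).
rewrite (chain_partial v _ _).2 /=.
- by rewrite cK.
- by rewrite cK//; exact: smoothR_diff.
- by move=> j; apply: smoothR_diff; exact: (transition_smoothR j).
Qed.

End TwoCharts.

Lemma smooth_atP c f q : in_maximal_atlas c -> cdom c q ->
  smooth_at f q <-> smoothR (f \o cinv c) (cmap c q).
Proof.
move=> [ic tr] cq; have [t1 t2] := tr q; have iq := chart_atP q; have qq := mem_chart_at q.
by split => h; [exact: (smoothR_transition ic iq t1)|exact: (smoothR_transition iq ic t2)].
Qed.

Lemma near_smooth_at f q : smooth_at f q -> \forall r \near q, smooth_at f r.
Proof.
move=> sf; have iq := chart_atP q; have qq := mem_chart_at q.
have [_ _ K _ _] := iq.
have n1 := (cmap_nearP iq (cdom (chart_at q)) qq).1 (cdom_near iq qq).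
have n2 : \forall x \near cmap (chart_at q) q, smoothR (f \o cinv (chart_at q)) x.
  exact: smoothR_near.
have n3 : \forall r \near q, smoothR (f \o cinv (chart_at q)) (cmap (chart_at q) r).
  by have [_ _ _ cm _] := iq; exact: cm qq _ n2.
apply: filterS2 (cdom_near iq qq) n3 => r cr sr.
exact/(smooth_atP f (atlas_chart_at q) cr).
Qed.

Lemma smooth_at_near_eq f g q : (\forall r \near q, f r = g r) -> smooth_at f q -> smooth_at g q.
Proof.
move=> fg; apply: smoothR_near_eq.
exact: (cmap_nearP (chart_atP q) (fun r => f r = g r) (mem_chart_at q)).1.
Qed.

Lemma smooth_funP f : smooth_fun f <-> forall q, smooth_at f q.
Proof.
split=> [sf q|sf p].
  exists (cimg (chart_at q)); last exact: sf.
  split; first by have [] := chart_atP q.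
  by exists q => //; exact: mem_chart_at.
apply: smoothR_Cinfty => _ [q cq <-].
exact/(smooth_atP f (atlas_chart_at p) cq).
Qed.

Lemma smooth_at_cst (a : R) q : smooth_at (fun=> a) q.
Proof. exact: smoothR_cst. Qed.

Lemma smooth_atD f g q : smooth_at f q -> smooth_at g q -> smooth_at (fun r => f r + g r) q.
Proof. exact: smoothRD. Qed.

Lemma smooth_atM f g q : smooth_at f q -> smooth_at g q -> smooth_at (fun r => f r * g r) q.
Proof. exact: smoothRM. Qed.

Lemma smooth_atV f q : smooth_at f q -> f q != 0 -> smooth_at (fun r => (f r)^-1) q.
Proof.
have [_ _ K _ _] := chart_atP q.
move=> sf fq; apply: (@smoothRV _ _ (f \o cinv (chart_at q))) => //=.
by rewrite K//; exact: mem_chart_at.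
Qed.

Lemma smooth_at_sum q (I : Type) (s : seq I) (P : pred I) (F : I -> M -> R) :
  (forall i, P i -> smooth_at (F i) q) -> smooth_at (fun r => \sum_(i <- s | P i) F i r) q.
Proof.
move=> sF; rewrite -(_ : (\sum_(i <- s | P i) F i) = (fun r => \sum_(i <- s | P i) F i r)).
  elim/big_ind : _ => //; [exact: smooth_at_cst|by move=> a b; exact: smooth_atD].
by apply/funext => x; rewrite fct_sumE.
Qed.

Lemma smooth_at_prod q (I : Type) (s : seq I) (P : pred I) (F : I -> M -> R) :
  (forall i, P i -> smooth_at (F i) q) -> smooth_at (fun r => \prod_(i <- s | P i) F i r) q.
Proof.
move=> sF; elim: s => [|i s IH].
  rewrite (_ : (fun r => _) = (fun=> 1)); first exact: smooth_at_cst.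
  by apply/funext => r; rewrite big_nil.
case: (boolP (P i)) => Pi; last first.
  rewrite (_ : (fun r => _) = (fun r => \prod_(j <- s | P j) F j r)) //.
  by apply/funext => r; rewrite big_cons (negbTE Pi).
rewrite (_ : (fun r => _) = (fun r => F i r * \prod_(j <- s | P j) F j r)).
  by apply: smooth_atM => //; exact: sF.
by apply/funext => r; rewrite big_cons Pi.
Qed.

Lemma smooth_at_continuous f q : smooth_at f q -> {for q, continuous f}.
Proof.
move=> /smoothR_continuous h; have iq := chart_atP q; have qq := mem_chart_at q.
have [_ _ K cm _] := iq.
have : ((f \o cinv (chart_at q)) \o cmap (chart_at q)) @ q --> f q.
  have h' : (f \o cinv (chart_at q)) @ (cmap (chart_at q) q) --> (f \o cinv (chart_at q)) (cmap (chart_at q) q).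
    exact: h.
  rewrite /= K// in h'.
  exact: (@cvg_comp _ _ _ (cmap (chart_at q)) (f \o cinv (chart_at q)) _ _ _ (cm q qq) h').
apply: cvg_trans; apply: near_eq_cvg.
by apply: filterS (cdom_near iq qq) => r cr /=; rewrite K.
Qed.

Section Vder.
Variables (q : M) (v : 'rV[R]_d).

Lemma vder_near_eq f g : (\forall r \near q, f r = g r) -> vder q v f = vder q v g.
Proof.
move=> fg; apply: near_eq_derive.
exact: (cmap_nearP (chart_atP q) (fun r => f r = g r) (mem_chart_at q)).1.
Qed.

Lemma vder_cst (a : R) : vder q v (fun=> a) = 0.
Proof. exact: derive_cst. Qed.

Lemma vderD f g : smooth_at f q -> smooth_at g q ->
  vder q v (fun r => f r + g r) = vder q v f + vder q v g.
Proof. by move=> /smoothR_diff df /smoothR_diff dg; apply: deriveD; exact: diff_derivable. Qed.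

Lemma vderM f g : smooth_at f q -> smooth_at g q ->
  vder q v (fun r => f r * g r) = f q * vder q v g + g q * vder q v f.
Proof.
have [_ _ K _ _] := chart_atP q.
move=> /smoothR_diff df /smoothR_diff dg; rewrite [LHS]deriveM; try exact: diff_derivable.
by rewrite /= K//; exact: mem_chart_at.
Qed.

Lemma vder_sum (I : Type) (s : seq I) (P : pred I) (F : I -> M -> R) :
  (forall i, P i -> smooth_at (F i) q) ->
  vder q v (fun r => \sum_(i <- s | P i) F i r) = \sum_(i <- s | P i) vder q v (F i).
Proof.
move=> sF; elim: s => [|i s IH].
  rewrite big_nil -[RHS](vder_cst 0); congr vder.
  by apply/funext => r; rewrite big_nil.
rewrite big_cons; case: (boolP (P i)) => Pi; last first.
  rewrite -IH; congr vder.
  by apply/funext => r; rewrite big_cons (negbTE Pi).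
rewrite -IH -vderD; [|exact: sF|exact: smooth_at_sum].
by congr vder; apply/funext => r; rewrite big_cons Pi.
Qed.

End Vder.

Lemma vder_linear q (a : R) u v f : smooth_at f q ->
  vder q (a *: u + v) f = a * vder q u f + vder q v f.
Proof. by move=> /smoothR_diff df; rewrite /vder !deriveE// linearP. Qed.

Lemma vder0 q f : vder q 0 f = 0.
Proof. exact: derive0. Qed.

Lemma vderZv q (a : R) v f : smooth_at f q -> vder q (a *: v) f = a * vder q v f.
Proof. by move=> sf; rewrite -[a *: v]addr0 vder_linear// vder0 addr0. Qed.

Lemma vderDv q u v f : smooth_at f q -> vder q (u + v) f = vder q u f + vder q v f.
Proof. by move=> sf; rewrite -[u]scale1r vder_linear// mul1r scale1r. Qed.

Lemma vder_sum_coord q v f : smooth_at f q ->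
  vder q v f = \sum_i v 0 i * vder q (e_ i) f.
Proof. by move=> /smoothR_diff df; rewrite /vder derive_sum_coord. Qed.

Lemma vder_coord q v i : vder q v (Defs.coord q i) = v 0 i.
Proof.
have [_ oi _ _ _] := chart_atP q.
have qi : cimg (chart_at q) (cmap (chart_at q) q) by exists q => //; exact: mem_chart_at.
transitivity ('D_v (fun x : 'rV[R]_d => x 0 i) (cmap (chart_at q) q)).
  apply: near_eq_derive; apply: (near_open oi qi) => _ [r cr <-].
  by have [_ _ K _ _] := chart_atP q; rewrite /= /Defs.coord K.
exact: derive_coordinate.
Qed.

Lemma smooth_at_ccoord c i q : in_maximal_atlas c -> cdom c q -> smooth_at (ccoord c i) q.
Proof.
move=> ac cq; apply/(smooth_atP _ ac cq).
have [[_ oi K _ _] _] := ac.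
apply: (@smoothR_near_eq _ _ (fun x => x 0 i)); last exact: smoothR_coord.
have qi : cimg c (cmap c q) by exists q.
by apply: (near_open oi qi) => _ [r cr <-]; rewrite /= /ccoord K.
Qed.

Lemma vder_chart c f q v : in_maximal_atlas c -> cdom c q -> smooth_at f q ->
  vder q v f = \sum_i vder q v (ccoord c i) * 'D_(e_ i) (f \o cinv c) (cmap c q).
Proof.
move=> ac cq /(smooth_atP _ ac cq) sf.
rewrite /vder (chain_charts (chart_atP q) ac.1)//; first by apply: eq_bigr => i _; rewrite mulrC.
  by have [] := smooth_transition_chart_at q ac.
exact: mem_chart_at.
Qed.

Lemma vder_coord_frame c f q i : in_maximal_atlas c -> cdom c q -> smooth_at f q ->
  vder q (row i (coord_frame c q)) f = 'D_(e_ i) (f \o cinv c) (cmap c q).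
Proof.
move=> ac cq sf; rewrite vder_sum_coord//.
rewrite (chain_charts ac.1 (chart_atP q))//; last 2 first.
  by have [] := smooth_transition_chart_at q ac.
  exact: mem_chart_at.
by apply: eq_bigr => j _; rewrite !mxE mulrC.
Qed.

Definition dcoord c q v : 'rV[R]_d := \row_i vder q v (ccoord c i).

Lemma dcoord_coord_frame c q i : in_maximal_atlas c -> cdom c q ->
  dcoord c q (row i (coord_frame c q)) = e_ i.
Proof.
move=> ac cq; apply/rowP => j; rewrite mxE vder_coord_frame//; last exact: smooth_at_ccoord.
have [[_ oi K _ _] _] := ac.
have qi : cimg c (cmap c q) by exists q.
transitivity ('D_(e_ i) (fun x : 'rV[R]_d => x 0 j) (cmap c q)).
  apply: near_eq_derive; apply: (near_open oi qi) => _ [r cr <-].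
  by rewrite /= /ccoord K.
exact: derive_coordinate.
Qed.

Lemma dcoordK c q v : in_maximal_atlas c -> cdom c q ->
  dcoord c q v *m coord_frame c q = v.
Proof.
move=> ac cq; apply/rowP => j; rewrite -[RHS](vder_coord q) (vder_chart _ ac cq).
  rewrite mxE; apply: eq_bigr => i _; rewrite !mxE; congr (_ * _).
by apply: (smooth_at_ccoord _ (atlas_chart_at q)); exact: mem_chart_at.
Qed.

Lemma coord_frame_unit c q : in_maximal_atlas c -> cdom c q -> coord_frame c q \in unitmx.
Proof.
move=> ac cq; pose B := \matrix_i dcoord c q (e_ i).
have : B *m coord_frame c q = 1%:M.
  by apply/row_matrixP => i; rewrite row_mul rowK dcoordK// row1.
by move=> /mulmx1_unit [].
Qed.

Lemma dcoordE c q v : in_maximal_atlas c -> cdom c q ->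
  dcoord c q v = v *m invmx (coord_frame c q).
Proof. by move=> ac cq; rewrite -{2}(dcoordK v ac cq) mulmxK// coord_frame_unit. Qed.

Lemma coord_frame_id q : coord_frame (chart_at q) q = 1%:M.
Proof.
have aq := atlas_chart_at q; have qq := mem_chart_at q.
apply/row_matrixP => i; rewrite row1 -(dcoord_coord_frame i aq qq).
by apply/rowP => j; rewrite [RHS]mxE [RHS]vder_coord.
Qed.

(** A chart-free test. The definition differentiates only coordinate functions of atlas charts;
    acting on all smooth germs is the form in which sums, multiples and brackets are handled. *)
Lemma smooth_vfP (X : vfield M) : smooth_vf X <->
  forall f q, smooth_at f q -> smooth_at (fun r => vder r (X r) f) q.
Proof.
split=> [sX f q sf|h p i]; last first.
  apply: smoothR_Cinfty => _ [q cq <-]; apply/(smooth_atP _ (atlas_chart_at p) cq).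
  by apply: h; exact: (smooth_at_ccoord _ (atlas_chart_at p) cq).
have aq := atlas_chart_at q; have qq := mem_chart_at q.
apply: (@smooth_at_near_eq (fun r => \sum_i vder r (X r) (Defs.coord q i) *
    ('D_(e_ i) (f \o cinv (chart_at q)) (cmap (chart_at q) r)))).
  have n1 := near_smooth_at sf; apply: filterS2 (cdom_near (chart_atP q) qq) n1 => r cr sr.
  by rewrite (vder_chart _ aq cr sr).
apply: smooth_at_sum => i _; apply: smooth_atM.
  exists (cimg (chart_at q)); last exact: sX.
  split; first by have [] := chart_atP q.
  by exists q.
apply: (@smoothR_near_eq _ _ ('D_(e_ i) (f \o cinv (chart_at q)))); last exact: smoothR_partial.
have [_ oi K _ _] := chart_atP q.
have qi : cimg (chart_at q) (cmap (chart_at q) q) by exists q.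
by apply: (near_open oi qi) => _ [r cr <-]; rewrite /= K.
Qed.

Lemma smooth_at_partial c f q i : in_maximal_atlas c -> cdom c q -> smooth_at f q ->
  smooth_at (fun r => 'D_(e_ i) (f \o cinv c) (cmap c r)) q.
Proof.
move=> ac cq /(smooth_atP _ ac cq) sf; apply/(smooth_atP _ ac cq).
apply: (@smoothR_near_eq _ _ ('D_(e_ i) (f \o cinv c))); last exact: smoothR_partial.
have [[_ oi K _ _] _] := ac.
have qi : cimg c (cmap c q) by exists q.
by apply: (near_open oi qi) => _ [r cr <-]; rewrite /= K.
Qed.

(** Outside the chart domain [f] is locally zero, because a compact [S] is closed in the Hausdorff
    space [M]. *)
Lemma smooth_at_supported c (S : set M) f : in_maximal_atlas c -> compact S ->
  (forall q, ~ S q -> f q = 0) -> S `<=` cdom c ->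
  (forall q, cdom c q -> smooth_at f q) -> forall q, smooth_at f q.
Proof.
move=> ac cS f0 Sc sf q; case: (pselect (cdom c q)) => [/sf//|ncq].
have oS : open (~` S).
  by apply: closed_openC; apply: compact_closed => //; exact: (@points_hausdorff _ _ M).
apply: (@smooth_at_near_eq (fun=> 0)); last exact: smooth_at_cst.
have nSq : (~` S) q by move=> /Sc.
by apply: filterS (open_nbhs_nbhs (conj oS nSq)) => r nS; rewrite f0.
Qed.

Lemma cutoff c q : in_maximal_atlas c -> cdom c q -> exists chi : M -> R, exists S : set M,
  [/\ smooth_fun chi, forall r, 0 <= chi r, \forall r \near q, chi r = 1 &
   [/\ compact S, S `<=` cdom c & forall r, ~ S r -> chi r = 0]].
Proof.
move=> ac cq; have [[od oi K cm ci] _] := ac; pose x := cmap c q.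
have : nbhs x (cimg c) by apply: open_nbhs_nbhs; split => //; exists q.
move=> /nbhs_ballP[e /= e0 eU].
have e20 : 0 < e / 2 by rewrite divr_gt0.
have [b [Cb b0 b1 bs]] := bump_function x e20.
(* The closed ball of half the radius is compact and stays inside the chart image; [chi] is the bump
   read in the chart and extended by 0. *)
pose B : set 'rV[R]_d := closed_ball x (e / 2).
have BU : B `<=` cimg c.
  move=> y; rewrite /B closed_ballE// /closed_ball_/= => h; apply: eU.
  rewrite -ball_normE /ball_/=; apply: le_lt_trans h _.
  by rewrite ltr_pdivrMr// ltr_pMr// ltr1n.
pose S := cinv c @` B.
have Sc : S `<=` cdom c by move=> _ [y /BU [r cr <-] <-]; rewrite K.
have cS : compact S.
  apply: continuous_compact.
    apply: continuous_in_subspaceT => y; rewrite inE => /BU; exact: ci.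
  apply: bounded_closed_compact; last exact: closed_ball_closed.
  exists (`|x| + e / 2); split; first exact: num_real.
  move=> m hm y; rewrite /B closed_ballE// /closed_ball_/= => h.
  apply: le_trans (ltW hm); rewrite -[y](subKr x) (le_trans (ler_normB _ _))//.
  by rewrite lerD2l.
pose chi r : R := if r \in cdom c then b (cmap c r) else 0.
have chi0 r : ~ S r -> chi r = 0.
  move=> nS; rewrite /chi; case: ifPn => // /set_mem cr.
  apply: bs; rewrite leNgt; apply/negP => h; apply: nS; exists (cmap c r); last exact: K.
  by rewrite /B closed_ballE// /closed_ball_/= distrC ltW.
have chiE r : cdom c r -> chi r = b (cmap c r) by move=> cr; rewrite /chi mem_set.
exists chi, S; split => //.
- apply/smooth_funP; apply: (smooth_at_supported ac cS chi0 Sc) => r cr.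
  apply/(smooth_atP _ ac cr); apply: (@smoothR_near_eq _ _ b).
    have ri : cimg c (cmap c r) by exists r.
    by apply: (near_open oi ri) => _ [r' cr' <-]; rewrite /= K// chiE.
  by exists setT => //; split => //; exact: openT.
- by move=> r; rewrite /chi; case: ifP.
- have n1 : \forall r \near q, b (cmap c r) = 1 by exact: cm cq _ b1.
  by apply: filterS2 (cdom_near ac.1 cq) n1 => r cr <-; rewrite chiE.
Qed.

(** Connections and [smooth_vf] speak of globally defined fields, so the coordinate fields of a
    chart are replaced by cut-off copies that agree with them near [q]. *)
Lemma frame_extension c q : in_maximal_atlas c -> cdom c q ->
  exists X : 'I_d -> vfield M, (forall i, smooth_vf (X i)) /\
   \forall r \near q, forall i, X i r = row i (coord_frame c r).
Proof.
move=> ac cq; have [chi [S [sc c0 c1 [cS Sc cz]]]] := cutoff ac cq.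
exists (fun i r => chi r *: row i (coord_frame c r)); split; last first.
  by apply: filterS c1 => r -> i; rewrite scale1r.
move=> i; apply/smooth_vfP => f p sf.
case: (pselect (cdom c p)) => [cp|ncp].
  apply: (@smooth_at_near_eq (fun r => chi r * 'D_(e_ i) (f \o cinv c) (cmap c r))).
    have n1 := near_smooth_at sf; apply: filterS2 (cdom_near ac.1 cp) n1 => r cr sr.
    by rewrite -(vder_coord_frame i ac cr sr) vderZv.
  by apply: smooth_atM; [move/smooth_funP : sc; exact|exact: smooth_at_partial].
have oS : open (~` S).
  by apply: closed_openC; apply: compact_closed => //; exact: (@points_hausdorff _ _ M).
apply: (@smooth_at_near_eq (fun=> 0)); last exact: smooth_at_cst.
have nSq : (~` S) p by move=> /Sc.
by apply: filterS (open_nbhs_nbhs (conj oS nSq)) => r nS; rewrite cz// scale0r vder0.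
Qed.

Lemma smooth_vder (X : vfield M) f : smooth_vf X -> smooth_fun f ->
  smooth_fun (fun r => vder r (X r) f).
Proof. by move=> /smooth_vfP sX /smooth_funP sf; apply/smooth_funP => q; exact: sX. Qed.

Lemma smooth_vfZ f (X : vfield M) : smooth_fun f -> smooth_vf X ->
  smooth_vf (fun r => f r *: X r).
Proof.
move=> /smooth_funP sf /smooth_vfP sX; apply/smooth_vfP => g q sg.
apply: (@smooth_at_near_eq (fun r => f r * vder r (X r) g)).
  apply: filterS (near_smooth_at sg) => r sr.
  by rewrite vderZv.
by apply: smooth_atM => //; exact: sX.
Qed.

Lemma smooth_vfD (X Y : vfield M) : smooth_vf X -> smooth_vf Y ->
  smooth_vf (fun r => X r + Y r).
Proof.
move=> /smooth_vfP sX /smooth_vfP sY; apply/smooth_vfP => g q sg.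
apply: (@smooth_at_near_eq (fun r => vder r (X r) g + vder r (Y r) g)).
  apply: filterS (near_smooth_at sg) => r sr.
  by rewrite vderDv.
by apply: smooth_atD; [exact: sX|exact: sY].
Qed.

Lemma smooth_fun_cst (a : R) : smooth_fun (fun _ : M => a).
Proof. by apply/smooth_funP => q; exact: smooth_at_cst. Qed.

Lemma smooth_vf0 : smooth_vf (fun _ : M => 0).
Proof.
apply/smooth_vfP => f q sf; apply: (@smooth_at_near_eq (fun=> 0)); last exact: smooth_at_cst.
by apply: nearW => r; rewrite vder0.
Qed.

Lemma smooth_vf_sum (I : Type) (s : seq I) (P : pred I) (X : I -> vfield M) :
  (forall i, smooth_vf (X i)) -> smooth_vf (fun r => \sum_(i <- s | P i) X i r).
Proof.
move=> sX; elim: s => [|i s IH].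
  rewrite (_ : (fun r => _) = (fun=> 0)); first exact: smooth_vf0.
  by apply/funext => r; rewrite big_nil.
case: (boolP (P i)) => Pi; last first.
  rewrite (_ : (fun r => _) = (fun r => \sum_(j <- s | P j) X j r)) //.
  by apply/funext => r; rewrite big_cons (negbTE Pi).
rewrite (_ : (fun r => _) = (fun r => X i r + \sum_(j <- s | P j) X j r)).
  exact: smooth_vfD.
by apply/funext => r; rewrite big_cons Pi.
Qed.

Lemma vfield_extension q v : exists X : vfield M, smooth_vf X /\ X q = v.
Proof.
have aq := atlas_chart_at q; have qq := mem_chart_at q.
have [X [sX XE]] := frame_extension aq qq.
exists (fun r => \sum_i v 0 i *: X i r); split.
  by apply: smooth_vf_sum => i; apply: smooth_vfZ => //; exact: smooth_fun_cst.
rewrite [RHS]row_sum_delta; apply: eq_bigr => i _.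
by rewrite (nbhs_singleton XE) coord_frame_id row1.
Qed.

(** [lie] is defined by coordinates in one chart. Expanding both iterated derivatives in that chart,
    the first-order terms give the bracket and the second-order terms cancel by symmetry of second
    derivatives. *)
Lemma vder_lie (X Y : vfield M) q f : smooth_vf X -> smooth_vf Y -> smooth_at f q ->
  vder q (lie X Y q) f = vder q (X q) (fun r => vder r (Y r) f) -
                         vder q (Y q) (fun r => vder r (X r) f).
Proof.
move=> sX sY sf; have aq := atlas_chart_at q; have qq := mem_chart_at q.
pose g i r := 'D_(e_ i) (f \o cinv (chart_at q)) (cmap (chart_at q) r).
have sg i : smooth_at (g i) q by exact: smooth_at_partial.
have sc i : smooth_at (Defs.coord q i) q by exact: (smooth_at_ccoord _ aq qq).
have gE i : g i q = vder q (e_ i) f by [].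
have E (Z : vfield M) (w : 'rV[R]_d) : smooth_vf Z -> vder q w (fun r => vder r (Z r) f) =
   \sum_i (vder q w (fun r => vder r (Z r) (Defs.coord q i)) * g i q) +
   \sum_i \sum_j w 0 j * Z q 0 i * vder q (e_ j) (g i).
  move=> sZ; transitivity (vder q w (fun r => \sum_i vder r (Z r) (Defs.coord q i) * g i r)).
    apply: vder_near_eq.
    apply: filterS2 (cdom_near (chart_atP q) qq) (near_smooth_at sf) => r cr sr.
    by rewrite (vder_chart _ aq cr sr).
  have sZ' i : smooth_at (fun r => vder r (Z r) (Defs.coord q i)) q by move/smooth_vfP : sZ; apply.
  rewrite vder_sum; last by move=> i _; exact: smooth_atM.
  rewrite -big_split/=; apply: eq_bigr => i _; rewrite vderM// addrC.
  rewrite [g i q * _]mulrC; congr (_ + _).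
  rewrite vder_coord (vder_sum_coord _ (sg i)) mulr_sumr; apply: eq_bigr => j _.
  by rewrite mulrCA mulrA.
rewrite !E// opprD addrACA -!sumrB.
have gs i j : vder q (e_ j) (g i) = vder q (e_ i) (g j).
  have gC k l : vder q (e_ k) (g l) =
     'D_(e_ k) ('D_(e_ l) (f \o cinv (chart_at q))) (cmap (chart_at q) q).
    apply: near_eq_derive; have [_ oi K _ _] := chart_atP q.
    have qi : cimg (chart_at q) (cmap (chart_at q) q) by exists q.
    by apply: (near_open oi qi) => _ [r cr <-]; rewrite /g /= K.
  by rewrite !gC schwarz_smoothR.
rewrite [X in _ + X](_ : _ = 0) ?addr0; last first.
  rewrite sumrB [X in _ - X]exchange_big/=; apply/eqP; rewrite subr_eq0; apply/eqP.
  apply: eq_bigr => i _; apply: eq_bigr => j _.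
  by rewrite gs [Y q 0 i * _]mulrC.
rewrite vder_sum_coord//; apply: eq_bigr => i _.
by rewrite !mxE mulrBl gE.
Qed.

End Manifold.

(** * Multilinear and alternating forms *)

Local Notation alternating := Defs.alternating.

Lemma big_ffun_insert (V : nmodType) (T : finType) q (j : 'I_q.+1) (F : {ffun 'I_q.+1 -> T} -> V) :
  \sum_I F I = \sum_i \sum_(J : {ffun 'I_q -> T})
     F [ffun a => if unlift j a is Some b then J b else i].
Proof.
rewrite pair_big/=.
pose ins (p : T * {ffun 'I_q -> T}) : {ffun 'I_q.+1 -> T} :=
  [ffun a => if unlift j a is Some b then p.2 b else p.1].
rewrite (reindex ins)//; exists (fun I : {ffun 'I_q.+1 -> T} => (I j, [ffun b : 'I_q => I (lift j b)])).
  move=> [i J] _; congr pair; first by rewrite /ins ffunE unlift_none.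
  by apply/ffunP => b; rewrite !ffunE liftK.
move=> I _; apply/ffunP => a; rewrite ffunE /=; case: (unliftP j a) => [b|] ->//.
by rewrite ffunE.
Qed.

Lemma big_perm_lift (V : nmodType) q (F : 'S_q.+1 -> V) :
  \sum_s F s = \sum_(j < q.+1) \sum_(u : 'S_q) F (lift_perm ord0 j u).
Proof.
rewrite pair_big/= (reindex (fun p : 'I_q.+1 * 'S_q => lift_perm ord0 p.1 p.2))//.
have inj (s : 'S_q.+1) : injective (fun k : 'I_q => odflt k (unlift (s ord0) (s (lift ord0 k)))).
  move=> k l /=; have nk (a : 'I_q) : s ord0 != s (lift ord0 a).
    by rewrite (inj_eq perm_inj) neq_lift.
  have [a Ea ->] := unlift_some (nk k); have [b Eb ->] /= := unlift_some (nk l).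
  by move=> ab; rewrite ab -Eb in Ea; move/perm_inj/lift_inj : Ea.
exists (fun s : 'S_q.+1 => (s ord0, perm (inj s))).
  move=> [j u] _ /=; congr pair; first by rewrite lift_perm_id.
  apply/permP => k.
  by rewrite permE lift_perm_id lift_perm_lift liftK.
move=> s _ /=; apply/permP => k; case: (unliftP ord0 k) => [a|] ->; last first.
  by rewrite lift_perm_id.
rewrite lift_perm_lift permE.
have nk : s ord0 != s (lift ord0 a) by rewrite (inj_eq perm_inj) neq_lift.
by have [b Eb ->] := unlift_some nk.
Qed.

Section Multilinear.
Variables (K : numFieldType) (d : nat).

Lemma row_set_row q (j i : 'I_q) (w : 'rV[K]_d) (A : 'M[K]_(q, d)) :
  row i (set_row j w A) = if i == j then w else row i A.
Proof. by rewrite rowK. Qed.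

Lemma set_row_id q (j : 'I_q) (A : 'M[K]_(q, d)) : set_row j (row j A) A = A.
Proof. by apply/row_matrixP => i; rewrite row_set_row; case: eqP => // ->. Qed.

Lemma set_rowC q (i j : 'I_q) u v (A : 'M[K]_(q, d)) : i != j ->
  set_row i u (set_row j v A) = set_row j v (set_row i u A).
Proof.
move=> ij; apply/row_matrixP => k; rewrite !row_set_row.
by case: eqP => [->|//]; rewrite (negbTE ij).
Qed.

Section OneForm.
Variables (q : nat) (w : mform K d q).
Hypothesis mw : multilinear w.

Lemma multilinearD A j u v : w (set_row j (u + v) A) = w (set_row j u A) + w (set_row j v A).
Proof. by rewrite -[u]scale1r mw mul1r scale1r. Qed.

Lemma multilinear0 A j : w (set_row j 0 A) = 0.
Proof.
have /eqP := multilinearD A j 0 0; rewrite addr0 -subr_eq0.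
by rewrite opprD addrA subrr sub0r oppr_eq0 => /eqP.
Qed.

Lemma multilinear_sum A j (I : Type) (s : seq I) (P : pred I) (a : I -> K) (u : I -> 'rV[K]_d) :
  w (set_row j (\sum_(i <- s | P i) a i *: u i) A) = \sum_(i <- s | P i) a i * w (set_row j (u i) A).
Proof.
elim: s => [|i s IH]; first by rewrite !big_nil multilinear0.
by rewrite !big_cons; case: ifP => // _; rewrite mw IH.
Qed.

End OneForm.

Lemma row_col_mx0 q (u : 'rV[K]_d) (A : 'M[K]_(q, d)) : row ord0 (col_mx u A : 'M[K]_(q.+1, d)) = u.
Proof.
apply/rowP => j; rewrite !mxE; case: splitP => // k _.
by rewrite ord1.
Qed.

Lemma row_col_mxS q (u : 'rV[K]_d) (A : 'M[K]_(q, d)) i :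
  row (lift ord0 i) (col_mx u A : 'M[K]_(q.+1, d)) = row i A.
Proof.
apply/rowP => j; rewrite !mxE; case: splitP => [k|k [/val_inj ->]//].
by rewrite ord1.
Qed.

Lemma set_row_col_mx0 q (u v : 'rV[K]_d) (A : 'M[K]_(q, d)) :
  set_row ord0 v (col_mx u A : 'M[K]_(q.+1, d)) = col_mx v A.
Proof.
apply/row_matrixP => i; rewrite row_set_row; case: (unliftP ord0 i) => [j|] ->.
  by rewrite !row_col_mxS.
by rewrite eqxx row_col_mx0.
Qed.

Lemma set_row_col_mxS q (u v : 'rV[K]_d) (A : 'M[K]_(q, d)) j :
  set_row (lift ord0 j) v (col_mx u A : 'M[K]_(q.+1, d)) = col_mx u (set_row j v A).
Proof.
apply/row_matrixP => i; rewrite row_set_row; case: (unliftP ord0 i) => [k|] ->.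
  by rewrite !row_col_mxS row_set_row (inj_eq lift_inj).
by rewrite !row_col_mx0.
Qed.

Lemma multilinear_col_mx q (w : mform K d q.+1) (u : 'rV[K]_d) : multilinear w ->
  multilinear (fun A : 'M[K]_(q, d) => w (col_mx u A)).
Proof. by move=> mw A j a x y; rewrite -!set_row_col_mxS mw. Qed.

Lemma alternating_col_mx q (w : mform K d q.+1) (u : 'rV[K]_d) : alternating w ->
  alternating (fun A : 'M[K]_(q, d) => w (col_mx u A)).
Proof.
move=> aw A i j ij Aij; apply: (aw _ (lift ord0 i) (lift ord0 j)).
  by rewrite (inj_eq lift_inj).
by rewrite !row_col_mxS.
Qed.

Lemma multilinear_expand q m (w : mform K d q) (B : 'M[K]_(q, m)) (F : 'M[K]_(m, d)) :
  multilinear w ->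
  w (B *m F) = \sum_(I : {ffun 'I_q -> 'I_m})
    (\prod_a B a (I a)) * w (\matrix_a row (I a) F).
Proof.
elim: q w B => [|q IH] w B mw.
  have -> : \sum_(I : {ffun 'I_0 -> 'I_m}) (\prod_a B a (I a)) * w (\matrix_a row (I a) F) =
            \sum_(I : {ffun 'I_0 -> 'I_m}) w (B *m F).
    apply: eq_bigr => I _; rewrite big_ord0 mul1r; congr w.
    by apply/matrixP => -[].
  by rewrite sumr_const card_ffun !card_ord expn0.
have E : (B *m F : 'M[K]_(q.+1, d)) = set_row ord0 (\sum_i B ord0 i *: row i F)
    (col_mx (0 : 'rV[K]_d) (row' ord0 B *m F : 'M[K]_(q, d))).
  apply/row_matrixP => i; rewrite set_row_col_mx0.
  case: (unliftP ord0 i) => [k|] ->.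
    rewrite row_col_mxS !row_mul; congr (_ *m _).
    by apply/rowP => l; rewrite !mxE.
  rewrite row_col_mx0 row_mul mulmx_sum_row; apply: eq_bigr => j _.
  by rewrite mxE.
rewrite E multilinear_sum// (big_ffun_insert ord0); apply: eq_bigr => i _.
rewrite set_row_col_mx0 (IH (fun A => w (col_mx (row i F) A))); last exact: multilinear_col_mx.
rewrite mulr_sumr; apply: eq_bigr => J _.
rewrite big_ord_recl ffunE unlift_none -mulrA; congr (_ * (_ * w _)).
  by apply: eq_bigr => a _; rewrite ffunE liftK mxE.
apply/row_matrixP => a; rewrite rowK; case: (unliftP ord0 a) => [k|] ->.
  by rewrite row_col_mxS rowK ffunE liftK.
by rewrite row_col_mx0 ffunE unlift_none.
Qed.

Lemma row_row_perm q (s : 'S_q) (A : 'M[K]_(q, d)) i : row i (row_perm s A) = row (s i) A.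
Proof. by apply/rowP => j; rewrite !mxE. Qed.

Definition antisymmetric_form q (w : mform K d q) : Prop :=
  forall s A, w (row_perm s A) = (-1) ^+ s * w A.

Lemma antisymmetric_alternating q (w : mform K d q) : antisymmetric_form w -> alternating w.
Proof.
move=> h A i j ij Aij; have := h (tperm i j) A.
have -> : row_perm (tperm i j) A = A.
  apply/row_matrixP => k; rewrite row_row_perm.
  by case: tpermP => [->|->|].
rewrite odd_tperm ij expr1 mulN1r => /eqP; rewrite -addr_eq0 -mulr2n.
by rewrite -mulr_natl mulf_eq0 pnatr_eq0/= => /eqP.
Qed.

Lemma alternating_antisymmetric q (w : mform K d q) : multilinear w -> alternating w ->
  antisymmetric_form w.
Proof.
move=> mw aw.
have T i j A : i != j -> w (row_perm (tperm i j) A) = - w A.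
  move=> ij; have ji : j != i by rewrite eq_sym.
  pose B u v := set_row i u (set_row j v A).
  have z u : w (B u u) = 0.
    apply: (aw _ i j ij); rewrite /B !row_set_row !eqxx.
    by rewrite (negbTE ji).
  have BD u v x y : w (B (u + v) (x + y)) = w (B u x) + w (B u y) + (w (B v x) + w (B v y)).
    by rewrite /B multilinearD// !(set_rowC _ _ _ ij) !multilinearD.
  have := z (row i A + row j A); rewrite BD !z add0r addr0 => /eqP.
  rewrite addr_eq0 => /eqP E.
  have E1 : B (row i A) (row j A) = A by rewrite /B !set_row_id.
  have -> : row_perm (tperm i j) A = B (row j A) (row i A).
    apply/row_matrixP => k; rewrite row_row_perm /B !row_set_row.
    case: tpermP => [->|->|/eqP/negbTE -> /eqP/negbTE ->//]; first by rewrite eqxx.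
    by rewrite (negbTE ji) eqxx.
  by apply/eqP; rewrite -eqr_oppLR -E E1.
move=> s A; case: (prod_tpermP s) => ts -> {s} dts.
elim: ts dts A => [|t ts IH] /= dts A.
  by rewrite big_nil odd_perm1 expr0 mul1r row_perm1.
move: dts => /andP[dt dts]; rewrite big_cons row_permM T// IH//.
by rewrite odd_mul_tperm dt signr_addb expr1 mulN1r mulNr.
Qed.

(** Some row is a combination of the others; expanding along it leaves only values with a repeated
    row. *)
Lemma alternating_rank q (w : mform K d q) A : multilinear w -> alternating w ->
  (\rank A < q)%N -> w A = 0.
Proof.
move=> mw aw rA.
have : ~~ row_free A by rewrite /row_free neq_ltn rA.
rewrite -kermx_eq0 => /rowV0Pn[u /sub_kermxP uA u0].
have [j uj] : exists j, u 0 j != 0.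
  apply/existsP; rewrite -negb_forall; apply: contra u0 => /forallP h.
  by apply/eqP/rowP => j; rewrite mxE; exact/eqP/h.
have E : row j A = \sum_(i | i != j) (- (u 0 j)^-1 * u 0 i) *: row i A.
  have : (u *m A) = 0 by [].
  rewrite mulmx_sum_row (bigD1 j)//= => /eqP; rewrite addr_eq0 => /eqP h.
  apply: (scalerI uj); rewrite h scaler_sumr -sumrN; apply: eq_bigr => i _.
  by rewrite scalerA mulrA mulrN mulfV// mulN1r scaleNr.
rewrite -[A](set_row_id j) E multilinear_sum// big1// => i ij.
rewrite (aw _ i j ij) ?mulr0//.
by rewrite !row_set_row (negbTE ij) eqxx.
Qed.

End Multilinear.

(** In the expansion over index maps only permutations survive, and their signs assemble the Leibniz
    formula for the determinant. *)
Lemma top_form_det (K : numFieldType) d (w : mform K d d) (A B : 'M[K]_d) :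
  multilinear w -> alternating w -> w (A *m B) = \det A * w B.
Proof.
move=> mw aw; rewrite multilinear_expand//.
rewrite (bigID (fun I : {ffun 'I_d -> 'I_d} => injectiveb I))/= [X in _ + X]big1 ?addr0; last first.
  move=> I /injectivePn[i [j ij Iij]].
  by rewrite (aw _ i j ij) ?mulr0// !rowK Iij.
rewrite mulr_suml (reindex (fun s : 'S_d => pval s))/=; last first.
  exists (fun I : {ffun 'I_d -> 'I_d} => insubd (1%g : 'S_d) I).
    by move=> s _; apply: val_inj; rewrite insubdK//; exact: (valP s).
  by move=> I /= Iinj; rewrite -[RHS](insubdK (1%g : 'S_d)).
apply: eq_big => [s|s _]; first exact: (valP s).
have E : \matrix_a row (pval s a) B = row_perm s B.
  by apply/row_matrixP => a; rewrite rowK row_row_perm pvalE.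
rewrite E (alternating_antisymmetric mw aw) mulrA; congr (_ * _).
rewrite mulrC; congr (_ * _).
by apply: eq_bigr => a _; rewrite pvalE.
Qed.

Section Wedge.
Variables (K : numFieldType) (d : nat).

Lemma wedge_antisymmetric p q (a : mform K d p) (b : mform K d q) :
  antisymmetric_form (wedge a b).
Proof.
move=> t A; rewrite /wedge mulrCA; congr (_ * _).
rewrite (reindex_inj (mulIg t^-1)%g) mulr_sumr /=; apply: eq_bigr => s _.
rewrite -row_permM mulgKV [RHS]mulrA; congr (_ * _).
by rewrite odd_permM odd_permV signr_addb mulrC.
Qed.

Lemma usubmx_row_perm_set_row p q (s : 'S_(p + q)) j (u : 'rV[K]_d) A :
  usubmx (row_perm s (set_row j u A)) =
  match fintype.split (s^-1%g j) with
  | inl i => set_row i u (usubmx (row_perm s A))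
  | inr _ => usubmx (row_perm s A) end.
Proof.
apply/row_matrixP => l.
have -> : row l (usubmx (row_perm s (set_row j u A))) = row (s (lshift q l)) (set_row j u A).
  by apply/rowP => c; rewrite !mxE.
have E : row l (usubmx (row_perm s A)) = row (s (lshift q l)) A.
  by apply/rowP => c; rewrite !mxE.
rewrite row_set_row; case: fintype.splitP => i ji.
  have -> : (s (lshift q l) == j) = (l == i).
    rewrite -(inj_eq (@perm_inj _ s^-1%g)) permK; apply/eqP/eqP => [h|->]; last exact: val_inj.
    by apply: val_inj; move: ji; rewrite -h.
  by rewrite row_set_row -E.
have -> : (s (lshift q l) == j) = false.
  rewrite -(inj_eq (@perm_inj _ s^-1%g)) permK; apply/eqP => h.
  by move: ji; rewrite -h /= => E1; have := ltn_ord l; rewrite E1 ltnNge leq_addr.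
by rewrite E.
Qed.

Lemma dsubmx_row_perm_set_row p q (s : 'S_(p + q)) j (u : 'rV[K]_d) A :
  dsubmx (row_perm s (set_row j u A)) =
  match fintype.split (s^-1%g j) with
  | inr i => set_row i u (dsubmx (row_perm s A))
  | inl _ => dsubmx (row_perm s A) end.
Proof.
apply/row_matrixP => l.
have -> : row l (dsubmx (row_perm s (set_row j u A))) = row (s (rshift p l)) (set_row j u A).
  by apply/rowP => c; rewrite !mxE.
have E : row l (dsubmx (row_perm s A)) = row (s (rshift p l)) A.
  by apply/rowP => c; rewrite !mxE.
rewrite row_set_row; case: fintype.splitP => i ji; last first.
  have -> : (s (rshift p l) == j) = (l == i).
    rewrite -(inj_eq (@perm_inj _ s^-1%g)) permK; apply/eqP/eqP => [h|->]; last exact: val_inj.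
    by apply: val_inj; move: ji; rewrite -h /= => /addnI.
  by rewrite row_set_row -E.
have -> : (s (rshift p l) == j) = false.
  rewrite -(inj_eq (@perm_inj _ s^-1%g)) permK; apply/eqP => h.
  by move: ji; rewrite -h /= => E1; have := ltn_ord i; rewrite -E1 ltnNge leq_addr.
by rewrite E.
Qed.

Lemma wedge_multilinear p q (a : mform K d p) (b : mform K d q) :
  multilinear a -> multilinear b -> multilinear (wedge a b).
Proof.
move=> ma mb A j c u v; rewrite /wedge mulrCA -mulrDr; congr (_ * _).
rewrite mulr_sumr -big_split/=; apply: eq_bigr => s _.
rewrite !usubmx_row_perm_set_row !dsubmx_row_perm_set_row.
case: (fintype.split _) => i.
  by rewrite ma mulrDl mulrDr -mulrA mulrCA.
by rewrite mb mulrDr mulrDr [_ * (c * _)]mulrCA [_ * (c * _)]mulrCA.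
Qed.

Lemma wedge_alternating p q (a : mform K d p) (b : mform K d q) : alternating (wedge a b).
Proof. exact/antisymmetric_alternating/wedge_antisymmetric. Qed.

(** [wedge] sums over all permutations, [extd] over the position of one row. Grouping the
    permutations by the row sent to slot 0 passes from one to the other, each group consisting of q!
    equal terms. *)
Lemma altsum q (G : 'rV[K]_d -> mform K d q) (A : 'M[K]_(1 + q, d)) :
  (forall v, antisymmetric_form (G v)) ->
  \sum_(s : 'S_(1 + q)) (-1) ^+ s * G (row (s ord0) A) (dsubmx (row_perm s A)) =
  q`!%:R * \sum_(j < q.+1) (-1) ^+ j * G (row j A) (row' j A).
Proof.
move=> aG; rewrite big_perm_lift mulr_sumr; apply: eq_bigr => j _.
transitivity (\sum_(u : 'S_q) (-1) ^+ j * G (row j A) (row' j A)); last first.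
  by rewrite sumr_const card_Sn mulr_natl.
apply: eq_bigr => u _; rewrite lift_perm_id odd_lift_perm addFb signr_addb signr_odd.
have -> : dsubmx (row_perm (lift_perm ord0 j u) A : 'M[K]_(1 + q, d)) = row_perm u (row' j A).
  apply/row_matrixP => i; rewrite row_row_perm; apply/rowP => c; rewrite !mxE.
  have -> : rshift 1 i = lift ord0 i by exact: val_inj.
  by rewrite lift_perm_lift.
by rewrite aG -mulrA; congr (_ * _); rewrite mulrA -expr2 sqrr_sign mul1r.
Qed.

Lemma wedge1E q (alpha : 'cV[K]_d) (b : mform K d q) (A : 'M[K]_(1 + q, d)) :
  antisymmetric_form b ->
  wedge (covform alpha) b A =
  \sum_(j < q.+1) (-1) ^+ j * ((row j A *m alpha) 0 0 * b (row' j A)).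
Proof.
move=> ab; rewrite /wedge mul1n.
rewrite -[RHS](mulKf (_ : q`!%:R != 0)); last by rewrite pnatr_eq0 -lt0n fact_gt0.
rewrite -(altsum (G := fun v B => (v *m alpha) 0 0 * b B)); last first.
  by move=> v s B; rewrite ab mulrCA.
congr (_ * _); apply: eq_bigr => s _; congr (_ * (_ * _)).
rewrite /covform !mxE; apply: eq_bigr => i _; rewrite !mxE.
by congr (A (s _) _ * _); apply: val_inj.
Qed.

End Wedge.

(** * Positivity of wedge products on adapted frames *)

Section Positivity.
Variable R : realFieldType.

(** Meant for a frame split along T and E, where the first factor sees only the [X] block and the
    second only the [E] block. Every permutation then contributes a square times [b E], and the
    identity contributes [b E] itself. *)
Lemma wedge_block_gt0 k q m (a : mform R m k) (b : mform R m q)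
    (X : 'M[R]_(k, m)) (E : 'M[R]_(q, m)) :
  (forall N N', a (N *m X + N' *m E) = \det N) ->
  (forall N N', b (N *m X + N' *m E) = \det N' * b E) ->
  0 < b E -> 0 < wedge a b (col_mx X E).
Proof.
move=> ha hb bE; rewrite /wedge; apply: mulr_gt0.
  by rewrite invr_gt0 ltr0n muln_gt0 !fact_gt0.
have term (s : 'S_(k + q)) : (-1) ^+ s * (a (usubmx (row_perm s (col_mx X E))) *
     b (dsubmx (row_perm s (col_mx X E)))) =
   (\det (perm_mx s : 'M[R]_(k + q)) * \det (ulsubmx (perm_mx s : 'M[R]_(k + q)))) ^+ 2 * b E.
  rewrite row_permE; set P := perm_mx s.
  have PE : P = block_mx (ulsubmx P) (ursubmx P) (dlsubmx P) (drsubmx P) by rewrite submxK.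
  have -> : P *m col_mx X E = col_mx (ulsubmx P *m X + ursubmx P *m E)
      (dlsubmx P *m X + drsubmx P *m E) by rewrite {1}PE mul_block_col.
  rewrite col_mxKu col_mxKd ha hb -[(-1) ^+ s]det_perm -/P.
  (* Jacobi's identity for complementary minors of an orthogonal matrix, obtained by multiplying [P]
     with a block triangular matrix built from the upper blocks of its transpose. *)
  suff D : \det P * \det (ulsubmx P) = \det (drsubmx P) by rewrite expr2 mulrA !D; ring.
  have PP : P *m P^T = 1%:M by rewrite tr_perm_mx -perm_mxM mulgV perm_mx1.
  have [D1 D2] : ulsubmx P *m (ulsubmx P)^T + ursubmx P *m (ursubmx P)^T = 1%:M /\
     dlsubmx P *m (ulsubmx P)^T + drsubmx P *m (ursubmx P)^T = 0.
    move: PP; rewrite {1 2}PE tr_block_mx mulmx_block scalar_mx_block.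
    by move=> /eq_block_mx [-> _ -> _].
  rewrite -(det_tr (ulsubmx P)).
  have -> : \det (ulsubmx P)^T = \det (block_mx (ulsubmx P)^T 0 (ursubmx P)^T 1%:M).
    by rewrite det_lblock det1 mulr1.
  rewrite -det_mulmx {1}PE mulmx_block !mulmx0 !mulmx1 !add0r D1 D2.
  by rewrite det_ublock det1 mul1r.
under eq_bigr do rewrite term.
rewrite -mulr_suml mulr_gt0// (bigD1 1%g)//= perm_mx1 ltr_pwDl//.
  rewrite det1 mul1r exprn_even_gt0//.
  by rewrite scalar_mx_block block_mxKul det1 oner_neq0.
by apply: sumr_ge0 => s _; rewrite sqr_ge0.
Qed.

(** The standard symplectic matrix for a basis ordered as v_0, phi v_0, v_1, phi v_1, and so on. *)
Definition symp (i j : nat) : R :=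
  if odd i then (if j.+1 == i then -1 else 0) else (if j == i.+1 then 1 else 0).

(** Removing the conjugate pair [t], [t.+1], with [t] even, leaves a basis of the same shape. *)
Lemma symp_shift (t k l : nat) : ~~ odd t ->
  symp (if (k < t)%N then k else k.+2) (if (l < t)%N then l else l.+2) = symp k l.
Proof.
move=> ot; have [[t' E]] : (exists t', t = t' * 2)%N /\ True.
  by split => //; exists t./2; rewrite muln2 even_halfK//.
move=> _; rewrite /symp; case: ltnP => kt; case: ltnP => lt //=; rewrite ?negbK;
  case: ifPn => ok; do 2!case: eqP => ? //; exfalso; lia.
Qed.

Lemma wedge_pow_antisymmetric d (a : mform R d 2) r : antisymmetric_form (wedge_pow a r).
Proof.
case: r => [|r] s A /=; last exact: wedge_antisymmetric.
have -> : s = 1%g by apply/permP => -[].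
by rewrite odd_perm1 mul1r.
Qed.

Lemma wedge_pow_multilinear d (a : mform R d 2) r : multilinear a -> multilinear (wedge_pow a r).
Proof.
by move=> ma; elim: r => [|r IH] /=; [move=> A []|exact: wedge_multilinear].
Qed.

(** Expand along the first two slots. Only conjugate pairs of rows contribute; the sign of moving
    such a pair to the front agrees with its [symp] entry, so the product is 1, and the remaining
    rows again form a symplectic basis. *)
Lemma wedge_pow_gt0 d (f : 'rV[R]_d -> 'rV[R]_d -> R) r (A : 'M[R]_(r * 2, d)) :
  (forall i j, f (row i A) (row j A) = symp i j) ->
  0 < wedge_pow (fun B : 'M[R]_(2, d) => f (row 0 B) (row 1 B)) r A.
Proof.
elim: r A => [|r IH] A hA; first by rewrite /= ltr01.
rewrite /= /wedge; apply: mulr_gt0.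
  by rewrite invr_gt0 ltr0n muln_gt0 !fact_gt0.
set w := wedge_pow _ r in IH *.
have aw : antisymmetric_form w by exact: wedge_pow_antisymmetric.
pose q := (r * 2)%N.
rewrite (big_perm_lift (q := q.+1)).
under eq_bigr do rewrite big_perm_lift.
pose A' (i : 'I_q.+2) (i' : 'I_q.+1) : 'M[R]_(q, d) := row' i' (row' i A).
have term (i : 'I_q.+2) (i' : 'I_q.+1) (u : 'S_q) : (-1) ^+ (lift_perm ord0 i (lift_perm ord0 i' u) : 'S_q.+2) *
   (f (row 0 (usubmx (row_perm (lift_perm ord0 i (lift_perm ord0 i' u)) A : 'M[R]_(2 + q, d))))
      (row 1 (usubmx (row_perm (lift_perm ord0 i (lift_perm ord0 i' u)) A : 'M[R]_(2 + q, d)))) *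
    w (dsubmx (row_perm (lift_perm ord0 i (lift_perm ord0 i' u)) A : 'M[R]_(2 + q, d)))) =
   (-1) ^+ (i + i') * symp i (lift i i') * w (A' i i').
  set s := lift_perm _ _ _.
  have -> : row 0 (usubmx (row_perm s A : 'M[R]_(2 + q, d))) = row i A.
    apply/rowP => c; rewrite !mxE (_ : lshift q 0 = ord0); last exact: val_inj.
    by rewrite lift_perm_id.
  have -> : row 1 (usubmx (row_perm s A : 'M[R]_(2 + q, d))) = row (lift i i') A.
    apply/rowP => c; rewrite !mxE (_ : lshift q 1 = lift ord0 ord0); last exact: val_inj.
    by rewrite lift_perm_lift lift_perm_id.
  have -> : dsubmx (row_perm s A : 'M[R]_(2 + q, d)) = row_perm u (A' i i').
    apply/row_matrixP => l; rewrite row_row_perm; apply/rowP => c; rewrite !mxE.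
    rewrite (_ : rshift 2 l = lift ord0 (lift ord0 l)); last exact: val_inj.
    by rewrite /s !lift_perm_lift.
  rewrite hA aw /s !odd_lift_perm !addFb 2!signr_addb !signr_odd exprD.
  set e := (-1) ^+ odd_perm u; have ee : e * e = 1 by rewrite -expr2 sqrr_sign.
  by rewrite -[RHS]mul1r -ee; ring.
have pos (i : 'I_q.+2) (i' : 'I_q.+1) : (-1) ^+ (i + i') * symp i (lift i i') != 0 ->
    (-1) ^+ (i + i') * symp i (lift i i') = 1 /\ 0 < w (A' i i').
  have IH' (t : nat) : ~~ odd t -> (forall l : 'I_q, lift i (lift i' l) = (if (l < t)%N then (l : nat) else l.+2) :> nat) ->
      0 < w (A' i i').
    move=> ot ht; apply: IH => k l.
    have rE (x : 'I_(r * 2)) : row x (A' i i') = row (lift i (lift i' x)) A.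
      by apply/rowP => c; rewrite !mxE.
    by rewrite !rE hA !ht symp_shift.
  rewrite /symp; case: ifPn => oi.
    case: ifP => [/eqP e1 _|_]; last by rewrite mulr0 eqxx.
    have e2 : i = i'.+1 :> nat by move: e1; rewrite /= /bump; case: leqP => ? ?; lia.
    split; first by rewrite e2 addSn addnn exprS -signr_odd odd_double; ring.
    apply: (IH' i'); first by move: oi; rewrite e2.
    by move=> l; rewrite /= /bump e2; case: leqP => ? ; case: leqP => ? /=; lia.
  case: ifP => [/eqP e1 _|_]; last by rewrite mulr0 eqxx.
  have e2 : i = i' :> nat by move: e1; rewrite /= /bump; case: leqP => ? ?; lia.
  split; first by rewrite e2 addnn -signr_odd odd_double expr0 mulr1.
  apply: (IH' i) => // l.
  by rewrite /= /bump e2; case: leqP => ? ; case: leqP => ? /=; lia.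
have ge0 (i : 'I_q.+2) (i' : 'I_q.+1) : 0 <= (-1) ^+ (i + i') * symp i (lift i i') * w (A' i i').
  have [->|/pos[-> /ltW]] := eqVneq ((-1) ^+ (i + i') * symp i (lift i i')) 0.
    by rewrite mul0r.
  by rewrite mul1r.
have gt0 : 0 < (-1) ^+ ((ord0 : 'I_q.+2) + (ord0 : 'I_q.+1)) *
    symp (ord0 : 'I_q.+2) (lift (ord0 : 'I_q.+2) (ord0 : 'I_q.+1)) * w (A' ord0 ord0).
  have E : (-1) ^+ ((ord0 : 'I_q.+2) + (ord0 : 'I_q.+1)) *
    symp (ord0 : 'I_q.+2) (lift (ord0 : 'I_q.+2) (ord0 : 'I_q.+1)) = 1 by rewrite mul1r.
  have [|-> h] := pos ord0 ord0; first by rewrite E oner_neq0.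
  by rewrite mul1r.
under eq_bigr do under eq_bigr do under eq_bigr do rewrite term.
rewrite (bigD1 ord0)//= ltr_pwDl//; last first.
  by apply: sumr_ge0 => i _; apply: sumr_ge0 => i' _; apply: sumr_ge0 => u _; exact: ge0.
rewrite (bigD1 ord0)//= ltr_pwDl//; last first.
  by apply: sumr_ge0 => i' _; apply: sumr_ge0 => u _; exact: (ge0 ord0 i').
rewrite (bigD1 1%g)//= ltr_pwDl//.
by apply: sumr_ge0 => u _; exact: (ge0 ord0 ord0).
Qed.

End Positivity.

(** * Connections *)

Lemma subrACA (V : zmodType) (a b x y : V) : a - b - (x - y) = a - x - (b - y).
Proof. by rewrite opprD opprK addrACA opprD opprK. Qed.

Section Restrict.
Variables (R : realType) (d : nat) (M : manifold R d).

Definition restrict_chart (c : chart R d M) (U : set M) : chart R d M :=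
  Chart (cdom c `&` U) (cmap c) (cinv c).

Lemma restrict_chart_atlas (c : chart R d M) (U : set M) :
  in_maximal_atlas c -> open U -> in_maximal_atlas (restrict_chart c U).
Proof.
move=> [[od oi K cm ci] tr] oU; split.
  have E : cimg (restrict_chart c U) = cimg c `&` cinv c @^-1` U.
    apply/seteqP; split => x /=.
      by move=> [r [cr Ur]] <-; split; [exists r|rewrite /= K].
    by move=> [[r cr <-]]; rewrite K// => Ur; exists r.
  split.
  - exact: openI.
  - by rewrite E; exact: open_setI_preimage.
  - by move=> p [cp _]; exact: K.
  - by move=> p [cp _]; exact: cm.
  - by rewrite E => x [cx _]; exact: ci.
move=> p; have [t1 t2] := tr p; split => i r.
  by apply: Ck_sub (t1 i r) => x [q [[cq _] pq] <-]; exists q.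
by apply: Ck_sub (t2 i r) => x [q [pq [cq _]] <-]; exists q.
Qed.

Lemma cutoff_near (q : M) (U : set M) : nbhs q U -> exists chi : M -> R, exists S : set M,
  [/\ smooth_fun chi, forall r, 0 <= chi r, \forall r \near q, chi r = 1 &
   [/\ compact S, S `<=` U & forall r, ~ S r -> chi r = 0]].
Proof.
move=> /nbhs_interior/nbhs_singleton Uq.
have a := restrict_chart_atlas (atlas_chart_at q) (@open_interior _ U).
have [|chi [S [h1 h2 h3 [h4 h5 h6]]]] := @cutoff _ _ _ _ q a.
  by split => //; exact: mem_chart_at.
exists chi, S; split => //; split => //.
by move=> r /h5 [_ /interior_subset].
Qed.

(** The components of [Y] are multiplied by a cutoff, since the Leibniz rule of a connection takes
    globally smooth coefficients. *)
Lemma smooth_vf_near_expand (c : chart R d M) q (X : 'I_d -> vfield M) (Y : vfield M) :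
  in_maximal_atlas c -> cdom c q ->
  (\forall r \near q, forall i, X i r = row i (coord_frame c r)) -> smooth_vf Y ->
  exists f : 'I_d -> M -> R, (forall i, smooth_fun (f i)) /\
    \forall r \near q, Y r = \sum_i f i r *: X i r.
Proof.
move=> ac cq XE sY; have [chi [S [sc c0 c1 [cS Sc cz]]]] := cutoff ac cq.
exists (fun i r => chi r * vder r (Y r) (ccoord c i)); split.
  move=> i; apply/smooth_funP; apply: (smooth_at_supported ac cS _ Sc).
    by move=> r /cz ->; rewrite mul0r.
  move=> r cr; apply: smooth_atM; first by move/smooth_funP: sc; exact.
  by move/smooth_vfP: sY; apply; exact: smooth_at_ccoord.
near=> r; have cr : cdom c r by near: r; exact: (cdom_near ac.1 cq).
rewrite -[LHS](dcoordK _ ac cr) mulmx_sum_row; apply: eq_bigr => i _.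
rewrite mxE; congr (_ *: _).
  have -> : chi r = 1 by near: r; exact: c1.
  by rewrite mul1r.
have XEr : forall i, X i r = row i (coord_frame c r) by near: r; exact: XE.
by rewrite XEr.
Unshelve. all: by end_near. Qed.

End Restrict.

Section Connection.
Variables (R : realType) (d : nat) (M : manifold R d) (nabla : connection M).
Hypothesis isc : is_connection nabla.
Implicit Types (p q : M) (X Y : vfield M) (v : 'rV[R]_d).

Lemma nablaD p v X Y : smooth_vf X -> smooth_vf Y ->
  nabla p v (fun r => X r + Y r) = nabla p v X + nabla p v Y.
Proof. by have [_ h _ _] := isc; exact: h. Qed.

Lemma nabla_leibniz p v f X : smooth_fun f -> smooth_vf X ->
  nabla p v (fun r => f r *: X r) = vder p v f *: X p + f p *: nabla p v X.
Proof. by have [_ _ h _] := isc; exact: h. Qed.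

Lemma nablaZ p v (a : R) X : smooth_vf X ->
  nabla p v (fun r => a *: X r) = a *: nabla p v X.
Proof.
move=> sX; rewrite (nabla_leibniz _ _ (@smooth_fun_cst _ _ M a) sX) vder_cst.
by rewrite scale0r add0r.
Qed.

Lemma nabla0 p v : nabla p v (fun=> 0) = 0.
Proof.
transitivity ((0 : R) *: nabla p v (fun=> 0)); last exact: scale0r.
rewrite -nablaZ; last exact: smooth_vf0.
by congr nabla; apply/funext => r; rewrite scale0r.
Qed.

Lemma smooth_vfN X : smooth_vf X -> smooth_vf (fun r => - X r).
Proof.
move=> sX; rewrite (_ : (fun r => - X r) = (fun r => (-1) *: X r)).
  by apply: smooth_vfZ => //; exact: smooth_fun_cst.
by apply/funext => r; rewrite scaleN1r.
Qed.

Lemma smooth_vfB X Y : smooth_vf X -> smooth_vf Y -> smooth_vf (fun r => X r - Y r).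
Proof. by move=> sX sY; exact: (smooth_vfD sX (smooth_vfN sY)). Qed.

Lemma nablaB p v X Y : smooth_vf X -> smooth_vf Y ->
  nabla p v (fun r => X r - Y r) = nabla p v X - nabla p v Y.
Proof.
move=> sX sY; rewrite nablaD//; last exact: smooth_vfN.
congr (_ + _); rewrite -scaleN1r -nablaZ//.
by congr nabla; apply/funext => r; rewrite scaleN1r.
Qed.

Lemma nabla_sum p v (I : Type) (s : seq I) (P : pred I) (f : I -> M -> R) (X : I -> vfield M) :
  (forall i, smooth_fun (f i)) -> (forall i, smooth_vf (X i)) ->
  nabla p v (fun r => \sum_(i <- s | P i) f i r *: X i r) =
  \sum_(i <- s | P i) (vder p v (f i) *: X i p + f i p *: nabla p v (X i)).
Proof.
move=> sf sX; elim: s => [|i s IH].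
  rewrite big_nil -[RHS](nabla0 p v); congr nabla.
  by apply/funext => r; rewrite big_nil.
rewrite big_cons; case: (boolP (P i)) => Pi; last first.
  by rewrite -IH; congr nabla; apply/funext => r; rewrite big_cons (negbTE Pi).
rewrite -IH -nabla_leibniz// -nablaD.
- by congr nabla; apply/funext => r; rewrite big_cons Pi.
- exact: smooth_vfZ.
- by apply: smooth_vf_sum => j; exact: smooth_vfZ.
Qed.

Lemma nabla_vlinear p (a : R) u v Y : smooth_vf Y ->
  nabla p (a *: u + v) Y = a *: nabla p u Y + nabla p v Y.
Proof. by have [h _ _ _] := isc; exact: h. Qed.

Lemma nabla_v0 p Y : smooth_vf Y -> nabla p 0 Y = 0.
Proof.
move=> sY; have := nabla_vlinear p 1 0 0 sY; rewrite !scale1r addr0 => /eqP.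
by rewrite -subr_eq subrr eq_sym => /eqP.
Qed.

Lemma nabla_vZ p a v Y : smooth_vf Y -> nabla p (a *: v) Y = a *: nabla p v Y.
Proof. by move=> sY; rewrite -[a *: v]addr0 nabla_vlinear// nabla_v0// addr0. Qed.

Lemma nabla_vD p u v Y : smooth_vf Y -> nabla p (u + v) Y = nabla p u Y + nabla p v Y.
Proof. by move=> sY; rewrite -[u]scale1r nabla_vlinear// !scale1r. Qed.

Lemma nabla_v_sum p v Y : smooth_vf Y ->
  nabla p v Y = \sum_i v 0 i *: nabla p (delta_mx 0 i) Y.
Proof.
move=> sY; rewrite {1}(row_sum_delta v).
elim/big_ind2 : _ => [|x1 x2 y1 y2 <- <-|i _]; first exact: nabla_v0.
  by rewrite nabla_vD.
by rewrite nabla_vZ.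
Qed.

Lemma smooth_nabla X Y : smooth_vf X -> smooth_vf Y -> smooth_vf (fun p => nabla p (X p) Y).
Proof. by have [_ _ _ h] := isc; exact: h. Qed.

Lemma nabla_near_eq p v X Y : smooth_vf X -> smooth_vf Y ->
  (\forall r \near p, X r = Y r) -> nabla p v X = nabla p v Y.
Proof.
move=> sX sY XY; apply/eqP; rewrite -subr_eq0 -nablaB//.
have [chi [S [sc c0 c1 [_ SU cz]]]] := cutoff_near XY.
(* Locality of [nabla]: [chi] is supported where [X = Y], so the difference is unchanged by the
   factor [1 - chi], which is zero near [p]. *)
have -> : (fun r => X r - Y r) = (fun r => (1 + -1 * chi r) *: (X r - Y r)).
  apply/funext => r; case: (pselect (S r)) => [/SU/= ->|/cz ->].
    by rewrite subrr scaler0.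
  by rewrite mulr0 addr0 scale1r.
have sc1 : smooth_fun (fun r => 1 + -1 * chi r).
  apply/smooth_funP => r; apply: smooth_atD; first exact: smooth_at_cst.
  by apply: smooth_atM; [exact: smooth_at_cst|move/smooth_funP: sc; exact].
rewrite nabla_leibniz//; last exact: smooth_vfB.
rewrite (nbhs_singleton XY) subrr scaler0 add0r (nbhs_singleton c1).
by rewrite mulr1 subrr scale0r.
Qed.

Lemma torsion_antisym X Y p : torsion nabla X Y p = - torsion nabla Y X p.
Proof.
rewrite /torsion !opprB; have -> : lie X Y p = - lie Y X p.
  by apply/rowP => i; rewrite !mxE opprB.
by rewrite opprK addrC.
Qed.

Lemma lie_sum X (f : 'I_d -> M -> R) (Y : 'I_d -> vfield M) p : smooth_vf X ->
  (forall i, smooth_fun (f i)) -> (forall i, smooth_vf (Y i)) ->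
  lie X (fun r => \sum_i f i r *: Y i r) p =
  \sum_i (vder p (X p) (f i) *: Y i p + f i p *: lie X (Y i) p).
Proof.
move=> sX sf sY; apply/rowP => j.
have sfp i r : smooth_at (f i) r by move/smooth_funP: (sf i); exact.
have sc r : cdom (chart_at p) r -> smooth_at (Defs.coord p j) r.
  by move=> cr; apply: (smooth_at_ccoord _ (atlas_chart_at p)).
have scp := sc p (mem_chart_at p).
have sYc i : smooth_at (fun r => vder r (Y i r) (Defs.coord p j)) p.
  by move/smooth_vfP: (sY i); apply.
have sXc : smooth_at (fun r => vder r (X r) (Defs.coord p j)) p by move/smooth_vfP: sX; apply.
have vsum r (w : 'I_d -> 'rV[R]_d) g : smooth_at g r ->
    vder r (\sum_i w i) g = \sum_i vder r (w i) g.
  move=> sg; elim/big_ind2 : _ => [|x1 x2 y1 y2 <- <-|//]; first exact: vder0.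
  by rewrite vderDv.
rewrite mxE summxE vsum//.
have -> : vder p (X p) (fun q => vder q (\sum_i f i q *: Y i q) (Defs.coord p j)) =
   vder p (X p) (fun q => \sum_i f i q * vder q (Y i q) (Defs.coord p j)).
  apply: vder_near_eq; apply: filterS (cdom_near (chart_atP p) (mem_chart_at p)) => r cr.
  by rewrite vsum; [apply: eq_bigr => i _; rewrite vderZv; [|exact: sc]|exact: sc].
rewrite vder_sum; last by move=> i _; exact: smooth_atM.
rewrite -sumrB; apply: eq_bigr => i _; rewrite vderM// vderZv// !mxE vder_coord.
rewrite mulrBr addrAC addrC; congr (_ + _); exact: mulrC.
Qed.

Lemma lieE X Y p j : lie X Y p 0 j =
  vder p (X p) (fun r => vder r (Y r) (Defs.coord p j)) -
  vder p (Y p) (fun r => vder r (X r) (Defs.coord p j)).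
Proof. by rewrite mxE. Qed.

Lemma lie_near_eq X Y Y' p : (\forall r \near p, Y r = Y' r) -> lie X Y p = lie X Y' p.
Proof.
move=> YY; have E : Y p = Y' p by exact: (nbhs_singleton YY).
apply/rowP => j; rewrite [LHS]lieE [RHS]lieE -E.
rewrite (@vder_near_eq _ _ _ p (X p) _ (fun r => vder r (Y' r) (Defs.coord p j)))//.
by apply: filterS YY => r ->.
Qed.

(** Tensoriality. Near [p] the field [Y] is a combination of a frame with coefficients vanishing at
    [p]; the derivatives of these coefficients enter [nabla] and [lie] equally and cancel. *)
Lemma torsion_zero X Y p : smooth_vf X -> smooth_vf Y -> Y p = 0 -> torsion nabla X Y p = 0.
Proof.
move=> sX sY Y0; have ac := atlas_chart_at p; have pp := mem_chart_at p.
have [F [sF FE]] := frame_extension ac pp.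
have [f [sf YE]] := smooth_vf_near_expand ac pp FE sY.
have sY' : smooth_vf (fun r => \sum_i f i r *: F i r).
  by apply: smooth_vf_sum => i; exact: smooth_vfZ.
have f0 i : f i p = 0.
  have E := nbhs_singleton YE; rewrite /= Y0 in E.
  have : (\sum_i f i p *: F i p) 0 i = 0 by rewrite -E mxE.
  rewrite summxE (bigD1 i)//= big1 ?addr0.
    by rewrite (nbhs_singleton FE) coord_frame_id row1 !mxE !eqxx mulr1.
  move=> j ji; rewrite (nbhs_singleton FE) coord_frame_id row1 !mxE eqxx/=.
  by rewrite eq_sym (negbTE ji) mulr0.
rewrite /torsion (lie_near_eq X YE) (nabla_near_eq _ sY sY' YE) Y0 nabla_v0//.
rewrite nabla_sum// lie_sum// subr0 -sumrB big1// => i _.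
by rewrite f0 !scale0r !addr0 subrr.
Qed.

Lemma torsionB X Y Y' p : smooth_vf X -> smooth_vf Y -> smooth_vf Y' ->
  torsion nabla X (fun r => Y r - Y' r) p = torsion nabla X Y p - torsion nabla X Y' p.
Proof.
move=> sX sY sY'; rewrite /torsion nablaB//.
have -> : nabla p (Y p - Y' p) X = nabla p (Y p) X - nabla p (Y' p) X.
  by rewrite nabla_vD// -scaleN1r nabla_vZ// scaleN1r.
have -> : lie X (fun r => Y r - Y' r) p = lie X Y p - lie X Y' p.
  apply/rowP => j; pose c := Defs.coord p j.
  have sc r : cdom (chart_at p) r -> smooth_at c r.
    by move=> cr; apply: (smooth_at_ccoord _ (atlas_chart_at p)).
  have scp := sc p (mem_chart_at p).
  have sYc Z : smooth_vf Z -> smooth_at (fun r => vder r (Z r) c) p.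
    by move=> /smooth_vfP; apply.
  have vB (r : M) u v g : smooth_at g r -> vder r (u - v) g = vder r u g + -1 * vder r v g.
    by move=> sg; rewrite vderDv// -scaleN1r vderZv.
  have D1 : vder p (X p) (fun r => vder r (Y r - Y' r) c) =
     vder p (X p) (fun r => vder r (Y r) c) - vder p (X p) (fun r => vder r (Y' r) c).
    transitivity (vder p (X p) (fun r => vder r (Y r) c + -1 * vder r (Y' r) c)).
      apply: vder_near_eq; apply: filterS (cdom_near (chart_atP p) (mem_chart_at p)) => r cr.
      by rewrite vB; [|exact: sc].
    rewrite vderD; [|exact: sYc|apply: smooth_atM; [exact: smooth_at_cst|exact: sYc]].
    rewrite vderM; [|exact: smooth_at_cst|exact: sYc].
    by rewrite vder_cst mulr0 addr0; congr (_ + _); exact: mulN1r.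
  have D2 : vder p (Y p - Y' p) (fun r => vder r (X r) c) =
     vder p (Y p) (fun r => vder r (X r) c) - vder p (Y' p) (fun r => vder r (X r) c).
    rewrite vB; last exact: sYc.
    by congr (_ + _); exact: mulN1r.
  have E : (lie X Y p - lie X Y' p) 0 j = lie X Y p 0 j - lie X Y' p 0 j.
    by rewrite mxE; congr (_ + _); rewrite mxE.
  apply: etrans (lieE _ _ _ _) _; apply: etrans (congr2 (fun a b => a - b) D1 D2) _.
  apply: etrans (esym E).
  apply: etrans (esym (congr2 (fun a b => a - b) (lieE X Y p j) (lieE X Y' p j))).
  exact: subrACA.
by rewrite (subrACA (nabla p (X p) Y)); exact: subrACA.
Qed.

Lemma torsion_tensor X X' Y Y' p : smooth_vf X -> smooth_vf X' -> smooth_vf Y ->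
  smooth_vf Y' -> X p = X' p -> Y p = Y' p -> torsion nabla X Y p = torsion nabla X' Y' p.
Proof.
have H Z A B : smooth_vf Z -> smooth_vf A -> smooth_vf B -> A p = B p ->
    torsion nabla Z A p = torsion nabla Z B p.
  move=> sZ sA sB AB; apply: subr0_eq.
  apply: etrans (esym (torsionB p sZ sA sB)) _.
  by apply: torsion_zero; [exact: sZ|exact: smooth_vfB|rewrite AB subrr].
move=> sX sX' sY sY' XX YY.
apply: etrans (H X Y Y' sX sY sY' YY) _; apply: etrans (torsion_antisym _ _ _) _.
apply: etrans (congr1 -%R (H Y' X X' sY' sX sX' XX)) _.
exact: esym (torsion_antisym _ _ _).
Qed.

(* N is linear in the coordinates of a chart at p, up to a cutoff. *)
Lemma sync_frame p (X : 'I_d -> vfield M) : (forall i, smooth_vf (X i)) ->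
  \matrix_i X i p \in unitmx ->
  exists N : 'I_d -> 'I_d -> M -> R,
  [/\ forall a b, smooth_fun (N a b), forall a b, N a b p = 0,
      forall v a b, vder p v (N a b) = (nabla p v (X a) *m invmx (\matrix_i X i p)) 0 b &
      forall v a, nabla p v (fun r => X a r - \sum_b N a b r *: X b r) = 0].
Proof.
move=> sX uX; have ac := atlas_chart_at p; have pp := mem_chart_at p.
have [chi [S [sc c0 c1 [cS Sc cz]]]] := cutoff ac pp.
pose f l r := chi r * (Defs.coord p l r + - Defs.coord p l p).
have sf l : smooth_fun (f l).
  apply/smooth_funP; apply: (smooth_at_supported ac cS _ Sc).
    by move=> r /cz h; rewrite /f h mul0r.
  move=> r cr; apply: smooth_atM; first by move/smooth_funP: sc; exact.
  by apply: smooth_atD; [exact: (smooth_at_ccoord _ ac cr)|exact: smooth_at_cst].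
have f0 l : f l p = 0 by rewrite /f subrr mulr0.
have vf v l : vder p v (f l) = v 0 l.
  transitivity (vder p v (fun r => Defs.coord p l r + - Defs.coord p l p)).
    by apply: vder_near_eq; apply: filterS c1 => r; rewrite /f => ->; rewrite mul1r.
  rewrite vderD; [|exact: (smooth_at_ccoord _ ac pp)|exact: smooth_at_cst].
  by rewrite vder_cst addr0 vder_coord.
pose G a b l := (nabla p (delta_mx 0 l) (X a) *m invmx (\matrix_i X i p)) 0 b.
pose N a b r := \sum_l f l r * G a b l.
have sfG a b l r : smooth_at (fun r => f l r * G a b l) r.
  by apply: smooth_atM; [move/smooth_funP: (sf l); exact|exact: smooth_at_cst].
have sN a b : smooth_fun (N a b) by apply/smooth_funP => r; exact: smooth_at_sum.
have N0 a b : N a b p = 0 by rewrite /N big1// => l _; rewrite f0 mul0r.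
have vN v a b : vder p v (N a b) = (nabla p v (X a) *m invmx (\matrix_i X i p)) 0 b.
  rewrite /N vder_sum//.
  rewrite (nabla_v_sum p v (sX a)) mulmx_suml summxE; apply: eq_bigr => l _.
  rewrite vderM; [|by move/smooth_funP: (sf l); exact|exact: smooth_at_cst].
  by rewrite vder_cst mulr0 add0r vf mulrC -scalemxAl [RHS]mxE.
exists N; split => // v a.
rewrite nablaB//; last by apply: smooth_vf_sum => b; exact: smooth_vfZ.
rewrite nabla_sum//; apply/eqP; rewrite subr_eq0; apply/eqP.
rewrite -[LHS](mulmxKV uX) mulmx_sum_row; apply: eq_bigr => b _.
by rewrite N0 scale0r addr0 rowK vN.
Qed.

End Connection.

(** * Linear algebra of the structure tensors *)

Local Open Scope complex_scope.

Lemma forms_row_replace (K : numFieldType) d q (w : mform K d q) (f : 'rV[K]_d -> 'rV[K]_d) A :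
  (forall B j, w (set_row j (f (row j B)) B) = w B) ->
  w (\matrix_j f (row j A)) = w A.
Proof.
move=> h; pose B (s : seq 'I_q) : 'M[K]_(q, d) :=
  \matrix_j (if j \in s then f (row j A) else row j A).
have -> : \matrix_j f (row j A) = B (enum 'I_q).
  by apply/row_matrixP => j; rewrite !rowK mem_enum.
elim: (enum 'I_q) => [|j s IH].
  by congr w; apply/row_matrixP => j; rewrite rowK.
rewrite -IH; case: (boolP (j \in s)) => js.
  congr w; apply/row_matrixP => i; rewrite !rowK inE.
  by case: eqP => // ->; rewrite js.
rewrite -[RHS](h _ j); congr w; apply/row_matrixP => i; rewrite row_set_row !rowK inE.
by case: eqP => [->|//]; rewrite (negbTE js).
Qed.

(** [A] is a projector that kills the row space of [B], so the two row spaces, both inside that of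
    [F], meet only in 0. *)
Lemma rank_twice_le (K : fieldType) d (A B F : 'M[K]_d) : \rank B = \rank A ->
  (A <= F)%MS -> (B <= F)%MS -> A *m A = A -> B *m A = 0 -> (2 * \rank A <= \rank F)%N.
Proof.
move=> rB sA sB AA BA.
have AB0 : (A :&: B)%MS = 0.
  apply/eqP/rowV0P => v; rewrite sub_capmx => /andP[/submxP[a va] /submxP[b vb]].
  have <- : v *m A = v by rewrite va -mulmxA AA.
  by rewrite vb -mulmxA BA mulmx0.
have := mxrank_sum_cap A B; rewrite AB0 mxrank0 addn0 rB => E.
have : (\rank (A + B)%MS <= \rank F)%N by apply: mxrankS; rewrite addsmx_sub sA sB.
by rewrite E addnn mul2n.
Qed.

Section Cplx.
Variable R : realType.
Local Notation C := R[i].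

Lemma cplxM a b c (A : 'M[R]_(a, b)) (B : 'M[R]_(b, c)) : cplx (A *m B) = cplx A *m cplx B.
Proof. by rewrite /cplx (map_mxM (real_complex R)). Qed.

Lemma cplxD a b (A B : 'M[R]_(a, b)) : cplx (A + B) = cplx A + cplx B.
Proof. by rewrite /cplx (map_mxD (real_complex R)). Qed.

Lemma cplxN a b (A : 'M[R]_(a, b)) : cplx (- A) = - cplx A.
Proof. by rewrite /cplx (map_mxN (real_complex R)). Qed.

Lemma cplxB a b (A B : 'M[R]_(a, b)) : cplx (A - B) = cplx A - cplx B.
Proof. by rewrite cplxD cplxN. Qed.

Lemma cplxZ a b c (A : 'M[R]_(a, b)) : cplx (c *: A) = c%:C *: cplx A.
Proof. by rewrite /cplx (map_mxZ (real_complex R)). Qed.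

Lemma cplx1 a : cplx (1%:M : 'M[R]_a) = 1%:M.
Proof. by rewrite /cplx (map_mx1 (real_complex R)). Qed.

Lemma cplx0 a b : cplx (0 : 'M[R]_(a, b)) = 0.
Proof. by rewrite /cplx (map_mx0 (real_complex R)). Qed.

Lemma cplx_tr a b (A : 'M[R]_(a, b)) : cplx A^T = (cplx A)^T.
Proof. by rewrite /cplx map_trmx. Qed.

Lemma cplx_delta a b i j : cplx (delta_mx i j : 'M[R]_(a, b)) = delta_mx i j.
Proof. by apply/matrixP => x y; rewrite !mxE; case: (_ && _). Qed.

Lemma complexE (z : C) : z = (complex.Re z)%:C + 'i%C * (complex.Im z)%:C.
Proof. by case: z => a b; apply/eqP; rewrite eq_complex /=; apply/andP; split; apply/eqP; simpc; rewrite ?mul0r ?mul1r ?mulr0 ?subr0 ?addr0 ?add0r ?subrr. Qed.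

Lemma cplx_ReIm a b (A : 'M[C]_(a, b)) : A = cplx (Remx A) + 'i%C *: cplx (Immx A).
Proof. by apply/matrixP => i j; rewrite !mxE -complexE. Qed.

Lemma Remx_cplx a b (A B : 'M[R]_(a, b)) : Remx (cplx A + 'i%C *: cplx B) = A.
Proof. by apply/matrixP => i j; rewrite !mxE /=; ring. Qed.

Lemma Immx_cplx a b (A B : 'M[R]_(a, b)) : Immx (cplx A + 'i%C *: cplx B) = B.
Proof. by apply/matrixP => i j; rewrite !mxE /=; ring. Qed.

Lemma ii : 'i%C * 'i%C = -1 :> C.
Proof. by apply/eqP; rewrite eq_complex /=; apply/andP; split; apply/eqP; ring. Qed.

End Cplx.

Section Pointwise.
Variables (R : realType) (n k : nat).
Local Notation m := (k + n * 2)%N.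
Variables (M : manifold R m) (St : fpk_data M).
Local Notation C := R[i].
Hypothesis Hf : is_metric_fpk St.
Variable p : M.
Local Notation ph := (phi St p).
Local Notation g := (metric St p).

Lemma phi_cube : ph *m ph *m ph = - ph.
Proof. by have [_ _ _ _ [_ h _ _]] := Hf; apply/eqP; rewrite -addr_eq0 h. Qed.

Lemma phi_rank : \rank ph = (2 * n)%N.
Proof. by have [_ _ _ _ [h _ _ _]] := Hf. Qed.

Lemma xi_phi i : xi St i p *m ph = 0.
Proof.
have [_ _ _ _ [_ _ h _]] := Hf; have [/andP[h1 _] _] := h p.
apply/sub_kermxP; apply: submx_trans h1.
by have := row_sub i (\matrix_i xi St i p); rewrite rowK.
Qed.

Lemma eta_xi i j : pair_eta St i p (xi St j p) = (i == j)%:R.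
Proof. by have [_ _ _ _ [_ _ _ [h _ _ _]]] := Hf. Qed.

Lemma phi_eta j : ph *m eta St j p = 0.
Proof. by have [_ _ _ _ [_ _ _ [_ h _ _]]] := Hf. Qed.

Lemma phi_sqr : ph *m ph = - 1%:M + \sum_i eta St i p *m xi St i p.
Proof. by have [_ _ _ _ [_ _ _ [_ _ h _]]] := Hf. Qed.

Lemma eta_phi j v : pair_eta St j p (v *m ph) = 0.
Proof. by rewrite /pair_eta -mulmxA phi_eta mulmx0 mxE. Qed.

Lemma metric_phi u v : gprod St p u v = gprod St p (u *m ph) (v *m ph) +
   \sum_i pair_eta St i p u * pair_eta St i p v.
Proof. by have [_ _ _ _ [_ _ _ [_ _ _ h]]] := Hf. Qed.

Lemma metric_sym : g^T = g.
Proof. by have [_ _ _ [_ h _] _] := Hf. Qed.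

Lemma gprod_sym u v : gprod St p u v = gprod St p v u.
Proof.
rewrite /gprod; transitivity ((u *m g *m v^T)^T 0 0); first by rewrite [RHS]mxE.
by rewrite !trmx_mul trmxK metric_sym mulmxA.
Qed.

Lemma gprodDl u v w : gprod St p (u + v) w = gprod St p u w + gprod St p v w.
Proof. by rewrite /gprod !mulmxDl mxE. Qed.

Lemma gprodZl a u w : gprod St p (a *: u) w = a * gprod St p u w.
Proof. by rewrite /gprod -!scalemxAl mxE. Qed.

Lemma gprod_suml (I : Type) (s : seq I) (P : pred I) (a : I -> R) (u : I -> 'rV[R]_m) w :
  gprod St p (\sum_(i <- s | P i) a i *: u i) w = \sum_(i <- s | P i) a i * gprod St p (u i) w.
Proof.
elim/big_ind2 : _ => [|x1 x2 y1 y2 <- <-|i _]; last exact: gprodZl.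
  by rewrite /gprod !mul0mx mxE.
by rewrite gprodDl.
Qed.

Lemma gprodNl u w : gprod St p (- u) w = - gprod St p u w.
Proof. by rewrite -scaleN1r gprodZl mulN1r. Qed.

Lemma gprod_xi_phi i v : gprod St p (xi St i p) (v *m ph) = 0.
Proof.
rewrite metric_phi xi_phi big1 ?addr0; first by rewrite /gprod !mul0mx mxE.
by move=> j _; rewrite eta_phi mulr0.
Qed.

Lemma phi_sqr_row v : v *m ph *m ph = - v + \sum_i pair_eta St i p v *: xi St i p.
Proof.
rewrite -mulmxA phi_sqr mulmxDr mulmxN mulmx1; congr (_ + _).
rewrite mulmx_sumr; apply: eq_bigr => i _; rewrite mulmxA.
by rewrite [v *m _]mx11_scalar mul_scalar_mx.
Qed.

Lemma phi_skew u v : gprod St p (u *m ph) v = - gprod St p u (v *m ph).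
Proof.
rewrite metric_phi big1 ?addr0; last by move=> i _; rewrite eta_phi mul0r.
rewrite phi_sqr_row gprodDl gprodNl gprod_suml big1 ?addr0// => i _.
by rewrite gprod_xi_phi mulr0.
Qed.

Lemma gprod_delta i j (A : 'M[R]_m) (B : 'M[R]_m) :
  ((delta_mx 0 i : 'rV[R]_m) *m A *m g *m ((delta_mx 0 j : 'rV[R]_m) *m B)^T) 0 0 = (A *m g *m B^T) i j.
Proof.
by rewrite trmx_mul trmx_delta !mulmxA -colE mxE -!mulmxA -rowE mxE.
Qed.

Lemma phi_skew_mx : ph *m g = - (g *m ph^T).
Proof.
apply/matrixP => i j.
have := phi_skew (delta_mx 0 i) (delta_mx 0 j); rewrite /gprod.
have := gprod_delta i j ph 1%:M; rewrite mulmx1 trmx1 mulmx1 => ->.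
by have := gprod_delta i j 1%:M ph; rewrite mulmx1 mul1mx => -> ->; rewrite [RHS]mxE.
Qed.

Lemma metric_unit : g \in unitmx.
Proof.
rewrite -row_free_unit -kermx_eq0; apply/rowV0P => v /sub_kermxP vg; apply/eqP.
have [_ _ _ [_ _ h] _] := Hf; apply: contraT => /(h p).
by rewrite /gprod vg mul0mx mxE ltxx.
Qed.

Lemma phi_tr : ph^T = - (invmx g *m ph *m g).
Proof. by rewrite -mulmxA phi_skew_mx mulmxN opprK mulKmx// metric_unit. Qed.

Local Notation P01 := (proj01 St p).
Local Notation P10 := (proj10 St p).
Local Notation F := (phiC St p).

Lemma phiC_cube : F *m F *m F = - F.
Proof. by rewrite /phiC -!cplxM phi_cube cplxN. Qed.

Let c2 : (2^-1 : C) * 2 = 1.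
Proof. by rewrite mulVf// pnatr_eq0. Qed.

Lemma proj01_phi : P01 *m F = - 'i%C *: P01.
Proof.
rewrite /proj01 -scalemxAl mulmxBl -scalemxAl phiC_cube.
move: (F *m F) => D; apply/matrixP => x y; rewrite !mxE.
by ring: (ii R).
Qed.

Lemma proj10_phi : P10 *m F = 'i%C *: P10.
Proof.
rewrite /proj10 -scalemxAl mulmxBl -scalemxAl phiC_cube.
move: (F *m F) => D; apply/matrixP => x y; rewrite !mxE.
by ring: (ii R).
Qed.

Lemma proj01_proj01 : P01 *m P01 = P01.
Proof.
rewrite {2}/proj01 -scalemxAr mulmxBr -scalemxAr mulmxA proj01_phi -scalemxAl proj01_phi.
move: P01 => P; apply/matrixP => x y; rewrite !mxE.
by ring: (ii R) c2.
Qed.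

Lemma proj10_proj01 : P10 *m P01 = 0.
Proof.
rewrite {1}/proj01 -scalemxAr mulmxBr -scalemxAr mulmxA proj10_phi -scalemxAl proj10_phi.
move: P10 => P; apply/matrixP => x y; rewrite !mxE.
by ring: (ii R).
Qed.

Lemma proj01_projE : P01 *m projE St p = P01.
Proof.
rewrite /projE mulmxN mulmxA proj01_phi -scalemxAl proj01_phi.
by rewrite scalerA mulrNN ii scaleN1r opprK.
Qed.

Lemma proj10_projE : P10 *m projE St p = P10.
Proof.
rewrite /projE mulmxN mulmxA proj10_phi -scalemxAl proj10_phi.
by rewrite scalerA ii scaleN1r opprK.
Qed.

Let proj_sum (A D : 'M[C]_m) :
  2^-1 *: ('i%C *: A - D) + 2^-1 *: (- 'i%C *: A - D) = - D.
Proof.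
apply/matrixP => x y; rewrite !mxE.
by apply: (@etrans _ _ (- (2^-1 * 2) * D x y)); [ring|rewrite c2 mulN1r].
Qed.

Lemma proj01_proj10D : P01 + P10 = - (F *m F).
Proof. exact: proj_sum. Qed.

Lemma inE01_proj01 (z : 'rV[C]_m) : inE01 St p (z *m P01).
Proof. by rewrite /inE01 -mulmxA proj01_phi -scalemxAr. Qed.

Lemma inE10_proj10 (z : 'rV[C]_m) : inE10 St p (z *m P10).
Proof. by rewrite /inE10 -mulmxA proj10_phi -scalemxAr. Qed.

Lemma inTC_compl (z : 'rV[C]_m) : inTC St p (z *m (1%:M + F *m F)).
Proof. by rewrite /inTC -mulmxA mulmxDl mul1mx phiC_cube subrr mulmx0. Qed.

Lemma proj01_compl (z : 'rV[C]_m) : z = z *m P01 + (z *m P10 + z *m (1%:M + F *m F)).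
Proof.
by rewrite addrA -!mulmxDr proj01_proj10D addrCA addNr addr0 mulmx1.
Qed.

(** The other two components of [z] lie in $E_{1,0}$ and in T, which spinors annihilate. *)
Lemma spinor_set_row_proj01 s q (A : 'M[C]_(q, m)) j z : in_spinor St p s ->
  s q (set_row j (z *m P01) A) = s q (set_row j z A).
Proof.
move=> /(_ q) [ms _ s0]; rewrite [in RHS](proj01_compl z) !(multilinearD ms).
rewrite [X in _ + (X + _)](s0 _ j); last first.
  by left; rewrite row_set_row eqxx; exact: inE10_proj10.
rewrite [X in _ + (_ + X)](s0 _ j); last first.
  by right; rewrite row_set_row eqxx; exact: inTC_compl.
by rewrite !addr0.
Qed.

Lemma spinor_proj01 s q (A : 'M[C]_(q, m)) : in_spinor St p s ->
  s q (A *m P01) = s q A.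
Proof.
move=> ss; rewrite -[RHS](forms_row_replace (f := fun v => v *m P01)).
  by congr (s q); apply/row_matrixP => j; rewrite row_mul rowK.
by move=> B j; rewrite spinor_set_row_proj01// set_row_id.
Qed.

Lemma conj_proj01 : map_mx (fun z : C => z^*) P01 = P10.
Proof.
rewrite /proj01 /proj10 /phiC -cplxM; move: (ph *m ph) ph => A B.
apply/matrixP => x y; rewrite !mxE.
by apply/eqP; rewrite eq_complex /=; apply/andP; split; apply/eqP; ring.
Qed.

(** Conjugation exchanges the images of [proj01] and [proj10], two independent subspaces of im phi,
    whose rank is 2n. This bound makes spinors vanish above degree [n], where [hpair] stops. *)
Lemma proj01_rank : (\rank P01 <= n)%N.
Proof.
have r10 : \rank P10 = \rank P01 by rewrite -conj_proj01 mxrank_map.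
have rF : \rank F = (2 * n)%N.
  by rewrite /phiC /cplx (mxrank_map (real_complex R)) phi_rank.
have s01 : (P01 <= F)%MS.
  apply/submxP; exists (2^-1 *: ('i%C%:M - F)).
  by rewrite -scalemxAl mulmxBl mul_scalar_mx.
have s10 : (P10 <= F)%MS.
  apply/submxP; exists (2^-1 *: ((- 'i%C)%:M - F)).
  by rewrite -scalemxAl mulmxBl mul_scalar_mx.
have := rank_twice_le r10 s01 s10 proj01_proj01 proj10_proj01.
by rewrite rF leq_pmul2l.
Qed.

Lemma spinor_eq0 s q A : in_spinor St p s -> (n < q)%N -> s q A = 0.
Proof.
move=> ss nq; rewrite -spinor_proj01//; have [ms as_ _] := ss q.
apply: alternating_rank => //; apply: leq_ltn_trans nq.
exact: leq_trans (mxrankM_maxr _ _) proj01_rank.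
Qed.

Local Notation ginv := (cplx (invmx g)).

(** As [phi] is skew for the metric, raising an index exchanges types: the (1,0) part of a covector
    is dual to a vector in $E_{0,1}$. *)
Lemma sharp_proj10 alpha : sharp St p (P10 *m alpha) = sharp St p alpha *m P01.
Proof.
rewrite /sharp trmx_mul -!mulmxA; congr (_ *m _).
have Fg : F^T *m ginv = - (ginv *m F).
  rewrite /phiC -cplx_tr -!cplxM -cplxN phi_tr mulNmx -!mulmxA mulmxV ?metric_unit//.
  by rewrite mulmx1.
have FFg : F^T *m F^T *m ginv = ginv *m F *m F.
  by rewrite -mulmxA Fg mulmxN mulmxA Fg mulNmx opprK.
rewrite /proj10 /proj01 linearZ/= linearB/= linearZ/= trmx_mul -scalemxAl -scalemxAr.
by rewrite mulmxBl mulmxBr -scalemxAl -scalemxAr Fg FFg scalerN scaleNr opprK mulmxA.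
Qed.

(* The two halves of the Clifford action, without the factor sqrt 2. *)
Definition dirac_wedge (s : 'I_m -> cform R n k) q : mform C m q :=
  match q with
  | 0 => fun=> 0
  | q'.+1 => fun A => \sum_j wedge (covform (P01 *m delta_mx j 0)) (s j q') A
  end.

Definition dirac_contract (s : 'I_m -> cform R n k) q : mform C m q :=
  fun A => - \sum_j s j q.+1 (col_mx (row j ginv) A).

End Pointwise.
Arguments dirac_wedge {R n k M} St p s q _.
Arguments dirac_contract {R n k M} St p s q _.

(** * The induced connection and the Cauchy-Riemann operator *)

Section ComplexFunctions.
Variables (R : realType) (d : nat) (M : manifold R d).
Local Notation C := R[i].
Implicit Types (f : M -> C) (p : M).

Definition smooth_cat f p :=
  smooth_at (fun q => complex.Re (f q)) p /\ smooth_at (fun q => complex.Im (f q)) p.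

Lemma smooth_cfun_at f p : smooth_cfun f -> smooth_cat f p.
Proof. by move=> [/smooth_funP sr /smooth_funP si]; split. Qed.

Lemma vderC_near_eq p v f f' : (\forall q \near p, f q = f' q) -> vderC p v f = vderC p v f'.
Proof.
move=> ff; rewrite /vderC.
have -> : vder p v (fun q => complex.Re (f q)) = vder p v (fun q => complex.Re (f' q)).
  by apply: vder_near_eq; apply: filterS ff => q ->.
have -> // : vder p v (fun q => complex.Im (f q)) = vder p v (fun q => complex.Im (f' q)).
by apply: vder_near_eq; apply: filterS ff => q ->.
Qed.

Lemma cvderC_near_eq p z f f' : (\forall q \near p, f q = f' q) -> cvderC p z f = cvderC p z f'.
Proof. by move=> ff; rewrite /cvderC !(vderC_near_eq _ ff). Qed.

Lemma vderC_sum_coord p v f : smooth_cat f p ->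
  vderC p v f = \sum_l (v 0 l)%:C * vderC p (delta_mx 0 l) f.
Proof.
move=> [sr si]; rewrite /vderC !(vder_sum_coord v)//.
apply/eqP; rewrite eq_complex /= !raddf_sum /=; apply/andP; split; apply/eqP.
  by apply: eq_bigr => l _; rewrite mul0r subr0.
by apply: eq_bigr => l _; rewrite mul0r addr0.
Qed.

Lemma cvderC_sum_coord p z f : smooth_cat f p ->
  cvderC p z f = \sum_l z 0 l * vderC p (delta_mx 0 l) f.
Proof.
move=> sf; rewrite /cvderC (vderC_sum_coord (Remx z) sf) (vderC_sum_coord (Immx z) sf).
rewrite mulr_sumr -big_split/=; apply: eq_bigr => l _.
by rewrite mulrA -mulrDl !mxE -complexE.
Qed.

End ComplexFunctions.

Section Torsion.
Variables (R : realType) (n k : nat).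
Local Notation m := (k + n * 2)%N.
Variables (M : manifold R m) (St : fpk_data M) (nabla : connection M).
Local Notation C := R[i].
Hypothesis Hf : is_metric_fpk St.
Hypothesis HT : is_tanaka_webster St nabla.
Implicit Types (p : M) (X Y : vfield M) (Z W : cvfield M).

Let Hc : is_connection nabla.
Proof. by have [] := HT. Qed.

Lemma smooth_vf_phi X : smooth_vf X -> smooth_vf (fun p => X p *m phi St p).
Proof. by have [h _ _ _ _] := Hf; exact: h. Qed.

Lemma nabla_phi p v Y : smooth_vf Y ->
  nabla p v (fun q => Y q *m phi St q) = nabla p v Y *m phi St p.
Proof. by have [_ [h _ _] _] := HT; exact: h. Qed.

(** The connection acts on real fields. Writing [proj01] through [phi] on real and imaginary parts
    makes the parallelism of [phi] applicable. *)
Lemma rowC_proj01 p (a b : 'rV[R]_m) :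
  (cplx a + 'i%C *: cplx b) *m proj01 St p =
  cplx (- 2^-1 *: (b *m phi St p + a *m phi St p *m phi St p)) +
  'i%C *: cplx (2^-1 *: (a *m phi St p - b *m phi St p *m phi St p)).
Proof.
have h2 : (2^-1 : R)%:C = 2^-1 by rewrite fmorphV rmorph_nat.
rewrite /proj01 -scalemxAr mulmxDl -!scalemxAl !mulmxBr -!scalemxAr !mulmxA /phiC -!cplxM.
move: (a *m phi St p) (b *m phi St p) => x y.
move: (x *m phi St p) (y *m phi St p) => x' y'.
apply/rowP => j; rewrite !mxE.
by rewrite -h2; apply/eqP; rewrite eq_complex /=; apply/andP; split; apply/eqP; ring.
Qed.

Lemma RemxM_proj01 p (z : 'rV[C]_m) : Remx (z *m proj01 St p) =
  - 2^-1 *: (Immx z *m phi St p + Remx z *m phi St p *m phi St p).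
Proof. by rewrite {1}(cplx_ReIm z) rowC_proj01 Remx_cplx. Qed.

Lemma ImmxM_proj01 p (z : 'rV[C]_m) : Immx (z *m proj01 St p) =
  2^-1 *: (Remx z *m phi St p - Immx z *m phi St p *m phi St p).
Proof. by rewrite {1}(cplx_ReIm z) rowC_proj01 Immx_cplx. Qed.

Lemma RemxM_proj01_fun Z : Revf (fun r => Z r *m proj01 St r) =
  (fun r => - 2^-1 *: (Immx (Z r) *m phi St r + Remx (Z r) *m phi St r *m phi St r)).
Proof. by apply/funext => r; exact: RemxM_proj01. Qed.

Lemma ImmxM_proj01_fun Z : Imvf (fun r => Z r *m proj01 St r) =
  (fun r => 2^-1 *: (Remx (Z r) *m phi St r - Immx (Z r) *m phi St r *m phi St r)).
Proof. by apply/funext => r; exact: ImmxM_proj01. Qed.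

(** The shape shared, up to the coefficients, by the real and imaginary parts of a field composed
    with [proj01]. *)
Let smooth_aux (a b : R) X Y : smooth_vf X -> smooth_vf Y ->
  smooth_vf (fun r => a *: (X r *m phi St r + b *: (Y r *m phi St r *m phi St r))).
Proof.
move=> sX sY; apply: (smooth_vfZ (@smooth_fun_cst _ _ M a)); apply: smooth_vfD.
  exact: smooth_vf_phi.
apply: (smooth_vfZ (@smooth_fun_cst _ _ M b)).
exact: (smooth_vf_phi (smooth_vf_phi sY)).
Qed.

Let nabla_aux p v (a b : R) X Y : smooth_vf X -> smooth_vf Y ->
  nabla p v (fun r => a *: (X r *m phi St r + b *: (Y r *m phi St r *m phi St r))) =
  a *: (nabla p v X *m phi St p + b *: (nabla p v Y *m phi St p *m phi St p)).
Proof.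
move=> sX sY; have sXp := smooth_vf_phi sX; have sYp := smooth_vf_phi sY.
have sYpp := smooth_vf_phi sYp.
have sb : smooth_vf (fun r => b *: (Y r *m phi St r *m phi St r)).
  exact: (smooth_vfZ (@smooth_fun_cst _ _ M b) sYpp).
apply: etrans (nablaZ Hc p v a (smooth_vfD sXp sb)) _; congr (_ *: _).
apply: etrans (nablaD Hc p v sXp sb) _.
apply: etrans (congr2 +%R (nabla_phi p v sX) (nablaZ Hc p v b sYpp)) _.
congr (_ + _ *: _); apply: etrans (nabla_phi p v sYp) _.
by congr (_ *m _); exact: nabla_phi.
Qed.

Let aux1 X Y : (fun r => - 2^-1 *: (X r *m phi St r + Y r *m phi St r *m phi St r)) =
  (fun r : M => - 2^-1 *: (X r *m phi St r + 1 *: (Y r *m phi St r *m phi St r))) :> vfield M.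
Proof. by apply/funext => r; rewrite scale1r. Qed.

Let aux2 X Y : (fun r => 2^-1 *: (X r *m phi St r - Y r *m phi St r *m phi St r)) =
  (fun r : M => 2^-1 *: (X r *m phi St r + (-1) *: (Y r *m phi St r *m phi St r))) :> vfield M.
Proof. by apply/funext => r; rewrite scaleN1r. Qed.

Lemma smooth_cvf_proj01 Z : smooth_cvf Z -> smooth_cvf (fun r => Z r *m proj01 St r).
Proof.
move=> [sr si]; split.
  by rewrite RemxM_proj01_fun (aux1 (Imvf Z) (Revf Z)); exact: smooth_aux.
by rewrite ImmxM_proj01_fun (aux2 (Revf Z) (Imvf Z)); exact: smooth_aux.
Qed.

Lemma nablaC_proj01 p v Z : smooth_cvf Z ->
  nablaC nabla p v (fun r => Z r *m proj01 St r) = nablaC nabla p v Z *m proj01 St p.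
Proof.
move=> [sr si]; rewrite /nablaC [RHS]rowC_proj01.
rewrite RemxM_proj01_fun (aux1 (Imvf Z) (Revf Z)) (nabla_aux _ _ _ _ si sr).
rewrite ImmxM_proj01_fun (aux2 (Revf Z) (Imvf Z)) (nabla_aux _ _ _ _ sr si).
by rewrite scale1r scaleN1r.
Qed.

Section Induced.
Variable nablaS : spinor_connection M.
Arguments nablaS : clear implicits.
Hypothesis HI : is_induced St nabla nablaS.

Lemma nablaS_spinor zeta p v : spinor_section St zeta -> in_spinor St p (nablaS p v zeta).
Proof. by move=> sz; exact: (HI sz p v).1. Qed.

(** [is_induced] states the formula only for fields in $E_{0,1}$. It extends to all complex fields
    because spinors see only the [proj01] part of their arguments and [proj01] commutes with
    [nablaC]. *)
Lemma induced_formula zeta p v q (W : 'I_q -> cvfield M) : spinor_section St zeta ->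
  (forall i, smooth_cvf (W i)) ->
  nablaS p v zeta q (\matrix_i W i p) =
    vderC p v (fun r => zeta r q (\matrix_i W i r)) -
    \sum_(j < q) zeta p q (set_row j (nablaC nabla p v (W j)) (\matrix_i W i p)).
Proof.
move=> sz sW; have [zs _] := sz.
pose W' i : cvfield M := fun r => W i r *m proj01 St r.
have WE r : \matrix_i W' i r = (\matrix_i W i r) *m proj01 St r.
  by apply/row_matrixP => i; rewrite row_mul !rowK.
rewrite -(spinor_proj01 Hf _ (nablaS_spinor p v sz)) -WE.
rewrite (HI sz p v).2; last 2 first.
- by move=> i; exact: smooth_cvf_proj01.
- by move=> i r; exact: inE01_proj01.
congr (_ - _).
  by congr vderC; apply/funext => r; rewrite WE spinor_proj01.
apply: eq_bigr => j _; rewrite nablaC_proj01// -[RHS](spinor_proj01 Hf _ (zs p)).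
congr (zeta p q _); apply/row_matrixP => i; rewrite row_mul !row_set_row.
by case: eqP => // _; rewrite WE row_mul.
Qed.

End Induced.

(** The torsion condition is given for sections of E, whereas here membership holds at [p] only. By
    tensoriality each field may be replaced by its image under the projector -phi^2, which lies in E
    everywhere and has the same value at [p]. *)
Lemma torsionE_E X Y p : smooth_vf X -> smooth_vf Y -> Defs.inE St p (X p) -> Defs.inE St p (Y p) ->
  torsion nabla X Y p = - (2 * Phi St p (X p) (Y p)) *: \sum_i xi St i p.
Proof.
move=> sX sY EX EY.
have H (Z : vfield M) : smooth_vf Z -> Defs.inE St p (Z p) -> exists Z' : vfield M,
    [/\ smooth_vf Z', forall r, Defs.inE St r (Z' r) & Z' p = Z p].
  move=> sZ /submxP[w Zw]; exists (fun r => (-1) *: (Z r *m phi St r *m phi St r)); split.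
  - apply: (smooth_vfZ (@smooth_fun_cst _ _ M (-1))).
    exact: (smooth_vf_phi (smooth_vf_phi sZ)).
  - by move=> r; apply: scalemx_sub; exact: submxMl.
  - rewrite Zw -2!mulmxA [phi St p *m (_ *m _)]mulmxA (phi_cube Hf).
    by rewrite mulmxN scaleN1r opprK.
have [X' [sX' EX' XX]] := H X sX EX; have [Y' [sY' EY' YY]] := H Y sY EY.
apply: etrans (torsion_tensor Hc sX sX' sY sY' (esym XX) (esym YY)) _.
have [_ _ [h _ _]] := HT.
by apply: etrans (h X' Y' sX' sY' EX' EY' p) _; rewrite XX YY.
Qed.

End Torsion.

(* Cancels the connection terms of d: torsion vanishes on E_{0,1}. *)
Lemma symmetric_altsum_eq0 (K : numFieldType) d q (w : mform K d q)
    (S : 'rV[K]_d -> 'rV[K]_d -> 'rV[K]_d) (A : 'M[K]_(q.+1, d)) :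
  multilinear w -> alternating w ->
  (forall i j, S (row i A) (row j A) = S (row j A) (row i A)) ->
  \sum_(j < q.+1) (-1) ^+ j *
    \sum_(i < q) w (set_row i (S (row j A) (row i (row' j A))) (row' j A)) = 0.
Proof.
move=> mw aw symS; have asw := alternating_antisymmetric mw aw.
pose G v (B : 'M[K]_(q, d)) := \sum_(i < q) w (set_row i (S v (row i B)) B).
have aG v : antisymmetric_form (G v).
  move=> t B; rewrite /G mulr_sumr (reindex_inj (@perm_inj _ t^-1%g))/=.
  apply: eq_bigr => i _; rewrite -asw row_row_perm permKV.
  congr w; apply/row_matrixP => l; rewrite row_set_row !row_row_perm row_set_row.
  by rewrite -(inj_eq (@perm_inj _ t)) permKV; case: eqP => // ->.
have : q`!%:R * (\sum_(j < q.+1) (-1) ^+ j * G (row j A) (row' j A)) = 0.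
  rewrite -(altsum (A : 'M[K]_(1 + q, d)) aG) /G.
  under eq_bigr do rewrite mulr_sumr.
  rewrite exchange_big/= big1// => i _.
  set Q := \sum_(s : 'S_(1 + q)) _.
  suff : Q = - Q by move/eqP; rewrite -addr_eq0 -mulr2n -mulr_natl mulf_eq0 pnatr_eq0/= => /eqP.
  (* Exchanging slot 0 with slot [lift ord0 i] flips the sign of the permutation, while the argument
     of [w] is unchanged by the symmetry of [S]. *)
  rewrite {1}/Q (reindex_inj (mulgI (tperm ord0 (lift ord0 i : 'I_(1 + q))))) -sumrN.
  apply: eq_bigr => s _; rewrite odd_mul_tperm neq_lift signr_addb expr1 mulN1r mulNr.
  congr (- (_ * w _)); apply/row_matrixP => l; rewrite !row_set_row.
  have dE (u : 'S_(1 + q)) (x : 'I_q) :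
      row x (dsubmx (row_perm u (A : 'M[K]_(1 + q, d)))) = row (u (lift ord0 x)) A.
    apply/rowP => c; rewrite !mxE; congr (A (u _) c); exact: val_inj.
  rewrite !dE !permM tpermL tpermR; case: eqP => [_|/eqP li]; first exact: symS.
  by rewrite tpermD ?neq_lift// (inj_eq lift_inj) eq_sym.
by move/eqP; rewrite mulf_eq0 pnatr_eq0 -leqn0 leqNgt fact_gt0/= => /eqP.
Qed.

(** * The Cauchy-Riemann operator as antisymmetrised covariant derivative *)

Section PartOne.
Variables (R : realType) (n k : nat).
Local Notation m := (k + n * 2)%N.
Variables (M : manifold R m) (St : fpk_data M) (nabla : connection M).
Variable nablaS : spinor_connection M.
Arguments nablaS : clear implicits.
Local Notation C := R[i].
Hypothesis Hf : is_metric_fpk St.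
Hypothesis HT : is_tanaka_webster St nabla.
Hypothesis HI : is_induced St nabla nablaS.
Variable p : M.
Variable X : 'I_m -> vfield M.
Hypothesis sX : forall i, smooth_vf (X i).
Hypothesis XE : \forall r \near p, forall i, X i r = row i (coord_frame (chart_at p) r).

Let Hc : is_connection nabla.
Proof. by have [] := HT. Qed.

Let XEr : \forall r \near p, cdom (chart_at p) r /\ forall i, X i r = row i (coord_frame (chart_at p) r).
Proof.
apply: filterS2 (cdom_near (chart_atP p) (mem_chart_at p)) XE => r cr xr; split.
  exact: cr.
exact: xr.
Qed.

(** A global field that near [p] is the constant-coefficient extension of [v] used by [extd]. *)
Definition const_ext (v : 'rV[R]_m) : vfield M := fun r => \sum_i v 0 i *: X i r.

Lemma smooth_const_ext v : smooth_vf (const_ext v).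
Proof. by apply: smooth_vf_sum => i; apply: smooth_vfZ; [exact: smooth_fun_cst|exact: sX]. Qed.

Lemma const_ext_near v : \forall r \near p, const_ext v r = v *m coord_frame (chart_at p) r.
Proof.
apply: filterS XEr => r [_ xr]; rewrite mulmx_sum_row; apply: eq_bigr => i _.
by rewrite xr.
Qed.

Lemma const_extE v : const_ext v p = v.
Proof.
have E := nbhs_singleton (const_ext_near v).
by apply: etrans E _; rewrite coord_frame_id mulmx1.
Qed.

Let vder_const_ext v j : \forall r \near p, vder r (const_ext v r) (Defs.coord p j) = v 0 j.
Proof.
apply: filterS2 XEr (const_ext_near v) => r [cr _] ->.
have aq := atlas_chart_at p.
transitivity (dcoord (chart_at p) r (v *m coord_frame (chart_at p) r) 0 j).
  by rewrite mxE.
by rewrite dcoordE// mulmxK// coord_frame_unit.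
Qed.

Lemma lie_const_ext u v : lie (const_ext u) (const_ext v) p = 0.
Proof.
apply/rowP => j; apply: etrans (lieE _ _ _ _) _; rewrite [RHS]mxE.
have Z (w y : 'rV[R]_m) : vder p w (fun r => vder r (const_ext y r) (Defs.coord p j)) = 0.
  by apply: etrans (vder_near_eq w (vder_const_ext y j)) _; exact: vder_cst.
by apply: etrans (congr2 (fun a b => a - b) (Z _ v) (Z _ u)) _; rewrite subrr.
Qed.

(** The Christoffel symbols of [nabla] at [p] in the chart attached to [p], as a map of two
    vectors. *)
Definition flat_nabla (u v : 'rV[R]_m) : 'rV[R]_m := nabla p u (const_ext v).

Lemma flat_nabla_torsion u v :
  flat_nabla u v - flat_nabla v u = torsion nabla (const_ext u) (const_ext v) p.
Proof. by rewrite /torsion lie_const_ext subr0 !const_extE. Qed.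

Lemma flat_nabla_E u v : Defs.inE St p u -> Defs.inE St p v ->
  flat_nabla u v - flat_nabla v u = - (2 * Phi St p u v) *: \sum_i xi St i p.
Proof.
move=> Eu Ev; rewrite flat_nabla_torsion.
have := @torsionE_E _ _ _ _ St nabla Hf HT (const_ext u) (const_ext v) p
  (smooth_const_ext u) (smooth_const_ext v).
by rewrite !const_extE => /(_ Eu Ev).
Qed.

Definition flat_nablaC (z w : 'rV[C]_m) : 'rV[C]_m :=
  cplx (flat_nabla (Remx z) (Remx w) - flat_nabla (Immx z) (Immx w)) +
  'i%C *: cplx (flat_nabla (Remx z) (Immx w) + flat_nabla (Immx z) (Remx w)).

Lemma inE01_ReIm z : inE01 St p z ->
  Remx z *m phi St p = Immx z /\ Immx z *m phi St p = - Remx z.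
Proof.
rewrite /inE01 {1 2}(cplx_ReIm z) mulmxDl -scalemxAl /phiC -!cplxM.
have -> : - 'i%C *: (cplx (Remx z) + 'i%C *: cplx (Immx z)) =
          cplx (Immx z) + 'i%C *: cplx (- Remx z).
  rewrite scalerDr scalerA mulNr ii opprK scale1r addrC; congr (_ + _).
  by rewrite cplxN scalerN scaleNr.
move=> E; split.
  by have := congr1 (@Remx _ _ _) E; rewrite !Remx_cplx.
by have := congr1 (@Immx _ _ _) E; rewrite !Immx_cplx.
Qed.

(** Brackets of constant-coefficient fields vanish at [p], so the antisymmetric part of the
    Christoffel map is the torsion. On $E_{0,1}$ it is a multiple of the complex extension of Phi,
    which vanishes there: with z = a + ib and w = c + id one has Phi(a, c) = Phi(b, d) and Phi(a, d)
    = - Phi(b, c). *)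
Lemma flat_nablaC_sym z w : inE01 St p z -> inE01 St p w ->
  flat_nablaC z w = flat_nablaC w z.
Proof.
move=> /inE01_ReIm [ab ba] /inE01_ReIm [cd dc].
rewrite /flat_nablaC; move: (Remx z) (Immx z) (Remx w) (Immx w) ab ba cd dc => a b c d ab ba cd dc.
have Ea : Defs.inE St p a by rewrite /Defs.inE -[a]opprK -ba eqmx_opp submxMl.
have Eb : Defs.inE St p b by rewrite /Defs.inE -ab submxMl.
have Ec : Defs.inE St p c by rewrite /Defs.inE -[c]opprK -dc eqmx_opp submxMl.
have Ed : Defs.inE St p d by rewrite /Defs.inE -cd submxMl.
have P1 : Phi St p a c = Phi St p b d.
  by rewrite /Phi ba gprodNl -cd -(phi_skew Hf).
have P2 : Phi St p a d = - Phi St p b c.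
  rewrite /Phi ab ba gprodNl opprK [RHS](metric_phi Hf) ab cd big1 ?addr0// => i _.
  by rewrite -[a]opprK -ba -mulNmx (eta_phi Hf) mul0r.
have T1 := flat_nabla_E Ea Ec; have T2 := flat_nabla_E Eb Ed.
have T3 := flat_nabla_E Ea Ed; have T4 := flat_nabla_E Eb Ec.
congr (cplx _ + _ *: cplx _).
  apply: subr0_eq; rewrite subrACA; apply/eqP; rewrite subr_eq0; apply/eqP.
  by apply: etrans T1 _; rewrite P1; exact: esym.
apply: subr0_eq; rewrite [flat_nabla c b + _]addrC opprD addrACA.
apply: etrans (congr2 +%R T3 T4) _; rewrite P2.
by rewrite mulrN opprK scaleNr subrr.
Qed.

Lemma flat_nablaC_sum z w :
  flat_nablaC z w = \sum_l z 0 l *: (cplx (flat_nabla (delta_mx 0 l) (Remx w)) +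
     'i%C *: cplx (flat_nabla (delta_mx 0 l) (Immx w))).
Proof.
have D (u v : 'rV[R]_m) : flat_nabla u v = \sum_l u 0 l *: flat_nabla (delta_mx 0 l) v.
  by apply: (nabla_v_sum Hc); exact: smooth_const_ext.
have cs (f : 'I_m -> 'rV[R]_m) (u : 'rV[R]_m) : cplx (\sum_l u 0 l *: f l) = \sum_l (u 0 l)%:C *: cplx (f l).
  elim/big_ind2 : _ => [|x1 x2 y1 y2 <- <-|l _]; [exact: cplx0|exact: cplxD|exact: cplxZ].
rewrite /flat_nablaC cplxB cplxD !(D (Remx z)) !(D (Immx z)) !cs.
rewrite -sumrB -big_split scaler_sumr -big_split/=; apply: eq_bigr => l _.
rewrite [z 0 l in RHS]complexE !mxE.
move: (cplx (flat_nabla _ (Remx w))) (cplx (flat_nabla _ (Immx w))) => x y.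
move: (complex.Re _)%:C (complex.Im _)%:C => a b.
by apply/rowP => j; rewrite !mxE; ring: (ii R).
Qed.

Definition const_extC (w : 'rV[C]_m) : cvfield M := fun r =>
  cplx (const_ext (Remx w) r) + 'i%C *: cplx (const_ext (Immx w) r).

Lemma Revf_const_extC w : Revf (const_extC w) = const_ext (Remx w).
Proof. by apply/funext => r; exact: Remx_cplx. Qed.

Lemma Imvf_const_extC w : Imvf (const_extC w) = const_ext (Immx w).
Proof. by apply/funext => r; exact: Immx_cplx. Qed.

Lemma smooth_const_extC w : smooth_cvf (const_extC w).
Proof.
by split; rewrite ?Revf_const_extC ?Imvf_const_extC; exact: smooth_const_ext.
Qed.

Lemma const_extC_near w :
  \forall r \near p, const_extC w r = w *m cplx (coord_frame (chart_at p) r).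
Proof.
apply: filterS2 (const_ext_near (Remx w)) (const_ext_near (Immx w)) => r E1 E2.
by rewrite /const_extC E1 E2 !cplxM [in RHS](cplx_ReIm w) mulmxDl -scalemxAl.
Qed.

Lemma const_extCE w : const_extC w p = w.
Proof. by rewrite /const_extC !const_extE -cplx_ReIm. Qed.

(** Each directional derivative in [extd] is a covariant derivative plus Christoffel terms. The
    latter are symmetric on $E_{0,1}$ and so cancel in the alternating sum. *)
Lemma extd_nablaS zeta q (A : 'M[C]_(q.+1, m)) : spinor_section St zeta ->
  extd (fun r => zeta r q) p (A *m proj01 St p) =
  \sum_(j < q.+1) (-1) ^+ j * \sum_l (row j A *m proj01 St p) 0 l *
     nablaS p (delta_mx 0 l) zeta q (row' j A).
Proof.
move=> sz; set B := A *m proj01 St p.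
have [mz az _] := sz.1 p q.
have rowB j : row j A *m proj01 St p = row j B by rewrite row_mul.
have rowB' j i : row i (row' j B) = row (lift j i) B by apply/rowP => c; rewrite !mxE.
have step j : cvderC p (row j B)
     (fun r => zeta r q (row' j B *m cplx (coord_frame (chart_at p) r))) =
   \sum_l (row j B) 0 l * nablaS p (delta_mx 0 l) zeta q (row' j A) +
   \sum_(i < q) zeta p q (set_row i (flat_nablaC (row j B) (row i (row' j B))) (row' j B)).
  pose W i := const_extC (row i (row' j B)).
  have sW i : smooth_cvf (W i) by exact: smooth_const_extC.
  have nW l i : nablaC nabla p (delta_mx 0 l) (W i) =
      cplx (flat_nabla (delta_mx 0 l) (Remx (row i (row' j B)))) +
      'i%C *: cplx (flat_nabla (delta_mx 0 l) (Immx (row i (row' j B)))).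
    by rewrite /nablaC Revf_const_extC Imvf_const_extC.
  have WE : \matrix_i W i p = row' j B.
    by apply/row_matrixP => i; rewrite rowK /W const_extCE.
  have E0 : cvderC p (row j B)
     (fun r => zeta r q (row' j B *m cplx (coord_frame (chart_at p) r))) =
     cvderC p (row j B) (fun r => zeta r q (\matrix_i W i r)).
    apply: cvderC_near_eq.
    have : \forall r \near p, forall i, W i r = row i (row' j B) *m cplx (coord_frame (chart_at p) r).
      apply: (@filter_forall _ _ (fun i r => W i r = row i (row' j B) *m cplx (coord_frame (chart_at p) r)) (nbhs p) (nbhs_filter p)) => i.
      exact: const_extC_near.
    apply: filterS => r Wr; congr (zeta r q _); apply/row_matrixP => i.
    by rewrite row_mul rowK Wr.
  rewrite E0 cvderC_sum_coord; last by apply: smooth_cfun_at; exact: sz.2.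
  have E1 l : vderC p (delta_mx 0 l) (fun r => zeta r q (\matrix_i W i r)) =
      nablaS p (delta_mx 0 l) zeta q (row' j A) +
      \sum_(i < q) zeta p q (set_row i (nablaC nabla p (delta_mx 0 l) (W i)) (row' j B)).
    have := induced_formula Hf HT HI p (delta_mx 0 l) sz sW; rewrite WE => IF.
    have -> : nablaS p (delta_mx 0 l) zeta q (row' j A) = nablaS p (delta_mx 0 l) zeta q (row' j B).
      rewrite -(spinor_proj01 Hf _ (nablaS_spinor HI p (delta_mx 0 l) sz)); congr (nablaS _ _ _ _ _).
      by apply/row_matrixP => i; rewrite row_mul rowB' -rowB; congr (_ *m _); apply/rowP => c; rewrite !mxE.
    by rewrite IF subrK.
  under eq_bigr do rewrite E1 mulrDr mulr_sumr.
  rewrite big_split/=; congr (_ + _).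
  rewrite exchange_big/=; apply: eq_bigr => i _.
  rewrite flat_nablaC_sum (multilinear_sum mz); apply: eq_bigr => l _.
  by rewrite nW.
rewrite /extd; under eq_bigr do rewrite step mulrDr.
rewrite big_split/= [X in _ + X]symmetric_altsum_eq0 ?addr0//.
  by apply: eq_bigr => j _; rewrite rowB.
by move=> i j; apply: flat_nablaC_sym; rewrite -rowB; exact: inE01_proj01.
Qed.

End PartOne.

Section DbarbDirac.
Variables (R : realType) (n k : nat).
Local Notation C := R[i].
Local Notation m := (k + n * 2)%N.
Variables (M : manifold R m) (St : fpk_data M) (nabla : connection M).
Variable nablaS : spinor_connection M.
Arguments nablaS : clear implicits.
Hypothesis Hf : is_metric_fpk St.
Hypothesis HT : is_tanaka_webster St nabla.
Hypothesis HI : is_induced St nabla nablaS.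

Lemma dirac_wedgeE p (s : 'I_m -> cform R n k) q A : (forall l, in_spinor St p (s l)) ->
  dirac_wedge St p s q.+1 A = \sum_(j < q.+1) (-1) ^+ j *
    \sum_l (row j A *m proj01 St p) 0 l * s l q (row' j A).
Proof.
move=> ss; rewrite /dirac_wedge.
have E l : wedge (covform (proj01 St p *m delta_mx l 0)) (s l q) A =
   \sum_(j < q.+1) (-1) ^+ j * ((row j A *m proj01 St p) 0 l * s l q (row' j A)).
  have [ms as_ _] := ss l q.
  rewrite wedge1E; last exact: alternating_antisymmetric.
  by apply: eq_bigr => j _; rewrite mulmxA -colE mxE.
under eq_bigr do rewrite E.
by rewrite exchange_big/=; apply: eq_bigr => j _; rewrite mulr_sumr.
Qed.

Lemma dbarb_dirac_wedge zeta p q A : spinor_section St zeta ->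
  (dbarb St zeta : csection M) p q A =
  dirac_wedge St p (fun l => nablaS p (delta_mx 0 l) zeta) q A.
Proof.
move=> sz; case: q A => [//|q] A.
rewrite dirac_wedgeE; last by move=> l; exact: (nablaS_spinor HI).
have [X [sX XE]] := frame_extension (atlas_chart_at p) (mem_chart_at p).
exact: (extd_nablaS Hf HT HI sX XE).
Qed.

(** [projE] is absorbed by both type projectors. In the contraction, the [proj10] on the covector
    becomes a [proj01] on the dual vector, which spinors do not notice. *)
Lemma DiracE zeta p q A : spinor_section St zeta ->
  (Dirac St nablaS zeta : csection M) p q A = (Num.sqrt 2)%:C%C *
    (dirac_wedge St p (fun l => nablaS p (delta_mx 0 l) zeta) q A +
     dirac_contract St p (fun l => nablaS p (delta_mx 0 l) zeta) q A).
Proof.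
move=> sz; rewrite /Dirac /clifford -mulr_sumr; congr (_ * _).
rewrite sumrB; congr (_ + _); last first.
  congr (- _); apply: eq_bigr => l _; rewrite /iota_g.
  have -> : sharp St p (proj10 St p *m (projE St p *m (delta_mx l 0 : 'cV[C]_m))) =
      row l (cplx (invmx (metric St p))) *m proj01 St p.
    have E : proj10 St p *m (projE St p *m delta_mx l 0) = proj10 St p *m (delta_mx l 0 : 'cV[C]_m).
      by rewrite mulmxA (proj10_projE Hf).
    by rewrite E (sharp_proj10 Hf) /sharp trmx_delta -rowE.
  have ss := nablaS_spinor HI p (delta_mx 0 l) sz.
  have := spinor_set_row_proj01 Hf (col_mx (0 : 'rV[C]_m) A : 'M[C]_(q.+1, m)) ord0
    (row l (cplx (invmx (metric St p)))) ss.
  by rewrite (set_row_col_mx0 0) (set_row_col_mx0 0).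
case: q A => [|q] A; first by rewrite big1.
by apply: eq_bigr => l _; rewrite mulmxA (proj01_projE Hf).
Qed.

End DbarbDirac.

(** * The Hermitian pairing *)

Section GermAlgebra.
Variables (R : realType) (d : nat) (M : manifold R d) (p : M).
Implicit Types f g : M -> R.

(* Used for the smooth germs and for those with vanishing differential at p; the
   latter show without computation that Gram matrices and volumes of frames
   parallel at p are stationary. *)
Record germ_algebra (P : (M -> R) -> Prop) : Prop := GermAlgebra {
  germ_smooth : forall f, P f -> smooth_at f p;
  germ_cst : forall a, P (fun=> a);
  germD : forall f g, P f -> P g -> P (fun q => f q + g q);
  germM : forall f g, P f -> P g -> P (fun q => f q * g q);
  germV : forall f, P f -> f p != 0 -> P (fun q => (f q)^-1);
  germ_near : forall f g, (\forall q \near p, f q = g q) -> P f -> P g }.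

Definition stationary_at f := smooth_at f p /\ forall v, vder p v f = 0.

Lemma smooth_germ_algebra : germ_algebra (fun f => smooth_at f p).
Proof.
split => //.
- by move=> a; exact: smooth_at_cst.
- by move=> f g; exact: smooth_atD.
- by move=> f g; exact: smooth_atM.
- by move=> f; exact: smooth_atV.
- by move=> f g; exact: smooth_at_near_eq.
Qed.

Lemma stationary_germ_algebra : germ_algebra stationary_at.
Proof.
split.
- by move=> f [].
- by move=> a; split; [exact: smooth_at_cst|move=> v; exact: vder_cst].
- move=> f g [sf df] [sg dg]; split; first exact: smooth_atD.
  by move=> v; rewrite vderD// df dg addr0.
- move=> f g [sf df] [sg dg]; split; first exact: smooth_atM.
  by move=> v; rewrite vderM// df dg !mulr0 addr0.
- move=> f [sf df] fp; have sV := smooth_atV sf fp; split => // v.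
  have : vder p v (fun q => f q * (f q)^-1) = 0.
    transitivity (vder p v (fun=> 1)); last exact: vder_cst.
    apply: vder_near_eq; have := smooth_at_continuous sf => /cvgr_neq0 - /(_ fp).
    by apply: filterS => q fq; rewrite mulfV.
  by rewrite vderM// df mulr0 addr0 => /eqP; rewrite mulf_eq0 (negbTE fp) => /eqP.
- move=> f g fg [sf df]; split; first exact: smooth_at_near_eq fg sf.
  by move=> v; rewrite -(vder_near_eq v fg).
Qed.

Section Closure.
Variables (P : (M -> R) -> Prop) (aP : germ_algebra P).

Lemma germ_sum (I : Type) (s : seq I) (Q : pred I) (F : I -> M -> R) :
  (forall i, P (F i)) -> P (fun q => \sum_(i <- s | Q i) F i q).
Proof.
move=> PF; elim: s => [|i s IH].
  have -> : (fun q => \sum_(i <- [::] | Q i) F i q) = (fun=> 0) :> (M -> R).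
    by apply/funext => q; rewrite big_nil.
  exact: germ_cst.
case: (boolP (Q i)) => Qi.
  have -> : (fun q => \sum_(i <- i :: s | Q i) F i q) = (fun q => F i q + \sum_(i <- s | Q i) F i q).
    by apply/funext => q; rewrite big_cons Qi.
  exact: germD.
have -> // : (fun q => \sum_(i <- i :: s | Q i) F i q) = (fun q => \sum_(i <- s | Q i) F i q).
by apply/funext => q; rewrite big_cons (negbTE Qi).
Qed.

Lemma germ_prod (I : Type) (s : seq I) (Q : pred I) (F : I -> M -> R) :
  (forall i, P (F i)) -> P (fun q => \prod_(i <- s | Q i) F i q).
Proof.
move=> PF; elim: s => [|i s IH].
  have -> : (fun q => \prod_(i <- [::] | Q i) F i q) = (fun=> 1) :> (M -> R).
    by apply/funext => q; rewrite big_nil.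
  exact: germ_cst.
case: (boolP (Q i)) => Qi.
  have -> : (fun q => \prod_(i <- i :: s | Q i) F i q) = (fun q => F i q * \prod_(i <- s | Q i) F i q).
    by apply/funext => q; rewrite big_cons Qi.
  exact: germM.
have -> // : (fun q => \prod_(i <- i :: s | Q i) F i q) = (fun q => \prod_(i <- s | Q i) F i q).
by apply/funext => q; rewrite big_cons (negbTE Qi).
Qed.

Lemma germZ (a : R) f : P f -> P (fun q => a * f q).
Proof. by move=> Pf; apply: (germM aP _ Pf); exact: germ_cst. Qed.

Lemma germ_det e (A : M -> 'M[R]_e) : (forall i j, P (fun q => A q i j)) ->
  P (fun q => \det (A q)).
Proof.
move=> PA; rewrite /determinant; apply: germ_sum => s.
by apply: germZ; apply: germ_prod => i; exact: PA.
Qed.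

(** Cramer's rule expresses the entries of the inverse through those of [A]; it is valid near [p],
    where the determinant stays nonzero. *)
Lemma germ_invmx e (A : M -> 'M[R]_e) i j : (forall i j, P (fun q => A q i j)) ->
  A p \in unitmx -> P (fun q => invmx (A q) i j).
Proof.
move=> PA uA; have PD := germ_det PA.
have d0 : \det (A p) != 0 by rewrite -unitfE; move: uA; rewrite unitmxE.
have PE : P (fun q => (\det (A q))^-1 * cofactor (A q) j i).
  apply: germM; [by []|exact: germV|].
  rewrite /cofactor; apply: germZ => //; apply: germ_det => a b.
  have -> : (fun q => row' j (col' i (A q)) a b) = (fun q => A q (lift j a) (lift i b)).
    by apply/funext => q; rewrite !mxE.
  exact: PA.
apply: (germ_near aP _ PE).
have := smooth_at_continuous (germ_smooth aP PD) => /cvgr_neq0 - /(_ d0).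
by apply: filterS => q dq; rewrite /invmx unitmxE unitfE dq !mxE.
Qed.

Lemma germ_wedge a b (u : M -> mform R d a) (w : M -> mform R d b) (A : M -> 'M[R]_(a + b, d)) :
  (forall s, P (fun q => u q (usubmx (row_perm s (A q))))) ->
  (forall s, P (fun q => w q (dsubmx (row_perm s (A q))))) ->
  P (fun q => wedge (u q) (w q) (A q)).
Proof.
move=> Pu Pw; rewrite /wedge; apply: germZ; apply: germ_sum => s.
by apply: germZ; exact: germM.
Qed.

End Closure.
End GermAlgebra.

Definition posdef (R : rcfType) d (A : 'M[R]_d) : Prop :=
  A^T = A /\ forall v : 'rV[R]_d, v != 0 -> 0 < (v *m A *m v^T) 0 0.

Lemma cholesky_step (R : rcfType) d (A : 'M[R]_(1 + d)) :
  (forall B : 'M[R]_d, posdef B -> exists2 L : 'M[R]_d, L \in unitmx & B = L *m L^T) ->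
  posdef A -> exists2 L : 'M[R]_(1 + d), L \in unitmx & A = L *m L^T.
Proof.
move=> IH [symA posA].
pose a : R := ulsubmx A 0 0; pose b := ursubmx A; pose D := drsubmx A.
have AE : A = block_mx a%:M b b^T D.
  rewrite -[LHS]submxK -/b -/D; congr block_mx; first exact: mx11_scalar.
  by rewrite /b trmx_ursub symA.
have symD : D^T = D by rewrite /D trmx_drsub symA.
have quad (x : R) (v : 'rV[R]_d) :
    (row_mx x%:M v *m A *m (row_mx x%:M v)^T) 0 0 =
    x * x * a + 2 * x * (v *m b^T) 0 0 + (v *m D *m v^T) 0 0.
  rewrite AE mul_row_block tr_row_mx mul_row_col !mulmxDl tr_scalar_mx.
  have -> : x%:M *m b *m v^T = (x * (v *m b^T) 0 0)%:M.
    rewrite mul_scalar_mx -scalemxAl [b *m v^T]mx11_scalar scale_scalar_mx.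
    by rewrite -[b *m v^T]trmxK trmx_mul trmxK [_^T 0 0]mxE.
  rewrite [v *m b^T]mx11_scalar -!scalar_mxM.
  by rewrite !mxE eqxx !mulr1n; ring.
have a0 : 0 < a.
  have := posA (row_mx 1%:M 0); rewrite quad !mul0mx !mxE !mulr0 !addr0 !mul1r; apply.
  apply/eqP => /(congr1 (@lsubmx _ _ _ _)); rewrite row_mxKl linear0 => /matrixP /(_ 0 0).
  by rewrite !mxE eqxx => /eqP; rewrite oner_eq0.
have an0 : a != 0 by rewrite gt_eqF.
pose S := D - a^-1 *: (b^T *m b).
have posS : posdef S.
  split.
    by rewrite /S linearB linearZ/= trmx_mul trmxK symD.
  (* This [x] minimises the quadratic form over its first coordinate; the minimum is the Schur
     complement evaluated at [v]. *)
  move=> v v0; pose x := - a^-1 * (v *m b^T) 0 0.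
  have := posA (row_mx x%:M v); rewrite quad.
  have -> : (v *m S *m v^T) 0 0 = x * x * a + 2 * x * (v *m b^T) 0 0 + (v *m D *m v^T) 0 0.
    rewrite /S mulmxBr mulmxBl -scalemxAr -scalemxAl.
    have -> : v *m (b^T *m b) *m v^T = (((v *m b^T) 0 0) ^+ 2)%:M.
      rewrite mulmxA -mulmxA [v *m b^T in LHS]mx11_scalar -[b *m v^T]trmxK trmx_mul trmxK.
      by rewrite [v *m b^T in LHS]mx11_scalar tr_scalar_mx -scalar_mxM expr2 !mxE eqxx mulr1n.
    set y := (v *m b^T) 0 0 in x *; rewrite /x; move: (v *m D *m v^T) => z.
    by rewrite !mxE eqxx mulr1n; field.
  apply; apply/eqP => /(congr1 (@rsubmx _ _ _ _)); rewrite row_mxKr linear0 => v00.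
  by rewrite v00 eqxx in v0.
have [L uL SE] := IH S posS.
pose r := Num.sqrt a; have rr : r * r = a by rewrite -expr2 sqr_sqrtr// ltW.
have r0 : r != 0 by rewrite gt_eqF// sqrtr_gt0.
exists (block_mx r%:M 0 (r^-1 *: b^T) L).
  by rewrite unitmxE det_lblock unitrM -!unitmxE uL andbT unitmxE det_scalar1 unitfE.
rewrite tr_block_mx mulmx_block AE; congr block_mx.
- by rewrite trmx0 mulmx0 addr0 tr_scalar_mx -scalar_mxM rr.
- by rewrite mul0mx addr0 linearZ/= trmxK mul_scalar_mx scalerA mulfV// scale1r.
- by rewrite trmx0 mulmx0 addr0 tr_scalar_mx mul_mx_scalar scalerA mulfV// scale1r.
- rewrite -SE linearZ/= trmxK -scalemxAl -scalemxAr scalerA -invfM rr.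
  by rewrite addrC subrK.
Qed.

(** The inverse of the factor is an orthonormal frame, in which the Hermitian pairing becomes a sum
    of squares. *)
Lemma cholesky (R : rcfType) d (A : 'M[R]_d) : posdef A ->
  exists2 L : 'M[R]_d, L \in unitmx & A = L *m L^T.
Proof.
elim: d A => [|d IH] A pA; last exact: (cholesky_step IH pA).
by exists 1%:M; [exact: unitmx1|apply/matrixP => -[]].
Qed.

Section Hform.
Variable R : realType.
Local Notation C := R[i].

(** Defined on arrays of components, so that the components in any frame can be inserted together
    with the inverse Gram matrix of that frame. *)
Definition hform q d (H : 'M[R]_d) (s t : {ffun 'I_q -> 'I_d} -> C) : C :=
  \sum_(I : {ffun 'I_q -> 'I_d}) \sum_(J : {ffun 'I_q -> 'I_d})
    (\prod_(a < q) (H (I a) (J a))%:C) * (Num.conj (s I) * t J).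

Definition frame_values q d m (F : 'M[R]_(d, m)) (w : mform C m q) : {ffun 'I_q -> 'I_d} -> C :=
  fun I => w (\matrix_a row (I a) (cplx F)).

Lemma frame_values_expand q d m (F : 'M[R]_(d, m)) (w : mform C m q) I : multilinear w ->
  frame_values F w I =
  \sum_(K : {ffun 'I_q -> 'I_m}) (\prod_a (F (I a) (K a))%:C) * frame_values 1%:M w K.
Proof.
move=> mw; rewrite /frame_values -[\matrix_a row (I a) _]mulmx1 -[1%:M]cplx1.
rewrite multilinear_expand//; apply: eq_bigr => K _; congr (_ * _).
by apply: eq_bigr => a _; rewrite !mxE.
Qed.

(** The components and [H] transform oppositely under a change of frame. The sums factor over the
    [q] slots, which is how the product of entries of the transformed matrix arises. *)
Lemma hform_change q d m (F : 'M[R]_(d, m)) (H : 'M[R]_d) (s t : mform C m q) :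
  multilinear s -> multilinear t ->
  hform (F^T *m H *m F) (frame_values 1%:M s) (frame_values 1%:M t) =
  hform H (frame_values F s) (frame_values F t).
Proof.
move=> ms mt; rewrite /hform.
have cE I : Num.conj (frame_values F s I) =
    \sum_(K : {ffun 'I_q -> 'I_m}) (\prod_a (F (I a) (K a))%:C) * Num.conj (frame_values 1%:M s K).
  rewrite (frame_values_expand _ _ ms) rmorph_sum; apply: eq_bigr => K _.
  rewrite rmorphM rmorph_prod; congr (_ * _); apply: eq_bigr => a _.
  by apply/eqP; rewrite eq_complex /= oppr0 !eqxx.
transitivity (\sum_(I' : {ffun 'I_q -> 'I_d}) \sum_(J' : {ffun 'I_q -> 'I_d})
   \sum_(I : {ffun 'I_q -> 'I_m}) \sum_(J : {ffun 'I_q -> 'I_m})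
   (\prod_(a < q) ((F (I' a) (I a) * H (I' a) (J' a) * F (J' a) (J a))%:C)) *
   (Num.conj (frame_values 1%:M s I) * frame_values 1%:M t J)); last first.
  apply: eq_bigr => I' _; apply: eq_bigr => J' _.
  rewrite cE (frame_values_expand _ _ mt).
  rewrite mulr_suml mulr_sumr; apply: eq_bigr => I _.
  rewrite !mulr_sumr; apply: eq_bigr => J _.
  have -> : \prod_(a < q) (F (I' a) (I a) * H (I' a) (J' a) * F (J' a) (J a))%:C =
    (\prod_a (F (I' a) (I a))%:C) * (\prod_(a < q) (H (I' a) (J' a))%:C) *
    (\prod_a (F (J' a) (J a))%:C) :> C.
    by rewrite -!big_split/=; apply: eq_bigr => a _; rewrite !rmorphM.
  move: (\prod_a _) (\prod_a _) (\prod_a _) => x y z; ring.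
under [RHS]eq_bigr do rewrite exchange_big/=.
rewrite [RHS]exchange_big/=; apply: eq_bigr => I _.
under [RHS]eq_bigr do rewrite exchange_big/=.
rewrite [RHS]exchange_big/=; apply: eq_bigr => J _.
under [RHS]eq_bigr do rewrite -mulr_suml.
rewrite -mulr_suml; congr (_ * _).
transitivity (\prod_(a < q) \sum_(i < d) \sum_(j < d) (F i (I a) * H i j * F j (J a))%:C).
  apply: eq_bigr => a _.
  transitivity ((\sum_(i < d) \sum_(j < d) F i (I a) * H i j * F j (J a))%:C : C); last first.
    by rewrite rmorph_sum; apply: eq_bigr => i _; rewrite rmorph_sum.
  congr (_%:C).
  rewrite !mxE exchange_big/=; apply: eq_bigr => j _; rewrite !mxE mulr_suml.
  by apply: eq_bigr => i _; rewrite !mxE.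
rewrite bigA_distr_bigA/=; apply: eq_bigr => I' _.
by rewrite bigA_distr_bigA.
Qed.

Lemma Re_hform q d (H : 'M[R]_d) (s t : {ffun 'I_q -> 'I_d} -> C) :
  complex.Re (hform H s t) = \sum_(I : {ffun 'I_q -> 'I_d}) \sum_(J : {ffun 'I_q -> 'I_d})
    (\prod_(a < q) H (I a) (J a)) *
     (complex.Re (s I) * complex.Re (t J) + complex.Im (s I) * complex.Im (t J)).
Proof.
rewrite /hform raddf_sum; apply: eq_bigr => I _; rewrite raddf_sum; apply: eq_bigr => J _.
rewrite -rmorph_prod; case: (s I) (t J) => a b [c e] /=; ring.
Qed.

Lemma hform1 q d (s : {ffun 'I_q -> 'I_d} -> C) :
  complex.Re (hform 1%:M s s) = \sum_I (complex.Re (s I) ^+ 2 + complex.Im (s I) ^+ 2).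
Proof.
rewrite Re_hform; apply: eq_bigr => I _; rewrite (bigD1 I)//= [X in _ + X]big1 ?addr0.
  rewrite big1 ?mul1r ?expr2//.
  by move=> a _; rewrite mxE eqxx.
move=> J JI; have [a Ha] : exists a, I a != J a.
  apply/existsP; rewrite -negb_forall; apply: contra JI => /forallP h.
  by apply/eqP/ffunP => a; apply/esym/eqP.
by rewrite (bigD1 a)//= mxE (negbTE Ha) !mul0r.
Qed.

End Hform.

Lemma antisymmetric_move_row (K : numFieldType) d q (w : mform K d q.+1) (j : 'I_q.+1)
    (A : 'M[K]_(q.+1, d)) : antisymmetric_form w ->
  w A = (-1) ^+ j * w (col_mx (row j A) (row' j A)).
Proof.
move=> aw; have -> : col_mx (row j A) (row' j A) = row_perm (lift_perm ord0 j 1) A :> 'M[K]_(q.+1, d).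
  apply/row_matrixP => i; rewrite row_row_perm; case: (unliftP ord0 i) => [b|] ->.
    rewrite row_col_mxS lift_perm_lift perm1.
    by apply/rowP => c; rewrite !mxE.
  by rewrite row_col_mx0 lift_perm_id.
rewrite aw odd_lift_perm odd_perm1 addbF addFb signr_odd mulrA -expr2 sqrr_sign.
by rewrite mul1r.
Qed.

Section Hpair.
Variables (R : realType) (n k : nat).
Local Notation m := (k + n * 2)%N.
Variables (M : manifold R m) (St : fpk_data M).
Local Notation C := R[i].
Hypothesis Hf : is_metric_fpk St.
Variable p : M.
Local Notation H := (invmx (metric St p)).
Local Notation fv := (frame_values 1%:M).

Definition contract (u : 'rV[C]_m) (t : cform R n k) : cform R n k :=
  fun q (A : 'M[C]_(q, m)) => t q.+1 (col_mx u A).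
Arguments contract u t q A : clear implicits.

Lemma frame_values1 q (w : mform C m q) I : fv w I = w (\matrix_a delta_mx 0 (I a)).
Proof. by congr w; apply/row_matrixP => a; rewrite !rowK cplx1 row1. Qed.

Lemma hpairE (s t : cform R n k) : hpair St p s t =
  \sum_(q < n.+1) (q`!%:R)^-1 * hform H (fv (s q)) (fv (t q)).
Proof.
apply: eq_bigr => q _; congr (_ * _); apply: eq_bigr => I _; apply: eq_bigr => J _.
by rewrite !frame_values1.
Qed.

Lemma metric_inv_sym : H^T = H.
Proof. by rewrite trmx_inv (metric_sym Hf). Qed.

(** Wedging is adjoint to contraction. For each position of the wedged covector the matching
    argument of [t] is moved to the front, which produces the same sign twice; the [q.+1] positions
    then contribute equally. The conjugate of [proj01] is [proj10], which turns into a [proj01]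
    absorbed by [t]. *)
Lemma hform_dirac_wedge (s : 'I_m -> cform R n k) (t : cform R n k) q :
  (forall l, in_spinor St p (s l)) -> in_spinor St p t ->
  hform H (fv (dirac_wedge St p s q.+1)) (fv (t q.+1)) =
  q.+1%:R * \sum_l hform H (fv (s l q)) (fv (contract (row l (cplx H)) t q)).
Proof.
move=> ss st; have [mt at_ _] := st q.+1; have ant := alternating_antisymmetric mt at_.
pose P := proj01 St p.
have wE I : fv (dirac_wedge St p s q.+1) I =
    \sum_(j < q.+1) (-1) ^+ j * \sum_l P (I j) l * fv (s l q) [ffun b => I (lift j b)].
  rewrite frame_values1 (dirac_wedgeE _ ss); apply: eq_bigr => j _; congr (_ * _).
  apply: eq_bigr => l _; rewrite rowK -rowE mxE; congr (_ * _).
  rewrite frame_values1; congr (s l q _); apply/row_matrixP => b.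
  by rewrite rowK ffunE; apply/rowP => c; rewrite !mxE.
have tE (J : {ffun 'I_q.+1 -> 'I_m}) (j : 'I_q.+1) : fv (t q.+1) J = (-1) ^+ j *
    t q.+1 (col_mx (delta_mx 0 (J j) : 'rV[C]_m) (\matrix_(b < q) delta_mx 0 (J (lift j b)))).
  rewrite frame_values1 (antisymmetric_move_row j _ ant); congr (_ * t q.+1 _).
  rewrite rowK; congr (@col_mx _ 1 q m _ _); apply/row_matrixP => b; rewrite rowK.
  by apply/rowP => c; rewrite !mxE.
rewrite /hform.
transitivity (\sum_(j < q.+1) \sum_l hform H (fv (s l q)) (fv (contract (row l (cplx H)) t q))); last first.
  by rewrite sumr_const card_ord mulr_natl.
transitivity (\sum_(j < q.+1) \sum_l
   \sum_(I : {ffun 'I_q.+1 -> 'I_m}) \sum_(J : {ffun 'I_q.+1 -> 'I_m})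
   (\prod_a (H (I a) (J a))%:C) * (Num.conj (P (I j) l) * Num.conj (fv (s l q) [ffun b => I (lift j b)]) *
    t q.+1 (col_mx (delta_mx 0 (J j) : 'rV[C]_m) (\matrix_(b < q) delta_mx 0 (J (lift j b)))))).
  under [RHS]eq_bigr do rewrite exchange_big/=.
  rewrite [RHS]exchange_big/=; apply: eq_bigr => I _.
  under [RHS]eq_bigr do rewrite exchange_big/=.
  rewrite [RHS]exchange_big/=; apply: eq_bigr => J _.
  rewrite wE rmorph_sum mulr_suml mulr_sumr; apply: eq_bigr => j _.
  rewrite -mulr_sumr; congr (_ * _).
  rewrite (tE J j) rmorphM rmorph_sum rmorphXn rmorphN1 mulrACA -expr2 sqrr_sign mul1r.
  by rewrite mulr_suml; apply: eq_bigr => l _; rewrite rmorphM.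
apply: eq_bigr => j _; apply: eq_bigr => l _.
rewrite (big_ffun_insert j).
under eq_bigr do under eq_bigr do rewrite (big_ffun_insert j).
rewrite exchange_big/=; apply: eq_bigr => I' _.
under eq_bigr do rewrite exchange_big/=.
rewrite exchange_big/=; apply: eq_bigr => J' _.
have conjP i : Num.conj (P i l) = proj10 St p i l
  by have /matrixP/(_ i l) := conj_proj01 St p; rewrite [in X in X -> _]mxE.
have -> : fv (contract (row l (cplx H)) t q) J' =
   \sum_i \sum_j0 (H i j0)%:C * proj10 St p i l * t q.+1 (col_mx (delta_mx 0 j0 : 'rV[C]_m) (\matrix_(b < q) delta_mx 0 (J' b))).
  rewrite frame_values1 /contract.
  set A := \matrix_b _.
  have := spinor_set_row_proj01 Hf (col_mx (0 : 'rV[C]_m) A : 'M[C]_(q.+1, m)) ord0 (row l (cplx H)) st.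
  rewrite !set_row_col_mx0 => <-.
  have -> : row l (cplx H) *m proj01 St p = \sum_j0 (\sum_i (H i j0)%:C * proj10 St p i l) *: delta_mx 0 j0.
    have -> : row l (cplx H) = sharp St p (delta_mx l 0 : 'cV[C]_m) by rewrite /sharp trmx_delta -rowE.
    rewrite -(sharp_proj10 Hf) [LHS]row_sum_delta; apply: eq_bigr => j0 _; congr (_ *: _).
    rewrite /sharp mxE; apply: eq_bigr => i _; rewrite mulrC -colE !mxE.
    by [].
  rewrite -(set_row_col_mx0 (0 : 'rV[C]_m)) multilinear_sum// exchange_big/=; apply: eq_bigr => j0 _.
  by rewrite set_row_col_mx0 mulr_suml.
rewrite mulr_sumr mulr_sumr; apply: eq_bigr => i _; rewrite !mulr_sumr; apply: eq_bigr => j0 _.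
rewrite (bigD1_ord j)//= !ffunE unlift_none conjP.
have -> : [ffun b => [ffun a => match unlift j a with Some b0 => I' b0 | None => i end] (lift j b)] = I'.
  by apply/ffunP => b; rewrite !ffunE liftK.
have -> : \matrix_(b < q) delta_mx 0 ([ffun a => match unlift j a with Some b0 => J' b0 | None => j0 end] (lift j b)) =
   \matrix_(b < q) delta_mx 0 (J' b) :> 'M[C]_(q, m).
  by apply/row_matrixP => b; rewrite !rowK ffunE liftK.
have -> : \prod_(b < q) (H ([ffun a => match unlift j a with Some b0 => I' b0 | None => i end] (lift j b))
    ([ffun a => match unlift j a with Some b0 => J' b0 | None => j0 end] (lift j b)))%:C =
  \prod_(b < q) (H (I' b) (J' b))%:C :> C.
  by apply: eq_bigr => b _; rewrite !ffunE liftK.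
move: (\prod_b _) (Num.conj _) (t _ _) => x y z; ring.
Qed.

Lemma hpair_dirac_wedge (s : 'I_m -> cform R n k) (t : cform R n k) :
  (forall l, in_spinor St p (s l)) -> in_spinor St p t ->
  hpair St p (dirac_wedge St p s) t =
  \sum_l hpair St p (s l) (contract (row l (cplx H)) t).
Proof.
move=> ss st; rewrite hpairE big_ord_recl [X in _ * X + _]big1 ?mulr0 ?add0r; last first.
  move=> I _; apply: big1 => J _; rewrite [X in Num.conj X](_ : _ = 0)//.
  by rewrite rmorph0 mul0r mulr0.
have -> : \sum_l hpair St p (s l) (contract (row l (cplx H)) t) =
   \sum_(q < n.+1) (q`!%:R)^-1 * \sum_l hform H (fv (s l q)) (fv (contract (row l (cplx H)) t q)).
  under eq_bigr do rewrite hpairE.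
  by rewrite exchange_big/=; apply: eq_bigr => q _; rewrite mulr_sumr.
(* In degree [n] the contraction reads the component of [t] of degree [n.+1], which is zero. This
   matches the missing degree 0 on the other side; the factor [q.+1] then turns 1/(q+1)! into
   1/q!. *)
rewrite big_ord_recr/= [X in _ = _ + _ * X]big1 ?mulr0 ?addr0; last first.
  move=> l _; apply: big1 => I _; apply: big1 => J _.
  have -> : fv (contract (row l (cplx H)) t n) J = 0.
    by apply: (spinor_eq0 Hf _ st).
  by rewrite !mulr0.
apply: eq_bigr => q _.
transitivity (((q.+1)`!%:R)^-1 * hform H (fv (dirac_wedge St p s q.+1)) (fv (t q.+1))); first by [].
rewrite (hform_dirac_wedge _ ss st) mulrA; congr (_ * _).
by rewrite factS natrM invfM mulrC mulrA mulfV ?mul1r// pnatr_eq0.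
Qed.

End Hpair.
Arguments contract {R n k} u t q A.

Section RealPairing.
Variables (R : realType) (n k : nat).
Local Notation m := (k + n * 2)%N.
Variables (M : manifold R m) (St : fpk_data M).
Local Notation C := R[i].
Hypothesis Hf : is_metric_fpk St.

Definition multilinear_family (s : cform R n k) := forall q, multilinear (s q).

Definition smooth_section (s : csection M) := forall q (W : 'I_q -> cvfield M),
  (forall i, smooth_cvf (W i)) -> smooth_cfun (fun r => s r q (\matrix_i W i r)).

Definition rpair p (s t : cform R n k) : R := complex.Re (hpair St p s t).
Arguments rpair : clear implicits.

(** The real part of [hpair] in components, written with real operations only so that it can be
    differentiated term by term. *)
Definition rform d (H : 'M[R]_d) (s t : forall q, {ffun 'I_q -> 'I_d} -> C) : R :=
  \sum_(q < n.+1) (q`!%:R)^-1 *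
    \sum_(I : {ffun 'I_q -> 'I_d}) \sum_(J : {ffun 'I_q -> 'I_d})
     (\prod_(a < q) H (I a) (J a)) *
     (complex.Re (s q I) * complex.Re (t q J) + complex.Im (s q I) * complex.Im (t q J)).

Lemma Re_factM q (z : C) : complex.Re ((q`!%:R)^-1 * z) = (q`!%:R)^-1 * complex.Re z.
Proof.
have -> : (q`!%:R : C)^-1 = ((q`!%:R)^-1 : R)%:C by rewrite fmorphV/= rmorph_nat.
by case: z => a b /=; rewrite mul0r subr0.
Qed.

Lemma frame_metric_inv p (F : 'M[R]_m) : F \in unitmx ->
  F^T *m invmx (F *m metric St p *m F^T) *m F = invmx (metric St p).
Proof.
move=> uF; have uT : F^T \in unitmx by rewrite unitmx_tr.
have ug := metric_unit Hf p.
have uX : F *m metric St p *m F^T \in unitmx by rewrite !unitmx_mul uF ug uT.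
have K : F^T *m invmx (F *m metric St p *m F^T) *m F *m metric St p = 1%:M.
  set X := F *m _ *m _ in uX *.
  have E : F *m metric St p = X *m invmx F^T by rewrite mulmxK.
  by rewrite -[_ *m F *m _]mulmxA E mulmxA (mulmxKV uX) mulmxV.
by rewrite -[LHS](mulmxK ug) K mul1mx.
Qed.

Lemma rpair_frame p (F : 'M[R]_m) (s t : cform R n k) :
  multilinear_family s -> multilinear_family t -> F \in unitmx ->
  rpair p s t = rform (invmx (F *m metric St p *m F^T))
    (fun q => frame_values F (s q)) (fun q => frame_values F (t q)).
Proof.
move=> ms mt uF; rewrite /rpair hpairE raddf_sum; apply: eq_bigr => q _.
apply: (etrans (Re_factM _ _)); rewrite -Re_hform; congr (_ * complex.Re _).
by rewrite -(hform_change F)// frame_metric_inv.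
Qed.

Lemma rpair_cplxlinear p a (s t t' : cform R n k) :
  rpair p s (fun q A => a%:C * t q A + t' q A) = a * rpair p s t + rpair p s t'.
Proof.
rewrite /rpair; have -> : hpair St p s (fun q A => a%:C * t q A + t' q A) = a%:C * hpair St p s t + hpair St p s t'.
  rewrite /hpair mulr_sumr -big_split; apply: eq_bigr => q _ /=.
  rewrite mulrCA -mulrDr; congr (_ * _).
  rewrite mulr_sumr -big_split; apply: eq_bigr => I _ /=.
  rewrite mulr_sumr -big_split; apply: eq_bigr => J _ /=.
  by move: (\prod_(_ < _) _) (Num.conj _) (t _ _) (t' _ _) => x y z w; ring.
by case: (hpair _ _ _ t) => x y; case: (hpair _ _ _ t') => x' y' /=; rewrite mul0r subr0.
Qed.

Lemma rpair_ext p s (t t' : cform R n k) : (forall q A, t q A = t' q A) -> rpair p s t = rpair p s t'.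
Proof.
move=> tt'; congr (complex.Re _); apply: eq_bigr => q _; congr (_ * _).
by apply: eq_bigr => I _; apply: eq_bigr => J _; rewrite tt'.
Qed.

Lemma rpair0r p s : rpair p s (fun q A => 0) = 0.
Proof.
rewrite /rpair /hpair big1// => q _; rewrite big1 ?mulr0// => I _; rewrite big1// => J _.
by rewrite !mulr0.
Qed.

Lemma rpair_sumr p s (I : Type) (l : seq I) (P : pred I) (a : I -> R) (t : I -> cform R n k) :
  rpair p s (fun q A => \sum_(i <- l | P i) (a i)%:C * t i q A) =
  \sum_(i <- l | P i) a i * rpair p s (t i).
Proof.
elim: l => [|i l IH].
  rewrite big_nil -[RHS](rpair0r p s); apply: rpair_ext => q A; exact: big_nil.
rewrite big_cons; case Pi: (P i).
  by rewrite -IH -rpair_cplxlinear; apply: rpair_ext => q A; rewrite big_cons Pi.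
by rewrite -IH; apply: rpair_ext => q A; rewrite big_cons Pi.
Qed.

Lemma contract_set_row u (t : cform R n k) q (A : 'M[C]_(q, m)) :
  t q.+1 (set_row ord0 u (col_mx (0 : 'rV[C]_m) A)) = contract u t q A.
Proof. by rewrite set_row_col_mx0. Qed.

Lemma contract_sum (t : cform R n k) (I : Type) (l : seq I) (P : pred I) (a : I -> C) (u : I -> 'rV[C]_m) q A :
  multilinear_family t ->
  contract (\sum_(i <- l | P i) a i *: u i) t q A = \sum_(i <- l | P i) a i * contract (u i) t q A.
Proof.
move=> mt; rewrite -contract_set_row multilinear_sum; last exact: mt.
by apply: eq_bigr => i _; rewrite contract_set_row.
Qed.

Lemma multilinear_contract u (t : cform R n k) : multilinear_family t -> multilinear_family (contract u t).
Proof. by move=> mt q; apply: multilinear_col_mx; exact: mt. Qed.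

Lemma smooth_cvf_cplx (Y : vfield M) : smooth_vf Y -> smooth_cvf (fun r => cplx (Y r)).
Proof.
move=> sY; split.
  have -> : Revf (fun r => cplx (Y r)) = Y by apply/funext => r; apply/matrixP => i j; rewrite !mxE.
  exact: sY.
have -> : Imvf (fun r => cplx (Y r)) = (fun _ : M => 0) :> vfield M by apply/funext => r; apply/matrixP => i j; rewrite !mxE.
exact: smooth_vf0.
Qed.

Lemma col_mx_fields q (Z : cvfield M) (W : 'I_q -> cvfield M) r :
  col_mx (Z r) (\matrix_i W i r) =
  \matrix_(i < q.+1) (if unlift ord0 i is Some j then W j else Z) r :> 'M[C]_(q.+1, m).
Proof.
apply/row_matrixP => i; rewrite rowK; case: (unliftP ord0 i) => [j|] ->.
  by rewrite row_col_mxS rowK.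
by rewrite row_col_mx0.
Qed.

Lemma smooth_contract (s : csection M) (Z : cvfield M) : smooth_section s -> smooth_cvf Z ->
  smooth_section (fun r => contract (Z r) (s r)).
Proof.
move=> ss sZ q W sW; rewrite /contract.
under [fun r => _]funext => r do rewrite col_mx_fields.
by apply: (ss q.+1) => i; case: (unlift _ _).
Qed.

Definition gram (N : 'I_m -> vfield M) r := \matrix_(a, b) gprod St r (N a r) (N b r).

Lemma gramE N r : gram N r = (\matrix_a N a r) *m metric St r *m (\matrix_a N a r)^T.
Proof.
apply/matrixP => a b; rewrite mxE /gprod -[in LHS](rowK (fun a => N a r) a) -[in LHS](rowK (fun a => N a r) b).
rewrite !rowE; exact: gprod_delta.
Qed.

Lemma smooth_gprod X Y : smooth_vf X -> smooth_vf Y -> smooth_fun (fun r => gprod St r (X r) (Y r)).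
Proof. by case: Hf => _ _ _ [+ _ _] _; apply. Qed.

(** The frame matrix at [r] refers to the chart attached to [r] and need not be continuous in [r].
    The determinant of the Gram matrix is smooth and detects invertibility equally well. *)
Lemma frame_near (N : 'I_m -> vfield M) p : (forall a, smooth_vf (N a)) ->
  \matrix_a N a p \in unitmx -> \forall r \near p, \matrix_a N a r \in unitmx.
Proof.
move=> sN uN.
have c : {for p, continuous (fun r => \det (gram N r))}.
  apply: smooth_at_continuous; apply: (germ_det (smooth_germ_algebra p)) => a b.
  under [fun r => _]funext => r do rewrite mxE.
  exact: (iffLR (smooth_funP _) (smooth_gprod (sN a) (sN b))).
have u0 : \det (gram N p) != 0.
  rewrite -unitfE -[_ \is a _]/(gram N p \in unitmx) gramE !unitmx_mul uN unitmx_tr uN (metric_unit Hf).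
  by [].
have H : \forall r \near p, \det (gram N r) != 0 := cvgr_neq0 _ c u0.
near=> r.
have : \det (gram N r) != 0 by near: r; exact: H.
by rewrite -unitfE -[_ \is a _]/(gram N r \in unitmx) gramE !unitmx_mul => /andP[/andP[]].
Unshelve. all: by end_near. Qed.

Definition frame_section (N : 'I_m -> vfield M) (s : csection M) r q (I : {ffun 'I_q -> 'I_m}) : C :=
  s r q (\matrix_a cplx (N (I a) r)).
Arguments frame_section N s r q I : clear implicits.

Lemma frame_sectionE N (s : csection M) r q : frame_values (\matrix_a N a r) (s r q) = frame_section N s r q.
Proof.
apply/funext => I; congr (s r q _); apply/row_matrixP => a; rewrite !rowK.
by apply/rowP => j; rewrite !mxE.
Qed.

Lemma smooth_frame_section N s q I p : (forall a, smooth_vf (N a)) -> smooth_section s ->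
  smooth_cat (fun r => frame_section N s r q I) p.
Proof.
move=> sN ss; apply: smooth_cfun_at; apply: (ss q (fun a r => cplx (N (I a) r))) => a.
exact: smooth_cvf_cplx.
Qed.

Lemma rpair_frame_near (N : 'I_m -> vfield M) (s t : csection M) p : (forall a, smooth_vf (N a)) ->
  \matrix_a N a p \in unitmx -> (forall r, multilinear_family (s r)) -> (forall r, multilinear_family (t r)) ->
  \forall r \near p, rform (invmx (gram N r)) (frame_section N s r) (frame_section N t r) =
    rpair r (s r) (t r).
Proof.
move=> sN uN ms mt; have H := frame_near sN uN; near=> r.
have u : \matrix_a N a r \in unitmx by near: r; exact: H.
rewrite (rpair_frame r (ms r) (mt r) u) -gramE; congr (rform _ _ _).
  by apply: functional_extensionality_dep => q; rewrite frame_sectionE.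
by apply: functional_extensionality_dep => q; rewrite frame_sectionE.
Unshelve. all: by end_near. Qed.

End RealPairing.

(** * The field dual to a pair of sections *)

Section Rform.
Variables (R : realType) (n d d' : nat) (M : manifold R d').
Local Notation C := R[i].
Variables (p : M) (H : M -> 'M[R]_d) (s t : M -> forall q, {ffun 'I_q -> 'I_d} -> C).

Arguments s : clear implicits.
Arguments t : clear implicits.
Hypothesis sH : forall a b, smooth_at (fun r => H r a b) p.
Hypothesis ss : forall q I, smooth_cat (fun r => s r q I) p.
Hypothesis st : forall q I, smooth_cat (fun r => t r q I) p.

Let summand q (I J : {ffun 'I_q -> 'I_d}) r :=
  (\prod_(a < q) H r (I a) (J a)) *
  (complex.Re (s r q I) * complex.Re (t r q J) + complex.Im (s r q I) * complex.Im (t r q J)).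

Let smooth_prodH q (I J : {ffun 'I_q -> 'I_d}) : smooth_at (fun r => \prod_(a < q) H r (I a) (J a)) p.
Proof. by apply: smooth_at_prod => a _; exact: sH. Qed.

Let smooth_re q (I J : {ffun 'I_q -> 'I_d}) :
  smooth_at (fun r => complex.Re (s r q I) * complex.Re (t r q J)) p.
Proof. exact: smooth_atM (ss I).1 (st J).1. Qed.

Let smooth_im q (I J : {ffun 'I_q -> 'I_d}) :
  smooth_at (fun r => complex.Im (s r q I) * complex.Im (t r q J)) p.
Proof. exact: smooth_atM (ss I).2 (st J).2. Qed.

Let smooth_summand q (I J : {ffun 'I_q -> 'I_d}) : smooth_at (summand I J) p.
Proof. apply: smooth_atM; [exact: smooth_prodH | exact: smooth_atD (smooth_re I J) (smooth_im I J)]. Qed.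

Let smooth_inner q : smooth_at (fun r => \sum_(I : {ffun 'I_q -> 'I_d}) \sum_(J : {ffun 'I_q -> 'I_d}) summand I J r) p.
Proof. by apply: smooth_at_sum => I _; apply: smooth_at_sum => J _; exact: smooth_summand. Qed.

Lemma smooth_rform : smooth_at (fun r => rform n (H r) (s r) (t r)) p.
Proof.
apply: smooth_at_sum => q _; apply: smooth_atM; first exact: smooth_at_cst.
exact: smooth_inner.
Qed.

Hypothesis dH : forall a b v, vder p v (fun r => H r a b) = 0.

Lemma vder_rform v : vder p v (fun r => rform n (H r) (s r) (t r)) =
  rform n (H p) (fun q I => vderC p v (fun r => s r q I)) (t p) +
  rform n (H p) (s p) (fun q I => vderC p v (fun r => t r q I)).
Proof.
have dP q (I J : {ffun 'I_q -> 'I_d}) : vder p v (fun r => \prod_(a < q) H r (I a) (J a)) = 0.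
  suff [_] : stationary_at p (fun r => \prod_(a < q) H r (I a) (J a)) by exact.
  by apply: (germ_prod (stationary_germ_algebra p)) => a; split; [exact: sH | move=> w; exact: dH].
rewrite /rform vder_sum; last first.
  by move=> q _; apply: smooth_atM; [exact: smooth_at_cst | exact: smooth_inner].
rewrite -big_split; apply: eq_bigr => q _.
rewrite vderM; [| exact: smooth_at_cst | exact: smooth_inner].
rewrite vder_cst mulr0 addr0 /= -mulrDr; congr (_ * _).
rewrite vder_sum; last by move=> I _; apply: smooth_at_sum => J _; exact: smooth_summand.
rewrite -big_split; apply: eq_bigr => I _ /=.
rewrite vder_sum; last by move=> J _; exact: smooth_summand.
rewrite -big_split; apply: eq_bigr => J _ /=.
rewrite vderM; [| exact: smooth_prodH | exact: smooth_atD (smooth_re I J) (smooth_im I J)].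
rewrite dP mulr0 addr0 -mulrDr; congr (_ * _).
rewrite (vderD _ (smooth_re I J) (smooth_im I J)).
rewrite (vderM _ (ss I).1 (st J).1) (vderM _ (ss I).2 (st J).2).
move: (vder _ _ _) (vder _ _ _) (vder _ _ _) (vder _ _ _) => x y z w.
move: (complex.Re _) (complex.Re _) (complex.Im _) (complex.Im _) => a b c e.
ring.
Qed.

End Rform.

Section DualField.
Variables (R : realType) (n k : nat).
Local Notation m := (k + n * 2)%N.
Variables (M : manifold R m) (St : fpk_data M).
Local Notation C := R[i].
Hypothesis Hf : is_metric_fpk St.

Lemma frame_extension_std (p : M) : exists X : 'I_m -> vfield M,
  (forall a, smooth_vf (X a)) /\ \matrix_a X a p = 1%:M.
Proof.
have [X [sX XE]] := frame_extension (atlas_chart_at p) (mem_chart_at p).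
exists X; split=> //; apply/row_matrixP => a; rewrite rowK.
have := nbhs_singleton XE a; rewrite coord_frame_id; exact.
Qed.

Lemma smooth_invgram (X : 'I_m -> vfield M) p a b : (forall a, smooth_vf (X a)) ->
  \matrix_a X a p \in unitmx -> smooth_at (fun r => invmx (gram St X r) a b) p.
Proof.
move=> sX uX; apply: (germ_invmx (smooth_germ_algebra p)) => [i j|].
  under [fun r => _]funext => r do rewrite mxE.
  exact: (iffLR (smooth_funP _) (smooth_gprod Hf (sX i) (sX j))).
by rewrite gramE !unitmx_mul uX unitmx_tr uX (metric_unit Hf).
Qed.

Lemma smooth_rpair (s t : csection M) : (forall r, multilinear_family (s r)) ->
  (forall r, multilinear_family (t r)) -> smooth_section s -> smooth_section t ->
  smooth_fun (fun r => rpair St r (s r) (t r)).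
Proof.
move=> ms mt ss st; apply/smooth_funP => p.
have [X [sX X1]] := frame_extension_std p.
have uX : \matrix_a X a p \in unitmx by rewrite X1 unitmx1.
apply: smooth_at_near_eq (rpair_frame_near Hf sX uX ms mt) _.
apply: smooth_rform => [a b|q I|q I].
- exact: smooth_invgram.
- exact: smooth_frame_section.
- exact: smooth_frame_section.
Qed.

(** In a smooth frame the components of [V] are the products g(V, X_b) contracted with the inverse
    Gram matrix. *)
Lemma riesz_smooth (V : vfield M) :
  (forall Y, smooth_vf Y -> smooth_fun (fun r => gprod St r (V r) (Y r))) -> smooth_vf V.
Proof.
move=> sV; apply/smooth_vfP => f p sf.
have [X [sX X1]] := frame_extension_std p.
have uX : \matrix_a X a p \in unitmx by rewrite X1 unitmx1.
pose c r a := \sum_b gprod St r (V r) (X b r) * invmx (gram St X r) b a.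
have VE : \forall r \near p, V r = \sum_a c r a *: X a r.
  have H := frame_near Hf sX uX; near=> r.
  have u : \matrix_a X a r \in unitmx by near: r; exact: H.
  have -> : \sum_a c r a *: X a r =
      (\row_b gprod St r (V r) (X b r)) *m invmx (gram St X r) *m \matrix_a X a r.
    rewrite [RHS]mulmx_sum_row; apply: eq_bigr => a _; rewrite rowK; congr (_ *: _).
    by rewrite mxE; apply: eq_bigr => b _; rewrite mxE.
  have -> : \row_b gprod St r (V r) (X b r) = V r *m metric St r *m (\matrix_a X a r)^T.
    apply/rowP => b; rewrite !mxE /gprod mxE; apply: eq_bigr => i _.
    by rewrite !mxE.
  rewrite gramE -[in RHS](mulmxA (V r *m _)) -[in RHS](mulmxA (V r *m _)).
  by rewrite (frame_metric_inv Hf _ u) mulmxK ?(metric_unit Hf).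
have E : \forall r \near p, \sum_a c r a * vder r (X a r) f = vder r (V r) f.
  have nf := near_smooth_at sf; near=> r.
  have -> : V r = \sum_a c r a *: X a r by near: r; exact: VE.
  have sfr : smooth_at f r by near: r; exact: nf.
  rewrite (big_morph (fun w => vder r w f) (fun u v => vderDv u v sfr) (vder0 r f)).
  by apply: eq_bigr => a _; rewrite (vderZv _ _ sfr).
apply: smooth_at_near_eq E _; apply: smooth_at_sum => a _; apply: smooth_atM; last first.
  exact: (iffLR (smooth_vfP _) (sX a)).
apply: smooth_at_sum => b _; apply: smooth_atM; last exact: smooth_invgram.
exact: (iffLR (smooth_funP _) (sV _ (sX b))).
Unshelve. all: by end_near. Qed.

Variables psi zeta : csection M.
Arguments psi : clear implicits.
Arguments zeta : clear implicits.

Hypothesis sp : spinor_section St psi.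
Hypothesis sz : spinor_section St zeta.

Lemma multilinear_spinor (s : csection M) r : spinor_section St s -> multilinear_family (s r).
Proof. by move=> [h _] q; have [] := h r q. Qed.

Lemma smooth_spinor (s : csection M) : spinor_section St s -> smooth_section s.
Proof. by move=> [_ h]. Qed.

Definition pair_contract r (Y : 'rV[R]_m) : R := rpair St r (psi r) (contract (cplx Y) (zeta r)).

(* The field V with g(V, Y) = Re <psi, iota_Y zeta>. *)
Definition dual_field : vfield M := fun r =>
  (\row_l pair_contract r (delta_mx 0 l)) *m invmx (metric St r).

Lemma pair_contract_sum r (I : Type) (l : seq I) (P : pred I) (a : I -> R) (Y : I -> 'rV[R]_m) :
  pair_contract r (\sum_(i <- l | P i) a i *: Y i) = \sum_(i <- l | P i) a i * pair_contract r (Y i).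
Proof.
rewrite /pair_contract -rpair_sumr; apply: rpair_ext => q A.
have -> : cplx (\sum_(i <- l | P i) a i *: Y i) = \sum_(i <- l | P i) (a i)%:C *: cplx (Y i).
  rewrite (big_morph (@cplx R 1 m) (@cplxD R 1 m) (@cplx0 R 1 m)).
  by apply: eq_bigr => i _; rewrite cplxZ.
by apply: contract_sum; exact: multilinear_spinor.
Qed.

Lemma gprod_dual_field r Y : gprod St r (dual_field r) Y = pair_contract r Y.
Proof.
rewrite /gprod /dual_field mulmxKV ?(metric_unit Hf)// [in RHS](row_sum_delta Y) pair_contract_sum.
by rewrite mxE; apply: eq_bigr => l _; rewrite !mxE mulrC.
Qed.

Lemma smooth_pair_contract Y : smooth_vf Y -> smooth_fun (fun r => pair_contract r (Y r)).
Proof.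
move=> sY; apply: (smooth_rpair (t := fun r => contract (cplx (Y r)) (zeta r))).
- by move=> r; exact: multilinear_spinor.
- by move=> r; apply: multilinear_contract; exact: multilinear_spinor.
- exact: smooth_spinor.
- apply: (smooth_contract (Z := fun r => cplx (Y r))); [exact: smooth_spinor | exact: smooth_cvf_cplx].
Qed.

Lemma smooth_dual_field : smooth_vf dual_field.
Proof.
apply: riesz_smooth => Y sY.
under [fun r => _]funext => r do rewrite gprod_dual_field.
exact: smooth_pair_contract.
Qed.

(** Contracting a spinor with a vector of T gives zero; hence the dual field is tangent to E. *)
Lemma dual_field_xi r i : gprod St r (dual_field r) (xi St i r) = 0.
Proof.
rewrite gprod_dual_field -[RHS](rpair0r St r (psi r)); apply: rpair_ext => q A.
have [_ _ h] := sz.1 r q.+1; apply: (h _ ord0); right.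
by rewrite row_col_mx0 /inTC /phiC -cplxM (xi_phi Hf) cplx0.
Qed.

End DualField.

Section SmoothCat.
Variables (R : realType) (d : nat) (M : manifold R d) (p : M).
Local Notation C := R[i].
Implicit Types (f g : M -> C).

Lemma smooth_catD f g : smooth_cat f p -> smooth_cat g p -> smooth_cat (fun r => f r + g r) p.
Proof.
move=> [f1 f2] [g1 g2]; split.
  under [fun r => _]funext => r do rewrite raddfD.
  exact: smooth_atD.
under [fun r => _]funext => r do rewrite raddfD.
exact: smooth_atD.
Qed.

Lemma smooth_catZ (a : M -> R) f : smooth_at a p -> smooth_cat f p -> smooth_cat (fun r => (a r)%:C * f r) p.
Proof.
move=> sa [f1 f2]; split.
  have -> : (fun r => complex.Re ((a r)%:C * f r)) = (fun r => a r * complex.Re (f r)).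
    by apply/funext => r; case: (f r) => x y /=; rewrite mul0r subr0.
  exact: smooth_atM.
have -> : (fun r => complex.Im ((a r)%:C * f r)) = (fun r => a r * complex.Im (f r)).
  by apply/funext => r; case: (f r) => x y /=; rewrite mul0r addr0.
exact: smooth_atM.
Qed.

Lemma smooth_cat_cst (a : C) : smooth_cat (fun=> a) p.
Proof. by split; exact: smooth_at_cst. Qed.

Lemma smooth_catN f : smooth_cat f p -> smooth_cat (fun r => - f r) p.
Proof.
move=> sf; have -> : (fun r => - f r) = (fun r => (-1 : R)%:C * f r).
  by apply/funext => r; rewrite rmorphN1 mulN1r.
exact: (smooth_catZ (a := fun=> -1)) (smooth_at_cst _ _) sf.
Qed.

Lemma smooth_cat_sum (I : Type) (l : seq I) (P : pred I) (f : I -> M -> C) :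
  (forall i, smooth_cat (f i) p) -> smooth_cat (fun r => \sum_(i <- l | P i) f i r) p.
Proof.
move=> sf; elim: l => [|i l IH].
  under [fun r => _]funext => r do rewrite big_nil.
  exact: smooth_cat_cst.
under [fun r => _]funext => r do rewrite big_cons.
case: (P i); last exact: IH.
exact: smooth_catD.
Qed.

Lemma smooth_cat_near_eq f g : (\forall r \near p, f r = g r) -> smooth_cat f p -> smooth_cat g p.
Proof.
move=> E [f1 f2]; split.
  by apply: smooth_at_near_eq f1; apply: filterS E => r ->.
by apply: smooth_at_near_eq f2; apply: filterS E => r ->.
Qed.

End SmoothCat.

Lemma smooth_cfunP (R : realType) d (M : manifold R d) (f : M -> R[i]) :
  (forall p, smooth_cat f p) -> smooth_cfun f.
Proof. by move=> sf; split; apply/smooth_funP => p; have [] := sf p. Qed.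

Section SpinorSections.
Variables (R : realType) (n k : nat).
Local Notation m := (k + n * 2)%N.
Variables (M : manifold R m) (St : fpk_data M).
Local Notation C := R[i].

Lemma in_spinorD p (s t : cform R n k) : in_spinor St p s -> in_spinor St p t ->
  in_spinor St p (fun q A => s q A + t q A).
Proof.
move=> hs ht q; have [ms as_ s0] := hs q; have [mt at_ t0] := ht q; split.
- by move=> A j a u v; rewrite ms mt mulrDr !addrA; congr (_ + _); rewrite addrAC.
- by move=> A i j ij Aij; rewrite (as_ _ _ _ ij Aij) (at_ _ _ _ ij Aij) addr0.
- by move=> A j h; rewrite (s0 _ _ h) (t0 _ _ h) addr0.
Qed.

Lemma in_spinorZ p (a : C) (s : cform R n k) : in_spinor St p s ->
  in_spinor St p (fun q A => a * s q A).
Proof.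
move=> hs q; have [ms as_ s0] := hs q; split.
- by move=> A j b u v; rewrite ms mulrDr mulrCA.
- by move=> A i j ij Aij; rewrite (as_ _ _ _ ij Aij) mulr0.
- by move=> A j h; rewrite (s0 _ _ h) mulr0.
Qed.

Lemma spinor_sectionD (s t : csection M) : spinor_section St s -> spinor_section St t ->
  spinor_section St (fun r q A => s r q A + t r q A).
Proof.
move=> [hs ss] [ht st]; split; first by move=> p; exact: in_spinorD.
move=> q W sW; apply: smooth_cfunP => p; apply: smooth_catD.
  exact: smooth_cfun_at (ss q W sW).
exact: smooth_cfun_at (st q W sW).
Qed.

Lemma spinor_sectionZ (a : M -> R) (s : csection M) : smooth_fun a -> spinor_section St s ->
  spinor_section St (fun r q A => (a r)%:C * s r q A).
Proof.
move=> sa [hs ss]; split; first by move=> p; exact: in_spinorZ.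
move=> q W sW; apply: smooth_cfunP => p; apply: smooth_catZ.
  exact: (iffLR (smooth_funP _) sa).
exact: smooth_cfun_at (ss q W sW).
Qed.

Lemma in_spinor_contract p u (s : cform R n k) : in_spinor St p s -> in_spinor St p (contract u s).
Proof.
move=> hs q; have [ms as_ s0] := hs q.+1; split.
- exact: multilinear_col_mx.
- exact: alternating_col_mx.
- move=> A j h; apply: (s0 _ (lift ord0 j)).
  by rewrite row_col_mxS.
Qed.

End SpinorSections.

(** * Covariant derivative of the dual field *)

Section Divergence.
Variables (R : realType) (n k : nat).
Local Notation m := (k + n * 2)%N.
Variables (M : manifold R m) (St : fpk_data M) (nabla : connection M).
Variable nablaS : spinor_connection M.
Arguments nablaS : clear implicits.
Local Notation C := R[i].
Hypothesis Hf : is_metric_fpk St.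
Hypothesis HT : is_tanaka_webster St nabla.
Hypothesis HI : is_induced St nabla nablaS.

Let Hc : is_connection nabla. Proof. by case: HT. Qed.

Lemma nabla_metric p v (Y Y' : vfield M) : smooth_vf Y -> smooth_vf Y' ->
  vder p v (fun q => gprod St q (Y q) (Y' q)) =
  gprod St p (nabla p v Y) (Y' p) + gprod St p (Y p) (nabla p v Y').
Proof. by case: HT => _ [_ h _] _; exact: h. Qed.

Lemma gprod0 p u : gprod St p 0 u = 0.
Proof. by rewrite /gprod !mul0mx mxE. Qed.

(** The frame is parallel at the single point [p], which avoids any condition on the curvature and
    suffices for first derivatives. *)
Lemma parallel_frame p : exists Y : 'I_m -> vfield M,
  [/\ forall a, smooth_vf (Y a), forall a, Y a p = delta_mx 0 a &
      forall v a, nabla p v (Y a) = 0].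
Proof.
have [X [sX X1]] := frame_extension_std p.
have uX : \matrix_a X a p \in unitmx by rewrite X1 unitmx1.
have [N [sN N0 _ nN]] := sync_frame Hc sX uX.
exists (fun a r => X a r - \sum_b N a b r *: X b r); split=> //.
  move=> a; apply: smooth_vfB => //.
  by apply: (smooth_vf_sum _ _ (X := fun b r => N a b r *: X b r)) => b; exact: smooth_vfZ.
move=> a; rewrite big1 ?subr0; last by move=> b _; rewrite N0 scale0r.
by rewrite -row1 -X1 rowK.
Qed.

(** For arguments parallel at [p] along [v] the connection terms of the induced formula drop out. *)
Lemma induced_parallel (s : csection M) p v (Y : 'I_m -> vfield M) q (I : {ffun 'I_q -> 'I_m}) :
  spinor_section St s -> (forall a, smooth_vf (Y a)) -> (forall a, nabla p v (Y a) = 0) ->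
  vderC p v (fun r => frame_section Y s r I) = nablaS p v s q (\matrix_a cplx (Y (I a) p)).
Proof.
move=> sp sY nY.
have := induced_formula Hf HT HI p v sp (W := fun a r => cplx (Y (I a) r)) _.
move=> -> => [|a]; last exact: smooth_cvf_cplx.
rewrite big1 ?subr0// => j _.
have -> : nablaC nabla p v (fun r => cplx (Y (I j) r)) = 0.
  rewrite /nablaC.
  have -> : Revf (fun r => cplx (Y (I j) r)) = Y (I j).
    by apply/funext => r; apply/matrixP => i l; rewrite !mxE.
  have -> : Imvf (fun r => cplx (Y (I j) r)) = (fun _ : M => 0) :> vfield M.
    by apply/funext => r; apply/matrixP => i l; rewrite !mxE.
  by rewrite nY (nabla0 Hc) !cplx0 scaler0 addr0.
have [ms _ _] := sp.1 p q; exact: (multilinear0 ms).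
Qed.

Section Pairing.
Variables psi zeta : csection M.
Arguments psi : clear implicits.
Arguments zeta : clear implicits.
Hypothesis sp : spinor_section St psi.
Hypothesis sz : spinor_section St zeta.
Local Notation V := (dual_field St psi zeta).

(** In a frame parallel at [p] the Gram matrix is stationary, and derivatives of components are
    components of covariant derivatives. The claim is then the Leibniz rule for g(V, Y_b) = Re <psi,
    iota zeta>, contraction being along the parallel field Y_b. *)
Lemma gprod_nabla_dual_field p v b :
  gprod St p (nabla p v V) (delta_mx 0 b) =
  rpair St p (nablaS p v psi) (contract (delta_mx 0 b) (zeta p)) +
  rpair St p (psi p) (contract (delta_mx 0 b) (nablaS p v zeta)).
Proof.
have [Y [sY Y1 nY]] := parallel_frame p.
have YE : \matrix_a Y a p = 1%:M by apply/row_matrixP => a; rewrite rowK Y1 row1.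
have uY : \matrix_a Y a p \in unitmx by rewrite YE unitmx1.
have sV := smooth_dual_field Hf sp sz.
have E1 := nabla_metric p v sV (sY b).
rewrite nY Y1 [X in _ + X](gprod_sym Hf) gprod0 addr0 in E1.
rewrite -E1.
pose t : csection M := fun r => contract (cplx (Y b r)) (zeta r).
have mz r : multilinear_family (zeta r) := multilinear_spinor r sz.
have mt r : multilinear_family (t r) by apply: multilinear_contract.
have mp r : multilinear_family (psi r) := multilinear_spinor r sp.
have ss := smooth_spinor sp.
have st : smooth_section t.
  apply: (smooth_contract (Z := fun r => cplx (Y b r))); [exact: (smooth_spinor sz) | exact: smooth_cvf_cplx].
transitivity (vder p v (fun r => rform n (invmx (gram St Y r)) (frame_section Y psi r) (frame_section Y t r))).
  apply: vder_near_eq; have E := rpair_frame_near Hf sY uY mp mt.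
  by apply: filterS E => r ->; exact: gprod_dual_field.
rewrite vder_rform; last first.
  move=> a c w.
  suff [_] : stationary_at p (fun r => invmx (gram St Y r) a c) by exact.
  apply: (germ_invmx (stationary_germ_algebra p)) => [i j|].
    under [fun r => _]funext => r do rewrite mxE.
    split; first exact: (iffLR (smooth_funP _) (smooth_gprod Hf (sY i) (sY j))).
    move=> u; rewrite nabla_metric// !nY gprod0 (gprod_sym Hf) gprod0 addr0.
    by [].
  by rewrite gramE !unitmx_mul uY unitmx_tr uY (metric_unit Hf).
- by move=> q I; exact: smooth_frame_section.
- by move=> q I; exact: smooth_frame_section.
- by move=> a c; exact: smooth_invgram.
have mnp : multilinear_family (nablaS p v psi).
  by move=> q; have [] := nablaS_spinor HI p v sp q.
have mnz : multilinear_family (nablaS p v zeta).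
  by move=> q; have [] := nablaS_spinor HI p v sz q.
have bE : delta_mx 0 b = cplx (Y b p) by rewrite Y1 cplx_delta.
rewrite (rpair_frame Hf p mnp (multilinear_contract _ (mz p)) uY).
rewrite (rpair_frame Hf p (mp p) (multilinear_contract _ mnz) uY) -gramE.
have fE (s : cform R n k) q (I : {ffun 'I_q -> 'I_m}) :
    frame_values (\matrix_a Y a p) (s q) I = s q (\matrix_a cplx (Y (I a) p)).
  congr (s q _); apply/row_matrixP => a; rewrite !rowK; apply/rowP => j.
  by rewrite !mxE.
congr (_ + _).
  congr (rform _ _ _ _).
    apply: functional_extensionality_dep => q; apply/funext => I.
    by rewrite (induced_parallel I sp sY (nY v)) fE.
  by apply: functional_extensionality_dep => q; rewrite -frame_sectionE /t -bE.
congr (rform _ _ _ _).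
  by apply: functional_extensionality_dep => q; rewrite -frame_sectionE.
apply: functional_extensionality_dep => q; apply/funext => I; rewrite fE /contract bE.
rewrite (col_mx_fields (fun r => cplx (Y b r)) (fun a r => cplx (Y (I a) r))).
pose J : {ffun 'I_q.+1 -> 'I_m} := [ffun i => if unlift ord0 i is Some j then I j else b].
have JE r : \matrix_(i < q.+1) (if unlift ord0 i is Some j then fun r => cplx (Y (I j) r)
      else fun r => cplx (Y b r)) r = \matrix_i cplx (Y (J i) r).
  apply/row_matrixP => i; rewrite !rowK ffunE; by case: (unlift _ _).
rewrite JE -(induced_parallel J sz sY (nY v)); congr (vderC _ _ _); apply/funext => r.
by rewrite /frame_section -JE -(col_mx_fields (fun r => cplx (Y b r)) (fun a r => cplx (Y (I a) r))).
Qed.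

End Pairing.
End Divergence.

Section DiracContract.
Variables (R : realType) (n k : nat).
Local Notation m := (k + n * 2)%N.
Variables (M : manifold R m) (St : fpk_data M) (nabla : connection M).
Variable nablaS : spinor_connection M.
Arguments nablaS : clear implicits.
Local Notation C := R[i].
Hypothesis Hf : is_metric_fpk St.
Hypothesis HT : is_tanaka_webster St nabla.
Hypothesis HI : is_induced St nabla nablaS.

Let Hc : is_connection nabla. Proof. by case: HT. Qed.

Variable zeta : csection M.
Arguments zeta : clear implicits.
Hypothesis sz : spinor_section St zeta.

Definition dbarb_adjoint : csection M := fun p =>
  dirac_contract St p (fun l => nablaS p (delta_mx 0 l) zeta).
Arguments dbarb_adjoint : clear implicits.

(** Tracing with the inverse metric turns the terms in nabla psi into the wedge half, by adjointness
    of wedge and contraction, and those in nabla zeta into minus the contraction half. *)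
Lemma trace_nabla_dual_field (psi : csection M) p : spinor_section St psi ->
  \sum_l nabla p (delta_mx 0 l) (dual_field St psi zeta) 0 l =
  rpair St p (dbarb St psi p) (zeta p) - rpair St p (psi p) (dbarb_adjoint p).
Proof.
move=> sp; set V := dual_field _ _ _.
pose H := invmx (metric St p).
have Hs b l : H b l = H l b by rewrite /H -[in LHS](metric_inv_sym Hf p) mxE.
have E l : nabla p (delta_mx 0 l) V 0 l = \sum_b H l b *
   (rpair St p (nablaS p (delta_mx 0 l) psi) (contract (delta_mx 0 b) (zeta p)) +
    rpair St p (psi p) (contract (delta_mx 0 b) (nablaS p (delta_mx 0 l) zeta))).
  rewrite -[LHS](congr1 (fun u : 'rV[R]_m => u 0 l) (mulmxK (metric_unit Hf p) (nabla p (delta_mx 0 l) V))).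
  rewrite mxE; apply: eq_bigr => b _; rewrite -/H Hs mulrC; congr (_ * _).
  rewrite -(gprod_nabla_dual_field Hf HT HI sp sz) /gprod [RHS]mxE (bigD1 b)//= big1 ?addr0.
    by rewrite [X in _ * X]mxE [X in _ * X]mxE !eqxx mulr1.
  by move=> i ib; rewrite [X in _ * X]mxE [X in _ * X]mxE (negPf ib) andbF mulr0.
have R1 (s : cform R n k) (t : cform R n k) l : multilinear_family t ->
   \sum_b H l b * rpair St p s (contract (delta_mx 0 b) t) = rpair St p s (contract (row l (cplx H)) t).
  move=> mt; rewrite -rpair_sumr; apply: rpair_ext => q A.
  rewrite [row l _]row_sum_delta contract_sum//; apply: eq_bigr => b _.
  by rewrite !mxE.
have mz := multilinear_spinor p sz.
have mnz l : multilinear_family (nablaS p (delta_mx 0 l) zeta).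
  by move=> q; have [] := nablaS_spinor HI p (delta_mx 0 l) sz q.
transitivity (\sum_l rpair St p (nablaS p (delta_mx 0 l) psi) (contract (row l (cplx H)) (zeta p)) +
  \sum_l rpair St p (psi p) (contract (row l (cplx H)) (nablaS p (delta_mx 0 l) zeta))).
  rewrite -big_split; apply: eq_bigr => l _; rewrite E.
  under eq_bigr do rewrite mulrDr.
  by rewrite big_split/= (R1 _ _ _ mz) (R1 _ _ _ (mnz l)).
congr (_ + _).
  have -> : dbarb St psi p = dirac_wedge St p (fun l => nablaS p (delta_mx 0 l) psi).
    apply: functional_extensionality_dep => q; apply/funext => A.
    exact: (dbarb_dirac_wedge Hf HT HI).
  rewrite /rpair hpair_dirac_wedge//; first by rewrite raddf_sum.
    by move=> l; exact: (nablaS_spinor HI).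
  by have := sz.1 p.
have -> : rpair St p (psi p) (dbarb_adjoint p) = \sum_l (-1) *
    rpair St p (psi p) (contract (row l (cplx H)) (nablaS p (delta_mx 0 l) zeta)).
  rewrite -rpair_sumr; apply: rpair_ext => q A.
  rewrite /dbarb_adjoint /dirac_contract -sumrN; apply: eq_bigr => l _.
  by rewrite rmorphN1 mulN1r.
by rewrite -mulr_sumr mulN1r opprK.
Qed.

Lemma in_spinor_sum p (I : Type) (l : seq I) (s : I -> cform R n k) :
  (forall i, in_spinor St p (s i)) -> in_spinor St p (fun q A => \sum_(i <- l) s i q A).
Proof.
move=> hs; elim: l => [|i l IH].
  have -> : (fun q (A : 'M[C]_(q, m)) => \sum_(i <- [::]) s i q A) = (fun q A => 0).
    by apply: functional_extensionality_dep => q; apply/funext => A; rewrite big_nil.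
  by move=> q; split=> // A j a u v; rewrite mulr0 addr0.
have -> : (fun q (A : 'M[C]_(q, m)) => \sum_(i <- i :: l) s i q A) =
    (fun q A => s i q A + \sum_(i <- l) s i q A).
  by apply: functional_extensionality_dep => q; apply/funext => A; rewrite big_cons.
exact: in_spinorD.
Qed.

Lemma in_spinor_dbarb_adjoint p : in_spinor St p (dbarb_adjoint p).
Proof.
have -> : dbarb_adjoint p = (fun q A => -1 * \sum_l
    contract (row l (cplx (invmx (metric St p)))) (nablaS p (delta_mx 0 l) zeta) q A).
  by apply: functional_extensionality_dep => q; apply/funext => A; rewrite mulN1r.
apply: in_spinorZ; apply: in_spinor_sum => l; apply: in_spinor_contract.
exact: (nablaS_spinor HI).
Qed.

Lemma nablaC_sum_coord p v (W : cvfield M) : smooth_cvf W ->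
  nablaC nabla p v W = \sum_l (v 0 l)%:C *: nablaC nabla p (delta_mx 0 l) W.
Proof.
move=> [s1 s2]; rewrite /nablaC (nabla_v_sum Hc p v s1) (nabla_v_sum Hc p v s2).
rewrite !(big_morph (@cplx R 1 m) (@cplxD R 1 m) (@cplx0 R 1 m)) scaler_sumr -big_split.
apply: eq_bigr => l _ /=; rewrite !cplxZ scalerDr; congr (_ + _).
by rewrite !scalerA mulrC.
Qed.

Lemma cvfield_extension (p : M) (z : 'rV[C]_m) : exists2 W : cvfield M, smooth_cvf W & W p = z.
Proof.
have [X [sX Xp]] := vfield_extension p (Remx z).
have [Y [sY Yp]] := vfield_extension p (Immx z).
exists (fun r => cplx (X r) + 'i%C *: cplx (Y r)); last by rewrite Xp Yp -cplx_ReIm.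
split.
  have -> : Revf (fun r => cplx (X r) + 'i%C *: cplx (Y r)) = X by apply/funext => r; exact: Remx_cplx.
  exact: sX.
have -> : Imvf (fun r => cplx (X r) + 'i%C *: cplx (Y r)) = Y by apply/funext => r; exact: Immx_cplx.
exact: sY.
Qed.

(** Linearity in [v] is read off from the induced formula after extending the rows of [A] to smooth
    fields. *)
Lemma nablaS_sum_coord p v q (A : 'M[C]_(q, m)) :
  nablaS p v zeta q A = \sum_l (v 0 l)%:C * nablaS p (delta_mx 0 l) zeta q A.
Proof.
have [W HW] : {W : 'I_q -> cvfield M & forall i, smooth_cvf (W i) /\ W i p = row i A}.
  apply: (@choice _ _ (fun i W => smooth_cvf W /\ W p = row i A)) => i.
  by have [W sW Wp] := cvfield_extension p (row i A); exists W.
have sW i : smooth_cvf (W i) by have [] := HW i.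
have -> : A = \matrix_i W i p by apply/row_matrixP => i; rewrite rowK; have [] := HW i.
have [mz _ _] := sz.1 p q.
rewrite (induced_formula Hf HT HI p v sz sW).
under [RHS]eq_bigr do rewrite (induced_formula Hf HT HI p _ sz sW) mulrBr.
rewrite sumrB; congr (_ - _).
  by apply: vderC_sum_coord; exact: smooth_cfun_at (sz.2 q W sW).
under [RHS]eq_bigr do rewrite mulr_sumr.
rewrite exchange_big/=; apply: eq_bigr => j _.
by rewrite (nablaC_sum_coord p v (sW j)) multilinear_sum.
Qed.

Lemma smooth_cvf_nablaC X (W : cvfield M) : smooth_vf X -> smooth_cvf W ->
  smooth_cvf (fun r => nablaC nabla r (X r) W).
Proof.
move=> sX [s1 s2]; split.
  have -> : Revf (fun r => nablaC nabla r (X r) W) = (fun r => nabla r (X r) (Revf W)).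
    by apply/funext => r; exact: Remx_cplx.
  exact: (smooth_nabla Hc).
have -> : Imvf (fun r => nablaC nabla r (X r) W) = (fun r => nabla r (X r) (Imvf W)).
  by apply/funext => r; exact: Immx_cplx.
exact: (smooth_nabla Hc).
Qed.

Lemma smooth_nablaS X q (W : 'I_q -> cvfield M) p : smooth_vf X -> (forall i, smooth_cvf (W i)) ->
  smooth_cat (fun r => nablaS r (X r) zeta q (\matrix_i W i r)) p.
Proof.
move=> sX sW.
have -> : (fun r => nablaS r (X r) zeta q (\matrix_i W i r)) =
   (fun r => vderC r (X r) (fun r' => zeta r' q (\matrix_i W i r')) +
     - \sum_(j < q) zeta r q (set_row j (nablaC nabla r (X r) (W j)) (\matrix_i W i r))).
  by apply/funext => r; exact: (induced_formula Hf HT HI r (X r) sz sW).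
have sm := sz.2 q W sW.
apply: smooth_catD.
  by apply: smooth_cfun_at; split; [exact: smooth_vder sX sm.1 | exact: smooth_vder sX sm.2].
apply: smooth_catN; apply: smooth_cat_sum => j.
pose W' i : cvfield M := if i == j then fun r => nablaC nabla r (X r) (W j) else W i.
have -> : (fun r => zeta r q (set_row j (nablaC nabla r (X r) (W j)) (\matrix_i W i r))) =
    (fun r => zeta r q (\matrix_i W' i r)).
  apply/funext => r; congr (zeta r q _); apply/row_matrixP => i; rewrite !rowK /W'.
  by case: (i == j).
apply: smooth_cfun_at; apply: sz.2 => i; rewrite /W'; case: (i == j) => //.
exact: smooth_cvf_nablaC.
Qed.

(** The defining sum uses the basis of the chart attached to each point, which jumps from point to
    point. Near [p] it is rewritten in a smooth frame with its inverse Gram matrix, where every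
    factor is visibly smooth. *)
Lemma dbarb_adjoint_section : spinor_section St dbarb_adjoint.
Proof.
split=> [p|q W sW]; first exact: in_spinor_dbarb_adjoint.
apply: smooth_cfunP => p.
have [X [sX X1]] := frame_extension_std p.
have uX : \matrix_a X a p \in unitmx by rewrite X1 unitmx1.
pose H r a b := invmx (gram St X r) a b.
pose F a b r := nablaS r (X a r) zeta q.+1 (col_mx (cplx (X b r)) (\matrix_i W i r)).
apply: (@smooth_cat_near_eq _ _ _ _ (fun r => - \sum_a \sum_b (H r a b)%:C * F a b r)); last first.
  apply: smooth_catN; apply: smooth_cat_sum => a; apply: smooth_cat_sum => b.
  apply: smooth_catZ; first exact: (smooth_invgram Hf a b sX uX).
  rewrite /F; under [fun r => _]funext => r do rewrite (col_mx_fields (fun r => cplx (X b r)) W).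
  apply: smooth_nablaS => // i; case: (unlift _ _) => [j|] //; exact: smooth_cvf_cplx.
have N := frame_near Hf sX uX; near=> r.
have u : \matrix_a X a r \in unitmx by near: r; exact: N.
rewrite /dbarb_adjoint /dirac_contract; congr (- _).
have rE l : row l (cplx (invmx (metric St r))) =
   \sum_b (\sum_a X a r 0 l * H r a b)%:C *: cplx (X b r).
  rewrite -(frame_metric_inv Hf r u) -gramE.
  transitivity (cplx (row l (((\matrix_a X a r)^T *m invmx (gram St X r)) *m \matrix_a X a r))).
    by apply/rowP => c; rewrite !mxE.
  rewrite row_mul mulmx_sum_row.
  rewrite (big_morph (@cplx R 1 m) (@cplxD R 1 m) (@cplx0 R 1 m)); apply: eq_bigr => b _.
  rewrite cplxZ rowK mxE; congr (_%:C *: _).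
  by rewrite mxE; apply: eq_bigr => a _; rewrite !mxE.
have mn l : multilinear_family (nablaS r (delta_mx 0 l) zeta).
  by move=> q'; have [] := nablaS_spinor HI r (delta_mx 0 l) sz q'.
transitivity (\sum_l \sum_b \sum_a (X a r 0 l * H r a b)%:C *
   nablaS r (delta_mx 0 l) zeta q.+1 (col_mx (cplx (X b r)) (\matrix_i W i r))); last first.
  apply: eq_bigr => l _.
  rewrite rE -[RHS]/(contract _ (nablaS r (delta_mx 0 l) zeta) q _) (contract_sum _ _ _ _ _ (mn l)).
  by apply: eq_bigr => b _; rewrite rmorph_sum mulr_suml.
under [RHS]eq_bigr do rewrite exchange_big.
rewrite [RHS]exchange_big/=; apply: eq_bigr => a _.
rewrite [RHS]exchange_big/=; apply: eq_bigr => b _.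
rewrite /F nablaS_sum_coord mulr_sumr; apply: eq_bigr => l _.
by rewrite rmorphM mulrA [in RHS](mulrC _%:C).
Unshelve. all: by end_near. Qed.

End DiracContract.
Arguments dbarb_adjoint {R n k M} St nablaS zeta p q A.

(** * The volume form *)

Local Close Scope complex_scope.

Lemma wedge_pow_mulmx (K : fieldType) d (f : 'rV[K]_d -> 'rV[K]_d -> K) (P : 'M[K]_d) r (B : 'M[K]_(r * 2, d)) :
  (forall u v, f (u *m P) (v *m P) = f u v) ->
  wedge_pow (fun B : 'M[K]_(2, d) => f (row 0 B) (row 1 B)) r (B *m P) =
  wedge_pow (fun B : 'M[K]_(2, d) => f (row 0 B) (row 1 B)) r B.
Proof.
move=> fP; elim: r B => [//|r IH] B /=.
rewrite /wedge; congr (_ * _); apply: eq_bigr => s _.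
have rp : row_perm s (B *m P) = row_perm s B *m P.
  by apply/matrixP => i j; rewrite !mxE; apply: eq_bigr => l _; rewrite !mxE.
congr (_ * (_ * _)).
  by rewrite !row_usubmx rp !row_mul fP.
by rewrite rp -mul_dsub_mx IH.
Qed.

Lemma sympS0 (R : realFieldType) i : symp R i.+2 0 = 0.
Proof. by rewrite /symp /= negbK; case: (odd i). Qed.

Lemma sympS1 (R : realFieldType) i : symp R i.+2 1 = 0.
Proof. by rewrite /symp /= negbK eqSS; case: i => [|i] //=; case: (~~ odd i). Qed.

Lemma sympSS (R : realFieldType) i j : symp R i.+2 j.+2 = symp R i j.
Proof. by rewrite /symp /= negbK !eqSS. Qed.

Section Volume.
Variables (R : realType) (n k : nat).
Local Notation m := (k + n * 2)%N.
Variables (M : manifold R m) (St : fpk_data M).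
Hypothesis Hf : is_metric_fpk St.

Section Pointwise.
Variable p : M.
Local Notation ph := (phi St p).
Local Notation g := (metric St p).

Definition eta_mx : 'M[R]_(m, k) := \matrix_(l, i) eta St i p l 0.

Lemma eta_detE (A : 'M[R]_(k, m)) :
  \det (\matrix_(i, j) pair_eta St i p (row j A)) = \det (A *m eta_mx).
Proof.
rewrite -[RHS]det_tr; congr (\det _); apply/matrixP => i j; rewrite !mxE /pair_eta mxE.
by apply: eq_bigr => l _; rewrite !mxE.
Qed.

Lemma eta_det_multilinear :
  multilinear (fun A : 'M[R]_(k, m) => \det (\matrix_(i, j) pair_eta St i p (row j A))).
Proof.
move=> A j a u v; rewrite !eta_detE.
have rowS w : row j (set_row j w A *m eta_mx) = w *m eta_mx by rewrite row_mul row_set_row eqxx.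
have rowS' w w' : row' j (set_row j w A *m eta_mx) = row' j (set_row j w' A *m eta_mx).
  apply/row_matrixP => i; apply/rowP => c; rewrite !mxE; apply: eq_bigr => l _.
  by rewrite !mxE eq_sym (negPf (neq_lift _ _)).
rewrite (@determinant_multilinear _ _ _ (set_row j u A *m eta_mx) (set_row j v A *m eta_mx) j a 1) ?mul1r//.
by rewrite !rowS mulmxDl -scalemxAl scale1r.
Qed.

Definition Phi_form : mform R m 2 := fun A => Phi St p (row 0 A) (row 1 A).

Lemma PhiDl (a : R) u v w : Phi St p (a *: u + v) w = a * Phi St p u w + Phi St p v w.
Proof. by rewrite /Phi mulmxDl -scalemxAl gprodDl gprodZl. Qed.

Lemma Phi_skew u v : Phi St p u v = - Phi St p v u.
Proof. by rewrite /Phi (phi_skew Hf) (gprod_sym Hf). Qed.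

Lemma PhiDr (a : R) u v w : Phi St p w (a *: u + v) = a * Phi St p w u + Phi St p w v.
Proof. by rewrite Phi_skew PhiDl opprD -mulrN -!(Phi_skew w). Qed.

Lemma Phi_form_multilinear : multilinear Phi_form.
Proof.
move=> A j a u v; rewrite /Phi_form !row_set_row.
case: (unliftP (0 : 'I_2) j) => [j'|] ->; first by rewrite (ord1 j') /= PhiDr.
by rewrite /= PhiDl.
Qed.

Lemma volume_multilinear : multilinear (volume St p).
Proof.
apply: wedge_multilinear; first exact: eta_det_multilinear.
exact: wedge_pow_multilinear Phi_form_multilinear.
Qed.

Lemma volume_alternating : alternating (volume St p).
Proof. exact: wedge_alternating. Qed.

Lemma volumeM (A B : 'M[R]_m) : volume St p (A *m B) = \det A * volume St p B.
Proof. exact: top_form_det volume_multilinear volume_alternating. Qed.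

Lemma gprod_mx a b (A : 'M[R]_(a, m)) (B : 'M[R]_(b, m)) i j :
  gprod St p (row i A) (row j B) = (A *m g *m B^T) i j.
Proof.
by rewrite /gprod -row_mul [LHS]mxE [RHS]mxE; apply: eq_bigr => l _; rewrite !mxE.
Qed.

Lemma gprod_gt0 v : v != 0 -> 0 < gprod St p v v.
Proof. by case: Hf => _ _ _ [_ _ +] _; exact. Qed.

(** A Gram-Schmidt step inside E. The new vector is the normalisation of some [w phi] orthogonal to
    the rows of [A]; as [A] is stable under [phi], the image of that vector under [phi] is
    orthogonal to them as well. *)
Lemma symplectic_step r (A : 'M[R]_(r * 2, m)) : (r < n)%N -> (A *m ph <= A)%MS ->
  exists v, [/\ (v <= ph)%MS, gprod St p v v = 1, forall i, gprod St p v (row i A) = 0 &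
    forall i, gprod St p (v *m ph) (row i A) = 0].
Proof.
move=> rn /submxP[B AB].
have [w w0 wA] : exists2 w : 'rV[R]_m, w *m ph != 0 & w *m ph *m g *m A^T = 0.
  pose Kr := kermx (ph *m g *m A^T).
  (* A rank count: the kernel has rank at least m - 2r, which exceeds m - 2n, the rank of ker phi,
     so [phi] cannot kill all of it. *)
  have [|KN0] := eqVneq (Kr *m ph) 0.
    move=> /sub_kermxP /mxrankS; rewrite !mxrank_ker (phi_rank Hf) => h.
    have r1 : (\rank (ph *m g *m A^T) <= r * 2)%N by exact: rank_leq_col.
    have := rank_leq_row ph; rewrite (phi_rank Hf); have := rank_leq_row (ph *m g *m A^T).
    by move: h r1 rn; lia.
  have [i Ki] : exists i, row i (Kr *m ph) != 0.
    apply/existsP; rewrite -negb_forall; apply: contra KN0 => /forallP h.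
    by apply/eqP/row_matrixP => i; rewrite row0; apply/eqP.
  exists (row i Kr); first by rewrite -row_mul.
  by rewrite -!row_mul -[X in row i X]mulmxA -mulmxA [X in Kr *m X]mulmxA mulmx_ker row0.
pose u := w *m ph.
have u0 : 0 < gprod St p u u by exact: gprod_gt0.
pose a := (Num.sqrt (gprod St p u u))^-1.
have uA i : gprod St p u (row i A) = 0.
  by rewrite -[u](row_id 0) gprod_mx wA mxE.
have upA i : gprod St p (u *m ph) (row i A) = 0.
  rewrite (phi_skew Hf) -row_mul AB -[u](row_id 0) gprod_mx trmx_mul mulmxA wA mul0mx mxE oppr0.
  by [].
exists (a *: u); split.
- by rewrite scalemx_sub// submxMl.
- rewrite gprodZl (gprod_sym Hf) gprodZl mulrA -expr2 exprVn sqr_sqrtr ?ltW// mulVf//.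
  by rewrite gt_eqF.
- by move=> i; rewrite gprodZl uA mulr0.
- by move=> i; rewrite -scalemxAl gprodZl upA mulr0.
Qed.

Lemma inE_phi2 a (A : 'M[R]_(a, m)) : (A <= ph)%MS -> A *m ph *m ph = - A.
Proof. by move=> /submxP[B ->]; rewrite -mulmxA -mulmxA (mulmxA ph) (phi_cube Hf) mulmxN. Qed.

(** The vectors are added in pairs v, phi v, which keeps the family stable under [phi] as the next
    step requires. *)
Lemma symplectic_basis r : (r <= n)%N -> exists A : 'M[R]_(r * 2, m),
  [/\ forall i j, Phi St p (row i A) (row j A) = symp R i j, (A <= ph)%MS & (A *m ph <= A)%MS].
Proof.
elim: r => [|r IH] rn.
  by exists 0; split=> [[]//||]; rewrite ?sub0mx// mul0mx sub0mx.
have [A [AS AE AA]] := IH (ltnW rn).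
have [v [vE vv vA vpA]] := symplectic_step rn AA.
pose A' : 'M[R]_(r.+1 * 2, m) := col_mx v (col_mx (v *m ph) A).
have vp2 : v *m ph *m ph = - v by exact: inE_phi2.
have R0 : row ord0 A' = v by exact: row_col_mx0.
have R1 : row (lift ord0 ord0) A' = v *m ph by rewrite [LHS]row_col_mxS; exact: row_col_mx0.
have R2 i : row (lift ord0 (lift ord0 i)) A' = row i A by rewrite [LHS]row_col_mxS; exact: row_col_mxS.
have vvp : gprod St p (v *m ph) v = 0.
  have : gprod St p (v *m ph) v = - gprod St p (v *m ph) v by rewrite {1}(phi_skew Hf) (gprod_sym Hf).
  lra.
have vpvp : gprod St p (v *m ph) (v *m ph) = 1.
  by rewrite (phi_skew Hf) vp2 (gprod_sym Hf) gprodNl opprK.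
have colS a b (P : 'M[R]_(a, m)) (Q : 'M[R]_(b, m)) (D : 'M[R]_m) :
  (P <= D)%MS -> (Q <= D)%MS -> (col_mx P Q <= D)%MS by move=> PD QD; rewrite col_mx_sub PD.
exists A'; split.
- move=> i j.
  case: (unliftP ord0 i) => [i'|] ->; last first.
    rewrite R0; case: (unliftP ord0 j) => [j'|] ->; last by rewrite R0 /Phi vvp.
    case: (unliftP ord0 j') => [j''|] ->; first by rewrite R2 /Phi vpA.
    by rewrite R1 /Phi vpvp.
  case: (unliftP ord0 i') => [i''|] ->; last first.
    rewrite R1; case: (unliftP ord0 j) => [j'|] ->; last first.
      by rewrite R0 /Phi vp2 gprodNl vv.
    case: (unliftP ord0 j') => [j''|] ->; first by rewrite R2 /Phi vp2 gprodNl vA oppr0.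
    by rewrite R1 /Phi vp2 gprodNl (gprod_sym Hf) vvp oppr0.
  rewrite R2; case: (unliftP ord0 j) => [j'|] ->; last first.
    rewrite R0 Phi_skew /Phi vpA oppr0; exact: esym (sympS0 R i'').
  case: (unliftP ord0 j') => [j''|] ->; last first.
    rewrite R1 Phi_skew /Phi vp2 gprodNl vA opprK; exact: esym (sympS1 R i'').
  rewrite R2 AS; exact: esym (sympSS R i'' j'').
- have H := colS _ _ _ _ _ vE (colS _ _ _ _ _ (submxMl v ph) AE).
  exact H.
have AvA : (v <= A')%MS by apply: (submx_trans (addsmxSl v (col_mx (v *m ph) A))); rewrite addsmxE.
have AAA : (col_mx (v *m ph) A <= A')%MS.
  by apply: (submx_trans (addsmxSr v (col_mx (v *m ph) A))); rewrite addsmxE.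
have -> : A' *m ph = col_mx (v *m ph) (col_mx (- v) (A *m ph)).
  by apply: (etrans (mul_col_mx v (col_mx (v *m ph) A) ph)); rewrite mul_col_mx vp2.
have [AvpA ApA] : (v *m ph <= A')%MS /\ (A <= A')%MS.
  by apply/andP; move: AAA; rewrite col_mx_sub.
have H1 : (v *m ph <= <<A'>>)%MS by rewrite genmxE.
have H2 : (- v <= <<A'>>)%MS by rewrite genmxE -scaleN1r scalemx_sub.
have H3 : (A *m ph <= <<A'>>)%MS by rewrite genmxE; exact: submx_trans ApA.
have := colS _ _ _ _ _ H1 (colS _ _ _ _ _ H2 H3).
by rewrite genmxE.
Qed.

(** The frame consists of the [xi] followed by a symplectic basis of E. The product of the eta^i
    sees only the first block and the power of Phi only the second. *)
Lemma volume_gt0_frame : exists A : 'M[R]_m, 0 < volume St p A.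
Proof.
have [E [ES EE EA]] := symplectic_basis (leqnn n).
pose X : 'M[R]_(k, m) := \matrix_i xi St i p.
exists (col_mx X E).
apply: wedge_block_gt0 => [N N'|N N'|]; last exact: wedge_pow_gt0.
  rewrite eta_detE mulmxDl -!mulmxA.
  have -> : X *m eta_mx = 1%:M.
    apply/matrixP => i j; rewrite [RHS]mxE eq_sym -(eta_xi Hf p j i) /pair_eta !mxE.
    by apply: eq_bigr => l _; rewrite !mxE.
  have -> : E *m eta_mx = 0.
    have /submxP[D ->] := EE; rewrite -mulmxA; have -> : ph *m eta_mx = 0; last by rewrite mulmx0.
    apply/matrixP => i j.
    transitivity ((ph *m eta St j p) i 0); last by rewrite (phi_eta Hf) !mxE.
    by rewrite !mxE; apply: eq_bigr => l _; rewrite mxE.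
  by rewrite mulmx1 mulmx0 addr0.
pose b := wedge_pow Phi_form n.
have mb : multilinear b by exact: wedge_pow_multilinear Phi_form_multilinear.
(* The projector onto E. It preserves [Phi] and removes the [xi] part of the rows, which shows that
   the power of Phi depends on the E block alone. *)
pose P := - (ph *m ph).
have vP (u : 'rV[R]_m) : u *m P = - (u *m ph *m ph) by rewrite mulmxN mulmxA.
have P2 u v : Phi St p (u *m P) (v *m P) = Phi St p u v.
  rewrite /Phi !vP mulNmx -(mulmxA (u *m ph)) -mulmxA (mulmxA ph) (phi_cube Hf) mulmxN opprK.
  rewrite (gprod_sym Hf) gprodNl (phi_skew Hf) (phi_skew Hf p v) opprK.
  have -> : u *m ph *m ph *m ph = - (u *m ph) by rewrite -[LHS]mulmxA -mulmxA (mulmxA ph) (phi_cube Hf) mulmxN.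
  by rewrite (gprod_sym Hf) gprodNl opprK.
have XP : (N *m X + N' *m E) *m P = N' *m E.
  rewrite mulmxDl; have -> : N' *m E *m P = N' *m E.
    by rewrite -mulmxA mulmxN mulmxA (inE_phi2 EE) opprK.
  have -> : N *m X *m P = 0; last by rewrite add0r.
    have Xp : X *m ph = 0 by apply/row_matrixP => i; rewrite row_mul rowK (xi_phi Hf) row0.
    by rewrite -mulmxA mulmxN mulmxA Xp mul0mx oppr0 mulmx0.
transitivity (b ((N *m X + N' *m E) *m P)); first exact: esym (wedge_pow_mulmx _ P2).
rewrite XP.
pose w : mform R (n * 2) (n * 2) := fun B => b (B *m E).
have mw : multilinear w.
  move=> B j a u v; rewrite /w.
  have sE z : set_row j z B *m E = set_row j (z *m E) (B *m E).
    by apply/row_matrixP => i; rewrite row_mul !row_set_row; case: (i == j); rewrite ?row_mul.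
  by rewrite !sE mulmxDl -scalemxAl mb.
have aw : alternating w.
  have altb : alternating b by apply: antisymmetric_alternating; exact: wedge_pow_antisymmetric.
  move=> B i j neq eqr; apply: (altb (B *m E) i j neq).
  by rewrite !row_mul eqr.
by have := top_form_det N' 1%:M mw aw; rewrite /w mulmx1 mul1mx.
Qed.

Lemma volume_neq0 (A : 'M[R]_m) : A \in unitmx -> volume St p A != 0.
Proof.
move=> uA; have [B pos] := volume_gt0_frame.
by apply/eqP => vA; move: pos; rewrite -[B](mulmxKV uA) volumeM vA mulr0 ltxx.
Qed.

End Pointwise.
End Volume.

Section VderDet.
Variables (R : realType) (d : nat) (M : manifold R d) (p : M) (v : 'rV[R]_d).

Lemma vder_prod1 (I : Type) (s : seq I) (F : I -> M -> R) :
  (forall i, smooth_at (F i) p) -> (forall i, F i p = 1) ->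
  vder p v (fun r => \prod_(i <- s) F i r) = \sum_(i <- s) vder p v (F i).
Proof.
move=> sF F1; elim: s => [|i s IH].
  under [fun r => _]funext => r do rewrite big_nil.
  by rewrite vder_cst big_nil.
under [fun r => _]funext => r do rewrite big_cons.
rewrite vderM; [|exact: sF|by apply: smooth_at_prod => j _; exact: sF].
rewrite IH F1 mul1r [X in _ + X * _]big1 ?mul1r; last by move=> j _; exact: F1.
by rewrite big_cons addrC.
Qed.

Lemma vder_mul_eq0 (f g : M -> R) : smooth_at f p -> smooth_at g p -> f p = 0 -> g p = 0 ->
  vder p v (fun r => f r * g r) = 0.
Proof. by move=> sf sg f0 g0; rewrite vderM// f0 g0 !mul0r addr0. Qed.

(* The other permutations contribute products with two factors vanishing at p. *)
Lemma vder_det1 e (D : M -> 'M[R]_e) : (forall i j, smooth_at (fun r => D r i j) p) ->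
  D p = 1%:M -> vder p v (fun r => \det (D r)) = \sum_a vder p v (fun r => D r a a).
Proof.
move=> sD D1; rewrite /determinant.
have sP (s : 'S_e) : smooth_at (fun r => \prod_i D r i (s i)) p.
  by apply: smooth_at_prod => i _; exact: sD.
rewrite vder_sum; last first.
  by move=> s _; apply: smooth_atM; [exact: smooth_at_cst | exact: sP].
rewrite (bigD1 1%g)//= [X in _ + X]big1 => [|s s1].
  rewrite addr0 vderM; [|exact: smooth_at_cst|exact: sP].
  rewrite vder_cst mulr0 addr0 odd_perm1 expr0 mul1r.
  rewrite vder_prod1 => [|i|i]; [|exact: sD|by rewrite D1 perm1 mxE eqxx].
  by apply: eq_bigr => i _; rewrite perm1.
rewrite vderM; [|exact: smooth_at_cst|exact: sP].
rewrite vder_cst mulr0 addr0.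
have [a sa] : exists a, s a != a.
  apply/existsP; rewrite -negb_forall; apply: contra s1 => /forallP h.
  by apply/eqP/permP => i; rewrite perm1; apply/eqP.
suff -> : vder p v (fun r => \prod_i D r i (s i)) = 0 by rewrite mulr0.
pose G r := \prod_(i | (i != a) && (i != s a)) D r i (s i).
have -> : (fun r => \prod_i D r i (s i)) = (fun r => D r a (s a) * (D r (s a) (s (s a)) * G r)).
  by apply/funext => r; rewrite (bigD1 a)//= (bigD1 (s a))//=.
have sG : smooth_at G p by apply: smooth_at_prod => i _; exact: sD.
apply: vder_mul_eq0.
- exact: sD.
- exact: smooth_atM (sD _ _) sG.
- by rewrite D1 mxE eq_sym (negPf sa).
by rewrite D1 mxE eq_sym (inj_eq perm_inj) (negPf sa) mul0r.
Qed.

End VderDet.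

Section Volume.
Variables (R : realType) (n k : nat).
Local Notation m := (k + n * 2)%N.
Variables (M : manifold R m) (St : fpk_data M).
Hypothesis Hf : is_metric_fpk St.

Section Germ.
Variables (p : M) (P : (M -> R) -> Prop).
Hypothesis aP : germ_algebra p P.
Variables (I : Type) (W : I -> vfield M).
Hypothesis PPhi : forall a b, P (fun q => Phi St q (W a q) (W b q)).
Hypothesis Peta : forall j a, P (fun q => pair_eta St j q (W a q)).

Lemma germ_Phi_pow r (s : 'I_(r * 2) -> I) :
  P (fun q => wedge_pow (Phi_form St q) r (\matrix_i W (s i) q)).
Proof.
elim: r s => [|r IH] s /=; first exact: (germ_cst aP).
apply: (germ_wedge aP (u := fun q => Phi_form St q) (w := fun q => wedge_pow (Phi_form St q) r)
  (A := fun q => (\matrix_(i < r.+1 * 2) W (s i) q : 'M[R]_(2 + r * 2, m)))) => t.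
  have rE q (i : 'I_2) : row i (usubmx (row_perm t (\matrix_(i < r.+1 * 2) W (s i) q : 'M[R]_(2 + r * 2, m)))) =
      W (s (t (lshift _ i))) q.
    by rewrite row_usubmx row_row_perm rowK.
  rewrite /Phi_form; under [fun q => _]funext => q do rewrite !rE.
  exact: PPhi.
under [fun q => _]funext => q.
  have -> : dsubmx (row_perm t (\matrix_(i < r.+1 * 2) W (s i) q : 'M[R]_(2 + r * 2, m))) =
     \matrix_i W (s (t (rshift 2 i))) q.
    by apply/row_matrixP => i; rewrite row_dsubmx row_row_perm !rowK.
  over.
exact: (IH (fun i => s (t (rshift 2 i)))).
Qed.

(** Applied to smooth germs this gives smoothness of the volume; applied to stationary germs it
    gives that the volume is parallel. *)
Lemma germ_volume (s : 'I_m -> I) : P (fun q => volume St q (\matrix_i W (s i) q)).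
Proof.
apply: (germ_wedge aP
  (u := fun q A => \det (\matrix_(i, j) pair_eta St i q (row j A)))
  (w := fun q => wedge_pow (Phi_form St q) n)
  (A := fun q => \matrix_i W (s i) q)) => t.
  apply: (germ_det aP) => i j; under [fun q => _]funext => q.
    rewrite mxE row_usubmx row_row_perm rowK; over.
  exact: Peta.
under [fun q => _]funext => q.
  have -> : dsubmx (row_perm t (\matrix_i W (s i) q)) = \matrix_i W (s (t (rshift k i))) q.
    by apply/row_matrixP => i; rewrite row_dsubmx row_row_perm !rowK.
  over.
exact: (germ_Phi_pow (fun i => s (t (rshift k i)))).
Qed.

End Germ.

Lemma smooth_volume (W : 'I_m -> vfield M) : (forall i, smooth_vf (W i)) ->
  smooth_fun (fun q => volume St q (\matrix_i W i q)).
Proof.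
move=> sW; apply/smooth_funP => p.
have [sphi _ seta _ _] := Hf.
apply: (germ_volume (smooth_germ_algebra p) _ _ id) => [a b|j a].
  exact: (iffLR (smooth_funP _) (smooth_gprod Hf (sphi _ (sW a)) (sW b))).
exact: (iffLR (smooth_funP _) (seta j _ (sW a))).
Qed.

Lemma topform_volume (f : M -> R) : smooth_fun f -> topform (fun q A => f q * volume St q A).
Proof.
move=> sf; split=> [p A j a u v|p A i j neq eqr|W sW].
- by rewrite (volume_multilinear Hf) mulrDr mulrCA.
- by rewrite (volume_alternating _ _ neq eqr) mulr0.
apply/smooth_funP => q; apply: smooth_atM; first exact: (iffLR (smooth_funP _) sf).
exact: (iffLR (smooth_funP _) (smooth_volume sW)).
Qed.

Variable nabla : connection M.
Hypothesis HT : is_tanaka_webster St nabla.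

Let Hc : is_connection nabla. Proof. by case: HT. Qed.

(** The frame Y = (1 - N) X is parallel at [p], so its volume det(1 - N) vol(X) is stationary there.
    Since N vanishes at [p], the derivative of the determinant is minus the trace of the derivative
    of N. *)
Lemma vder_volume (X : 'I_m -> vfield M) p v : (forall i, smooth_vf (X i)) ->
  \matrix_i X i p \in unitmx ->
  vder p v (fun q => volume St q (\matrix_i X i q)) =
  volume St p (\matrix_i X i p) * \sum_a (nabla p v (X a) *m invmx (\matrix_i X i p)) 0 a.
Proof.
move=> sX uX; have [N [sN N0 vN nN]] := sync_frame Hc sX uX.
pose Y a r := X a r - \sum_b N a b r *: X b r.
have sY a : smooth_vf (Y a).
  apply: smooth_vfB => //.
  by apply: (smooth_vf_sum _ _ (X := fun b r => N a b r *: X b r)) => b; exact: smooth_vfZ.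
have nY w a : nabla p w (Y a) = 0 by exact: nN.
pose D r : 'M[R]_m := 1%:M - \matrix_(a, b) N a b r.
have D1 : D p = 1%:M.
  by apply/matrixP => a b; rewrite !mxE N0 subr0.
have sD a b : smooth_at (fun r => D r a b) p.
  under [fun r => _]funext => r do rewrite !mxE -mulN1r.
  apply: smooth_atD; first exact: smooth_at_cst.
  apply: smooth_atM; [exact: smooth_at_cst | exact: (iffLR (smooth_funP _) (sN a b))].
have YE r : \matrix_a Y a r = D r *m \matrix_a X a r.
  apply/row_matrixP => a; rewrite rowK row_mul /D linearB/= mulmxBl row1 -rowE rowK.
  congr (_ - _); rewrite mulmx_sum_row; apply: eq_bigr => b _.
  by rewrite !mxE rowK.
have [sphi _ seta _ _] := Hf.
have [_] : stationary_at p (fun q => volume St q (\matrix_i Y i q)).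
  apply: (germ_volume (stationary_germ_algebra p) _ _ id) => [a b|j a].
    split; first exact: (iffLR (smooth_funP _) (smooth_gprod Hf (sphi _ (sY a)) (sY b))).
    move=> w; rewrite (nabla_metric HT p w (sphi _ (sY a)) (sY b)).
    by rewrite (nabla_phi HT p w (sY a)) !nY mul0mx gprod0 (gprod_sym Hf) gprod0 addr0.
  split; first exact: (iffLR (smooth_funP _) (seta j _ (sY a))).
  move=> w; case: HT => _ [_ _ h] _; rewrite (h p w j _ (sY a)) nY.
  by rewrite /pair_eta mul0mx mxE.
move=> /(_ v).
under [fun q => _]funext => q do rewrite YE (volumeM Hf).
have sv := iffLR (smooth_funP _) (smooth_volume sX) p.
rewrite (vderM _ (germ_det (smooth_germ_algebra p) sD) sv) D1 det1 mul1r (vder_det1 _ sD D1).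
move=> /eqP; rewrite addr_eq0 => /eqP ->; rewrite -mulrN -sumrN; congr (_ * _).
apply: eq_bigr => a _; under [fun r => _]funext => r do rewrite !mxE -mulN1r.
have sNa := iffLR (smooth_funP _) (sN a a) p.
rewrite vderD; [|exact: smooth_at_cst|exact: smooth_atM (smooth_at_cst _ _) sNa].
rewrite vder_cst add0r (vderM _ (smooth_at_cst _ _) sNa) vder_cst mulr0 addr0 mulN1r opprK.
exact: vN.
Qed.

End Volume.

(** * Linear changes of chart and orientation *)

Section LinearChart.
Variables (R : realType) (d : nat) (M : manifold R d).

Lemma smoothR_sum (I : Type) (s : seq I) (F : I -> 'rV[R]_d -> R) x :
  (forall i, smoothR (F i) x) -> smoothR (fun y => \sum_(i <- s) F i y) x.
Proof.
move=> sF; elim: s => [|i s IH].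
  under [fun y => _]funext => y do rewrite big_nil.
  exact: smoothR_cst.
under [fun y => _]funext => y do rewrite big_cons.
exact: smoothRD.
Qed.

Lemma smoothR_mulmx (Q : 'M[R]_d) j x : smoothR (fun y : 'rV[R]_d => (y *m Q) 0 j) x.
Proof.
under [fun y => _]funext => y do rewrite mxE.
apply: smoothR_sum => i; apply: smoothRM; [exact: smoothR_coord | exact: smoothR_cst].
Qed.

Lemma continuous_mulmx (Q : 'M[R]_d) (x : 'rV[R]_d) : {for x, continuous (fun y : 'rV[R]_d => y *m Q)}.
Proof. by apply: for_continuous_row => j; apply: smoothR_continuous; exact: smoothR_mulmx. Qed.

(** Serves to reverse the orientation of a chart. *)
Definition linear_chart (c : chart R d M) (Q : 'M[R]_d) : chart R d M :=
  Chart (cdom c) (fun q => cmap c q *m Q) (fun x => cinv c (x *m invmx Q)).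

Variables (c : chart R d M) (Q : 'M[R]_d).
Hypothesis ac : in_maximal_atlas c.
Hypothesis uQ : Q \in unitmx.

Lemma linear_chart_atlas : in_maximal_atlas (linear_chart c Q).
Proof.
have [[od oi K cm ci] ht] := ac.
have iE : cimg (linear_chart c Q) = (fun x => x *m invmx Q) @^-1` cimg c.
  apply/seteqP; split=> x.
    by move=> [q cq <-] /=; exists q => //; rewrite mulmxK.
  by move=> [q cq /= qx]; exists q => //=; rewrite qx mulmxKV.
split.
  split.
  - exact: od.
  - rewrite iE; apply: open_comp oi => x _; exact: continuous_mulmx.
  - by move=> p cp; rewrite /= mulmxK// K.
  - move=> p cp; exact: (continuous_comp (cm p cp) (@continuous_mulmx Q (cmap c p))).
  - move=> x; rewrite iE => cx; exact: (continuous_comp (@continuous_mulmx (invmx Q) x) (ci _ cx)).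
move=> p; have [t1 t2] := ht p; split=> i.
  apply: smoothR_Cinfty => x [q [cq pq] <-] /=.
  apply: (smoothR_comp (f := fun y => cmap (chart_at p) (cinv c y) 0 i) (g := fun y => y *m invmx Q)) => [j|].
    exact: smoothR_mulmx.
  by rewrite mulmxK//; exact: (transition_smoothR ac.1 (chart_atP p) i t1 cq pq).
apply: smoothR_Cinfty => x [q [pq cq] <-] /=.
apply: (smoothR_comp (f := fun y : 'rV[R]_d => (y *m Q) 0 i) (g := fun y => cmap c (cinv (chart_at p) y))) => [j|].
  exact: (transition_smoothR (chart_atP p) ac.1 j t2 pq cq).
exact: smoothR_mulmx.
Qed.

Lemma coord_frame_linear_chart q : cdom c q -> coord_frame c q = Q *m coord_frame (linear_chart c Q) q.
Proof.
move=> cq; have al := linear_chart_atlas.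
have cq' : cdom (linear_chart c Q) q by exact: cq.
have uK := coord_frame_unit ac cq; have uK' := coord_frame_unit al cq'.
have E v : dcoord (linear_chart c Q) q v = dcoord c q v *m Q.
  apply/rowP => i; rewrite !mxE.
  transitivity (vder q v (fun r => \sum_l ccoord c l r * Q l i)).
    by congr (vder q v _); apply/funext => r; rewrite /ccoord /= mxE.
  have sc l : smooth_at (ccoord c l) q by exact: smooth_at_ccoord.
  rewrite vder_sum => [|l _]; last by apply: smooth_atM; [exact: sc | exact: smooth_at_cst].
  apply: eq_bigr => l _; rewrite mxE vderM; [|exact: sc|exact: smooth_at_cst].
  by rewrite vder_cst mulr0 add0r mulrC.
have E2 : invmx (coord_frame (linear_chart c Q) q) = invmx (coord_frame c q) *m Q.
  apply/row_matrixP => i; rewrite !rowE.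
  by have := E (delta_mx 0 i); rewrite (dcoordE _ al cq') (dcoordE _ ac cq) mulmxA.
have : Q = coord_frame c q *m invmx (coord_frame (linear_chart c Q) q) by rewrite E2 mulKVmx.
by move=> {1}->; rewrite mulmxKV.
Qed.

End LinearChart.

Section PositiveChart.
Variables (R : realType) (n k : nat).
Local Notation m := (k + n * 2)%N.
Variables (M : manifold R m) (St : fpk_data M).
Hypothesis Hf : is_metric_fpk St.

Lemma smooth_volume_frame (c : chart R m M) q : in_maximal_atlas c -> cdom c q ->
  smooth_at (fun r => volume St r (coord_frame c r)) q.
Proof.
move=> ac cq; have [X [sX XE]] := frame_extension ac cq.
apply: smooth_at_near_eq _ (iffLR (smooth_funP _) (smooth_volume Hf sX) q).
apply: filterS XE => r h; congr (volume St r _); apply/row_matrixP => i.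
by rewrite rowK.
Qed.

(** The volume of the coordinate frame is continuous and nonzero at [p], so it has constant sign on
    a smaller domain; if that sign is negative, one coordinate is reversed. *)
Lemma positive_chart (p : M) : exists c : chart R m M,
  [/\ in_maximal_atlas c, cdom c p & forall q, cdom c q -> 0 < volume St q (coord_frame c q)].
Proof.
have ac := atlas_chart_at p; have pp := mem_chart_at p.
pose rho r := volume St r (coord_frame (chart_at p) r).
have crho : {for p, continuous rho} by apply: smooth_at_continuous; exact: smooth_volume_frame.
have rho0 : rho p != 0 by apply: (volume_neq0 Hf); exact: coord_frame_unit.
have [rp|rn|r0] := ltgtP 0 (rho p); last by rewrite -r0 eqxx in rho0.
  have N : \forall r \near p, 0 < rho r := cvgr_gt _ crho _ rp.
  pose U := interior [set r | 0 < rho r].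
  have aU : in_maximal_atlas (restrict_chart (chart_at p) U) by apply: restrict_chart_atlas => //; exact: open_interior.
  exists (restrict_chart (chart_at p) U); split; [exact: aU | by split; [exact: pp | exact: N] | ].
  by move=> q [_ /interior_subset]; exact.
have N : \forall r \near p, rho r < 0 := cvgr_lt _ crho _ rn.
pose U := interior [set r | rho r < 0].
have aU : in_maximal_atlas (restrict_chart (chart_at p) U) by apply: restrict_chart_atlas => //; exact: open_interior.
(* In dimension 0 there is no coordinate to reverse, but then the only frame has positive volume,
   against the sign at [p]. *)
have [i0 _|no] := pickP (fun i : 'I_m => true); last first.
  have [A] := volume_gt0_frame Hf p.
  have -> : A = coord_frame (chart_at p) p by apply/matrixP => i; have := no i.
  by move=> /lt_trans/(_ rn); rewrite ltxx.
pose Q : 'M[R]_m := diag_mx (\row_i (if i == i0 then -1 else 1)).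
have dQ : \det Q = -1.
  rewrite det_diag (bigD1 i0)//= mxE eqxx big1 ?mulr1// => i ii0.
  by rewrite mxE (negPf ii0).
have uQ : Q \in unitmx by rewrite unitmxE dQ unitrN1.
exists (linear_chart (restrict_chart (chart_at p) U) Q); split; [exact: linear_chart_atlas | by split; [exact: pp | exact: N] | ].
move=> q cq; have := coord_frame_linear_chart aU uQ cq.
move=> /(congr1 (volume St q)); rewrite (volumeM Hf) dQ mulN1r => e.
have : rho q < 0 by have [_ /interior_subset] := cq.
by rewrite /rho -[coord_frame _ _]/(coord_frame (restrict_chart (chart_at p) U) q) e oppr_lt0.
Qed.

End PositiveChart.

(** * The divergence theorem in a chart *)

Section ExtendByZero.
Variables (R : realType) (d : nat) (M : manifold R d).
Implicit Types (c : chart R d M) (f : M -> R).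

(** For [f q = w q (coord_frame c q)] this is the integrand that [is_integral] assigns to the form
    [w]. *)
Definition zext c f (x : 'rV[R]_d) : R := if x \in cimg c then f (cinv c x) else 0.

Lemma zext_near c f x : in_maximal_atlas c -> cimg c x -> \forall y \near x, zext c f y = (f \o cinv c) y.
Proof.
move=> [[_ oi _ _ _] _] cx; have := open_nbhs_nbhs (conj oi cx); apply: filterS => y cy.
by rewrite /zext mem_set.
Qed.

(** The chart image of the compact [S] is closed in R^d, so [x] has a neighbourhood avoiding it,
    even when [x] lies on the boundary of the chart image. *)
Lemma zext_near0 c f S x : in_maximal_atlas c -> compact S -> S `<=` cdom c ->
  (forall q, ~ S q -> f q = 0) -> ~ (cmap c @` S) x -> \forall y \near x, zext c f y = 0.
Proof.
move=> [[_ _ K cm _] _] cS Sc f0 nx.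
have cK : closed (cmap c @` S).
  apply: compact_closed; first exact: norm_hausdorff.
  apply: continuous_compact cS; apply: continuous_in_subspaceT => q.
  by rewrite in_setE => Sq; apply: cm; exact: Sc.
have := open_nbhs_nbhs (conj (closed_openC cK) nx); apply: filterS => y ny.
rewrite /zext; case: ifP => // /set_mem [q cq qy].
apply: f0 => Sq; apply: ny; exists q => //.
by move: Sq; rewrite -qy K.
Qed.

Lemma zext_smooth c f S : in_maximal_atlas c -> compact S -> S `<=` cdom c ->
  (forall q, ~ S q -> f q = 0) -> (forall q, cdom c q -> smooth_at f q) -> Cinfty setT (zext c f).
Proof.
move=> ac cS Sc f0 sf; apply: smoothR_Cinfty => x _.
have [cx|ncx] := pselect (cimg c x).
  have E := zext_near f ac cx.
  apply: (smoothR_near_eq (f := f \o cinv c)).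
    by apply: filterS E => y ->.
  case: cx => q cq <-; exact: (iffLR (smooth_atP f ac cq) (sf q cq)).
apply: (smoothR_near_eq (f := fun=> 0)); last exact: smoothR_cst.
have nx : ~ (cmap c @` S) x by move=> [q Sq qx]; apply: ncx; exists q => //; exact: Sc.
by have E := zext_near0 ac cS Sc f0 nx; apply: filterS E => y ->.
Qed.

Lemma compact_image_bound c S : in_maximal_atlas c -> compact S -> S `<=` cdom c ->
  exists2 B : R, 0 <= B & forall q, S q -> `|cmap c q| <= B.
Proof.
move=> [[_ _ K cm _] _] cS Sc.
have cK : compact (cmap c @` S).
  apply: continuous_compact cS; apply: continuous_in_subspaceT => q.
  by rewrite in_setE => Sq; apply: cm; exact: Sc.
have [B [_ HB]] := compact_bounded cK.
exists (`|B| + 1); first by rewrite addr_ge0.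
move=> q Sq; apply: (HB (`|B| + 1)); last by exists q.
by rewrite (le_lt_trans (ler_norm B))// ltrDl.
Qed.

Lemma zext_bounded c f S B : in_maximal_atlas c -> S `<=` cdom c ->
  (forall q, S q -> `|cmap c q| <= B) -> (forall q, ~ S q -> f q = 0) ->
  forall x, B < `|x| -> zext c f x = 0.
Proof.
move=> [[_ _ K _ _] _] Sc HB f0 x Bx; rewrite /zext; case: ifP => // /set_mem [q cq qx].
apply: f0 => Sq; have := HB _ Sq; rewrite -qx K// qx => h.
by move: (lt_le_trans Bx h); rewrite ltxx.
Qed.

Lemma integral_Rn_sum0 e B (I : Type) (s : seq I) (F : I -> 'rV[R]_e -> R) : 0 <= B ->
  (forall i, lip_supp B (F i) /\ integral_Rn (F i) = 0) ->
  lip_supp B (fun x => \sum_(i <- s) F i x) /\ integral_Rn (fun x => \sum_(i <- s) F i x) = 0.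
Proof.
move=> B0 HF; elim: s => [|i s [IH1 IH2]].
  under [fun x => _]funext => x do rewrite big_nil.
  by split; [exact: lip_supp0 | exact: integral_Rn0].
under [fun x => _]funext => x do rewrite big_cons -[F i x]mul1r.
have [l1 l2] := HF i; split; first exact: lip_suppZD.
by rewrite (integral_RnZD _ B0 l1 IH1) l2 IH2 mulr0 addr0.
Qed.

End ExtendByZero.

Lemma additive_split (V W : zmodType) (D : V -> W) x y z : (forall u v, D (u - v) = D u - D v) ->
  D x = D y + D z + D (x - y - z).
Proof. by move=> DB; rewrite !DB addrC -[D x - _ - _]addrA -opprD subrK. Qed.

Section Divergence.
Variables (R : realType) (n k : nat).
Local Notation m := (k + n * 2)%N.
Variables (M : manifold R m) (St : fpk_data M) (nabla : connection M).
Hypothesis Hf : is_metric_fpk St.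
Hypothesis HT : is_tanaka_webster St nabla.

Let Hc : is_connection nabla. Proof. by case: HT. Qed.

Definition trace_nabla (V : vfield M) (q : M) : R := \sum_l nabla q (delta_mx 0 l) V 0 l.

(** The trace does not depend on the basis, so the frame of [c] may replace that of the chart
    attached to [q]. *)
Lemma trace_nabla_dcoord c q V : in_maximal_atlas c -> cdom c q -> smooth_vf V ->
  trace_nabla V q = \sum_i dcoord c q (nabla q (row i (coord_frame c q)) V) 0 i.
Proof.
move=> ac cq sV; pose A : 'M[R]_m := \matrix_l nabla q (delta_mx 0 l) V.
have nE u : nabla q u V = u *m A.
  by rewrite (nabla_v_sum Hc q u sV) mulmx_sum_row; apply: eq_bigr => l _; rewrite rowK.
transitivity (\tr A); first by apply: eq_bigr => l _; rewrite !mxE.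
have uK := coord_frame_unit ac cq.
rewrite -[in LHS](mulKmx uK A) mxtrace_mulC; apply: eq_bigr => i _.
by rewrite (dcoordE _ ac cq) nE -!row_mul [RHS]mxE.
Qed.

Lemma smooth_trace_nabla V : smooth_vf V -> smooth_fun (trace_nabla V).
Proof.
move=> sV; apply/smooth_funP => q; have ac := atlas_chart_at q; have qq := mem_chart_at q.
have [X [sX XE]] := frame_extension ac qq.
have sm i : smooth_at (fun r => vder r (nabla r (X i r) V) (ccoord (chart_at q) i)) q.
  apply: (iffLR (smooth_vfP _) (smooth_nabla Hc (sX i) sV)).
  exact: smooth_at_ccoord.
apply: (@smooth_at_near_eq _ _ _ (fun r => \sum_i vder r (nabla r (X i r) V) (ccoord (chart_at q) i))); last first.
  by apply: smooth_at_sum => i _; exact: sm.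
have N := cdom_near (chart_atP q) qq.
apply: filterS2 XE N => r XEr cr.
rewrite (trace_nabla_dcoord ac cr sV); apply: eq_bigr => i _.
by rewrite mxE XEr.
Qed.

(** A field tangent to E is presented as [phi] applied to [V'], the form in which the torsion
    condition on the [xi] applies. *)
Variable V' : vfield M.
Hypothesis sV' : smooth_vf V'.
Local Notation V := (fun r => V' r *m phi St r).

Let sV : smooth_vf V. Proof. by case: Hf => h _ _ _ _; exact: h. Qed.

Section Torsion.
Variables (q : M) (X : 'I_m -> vfield M).
Hypothesis sX : forall i, smooth_vf (X i).
Hypothesis uX : \matrix_i X i q \in unitmx.

(** The matrix of the endomorphism T(., V) at [q]; the frame [X] only serves to compute it. *)
Definition torsion_mx : 'M[R]_m := invmx (\matrix_i X i q) *m \matrix_i torsion nabla (X i) V q.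

Lemma torsion_mxE U : smooth_vf U -> U q *m torsion_mx = torsion nabla U V q.
Proof.
move=> sU; pose a i := (U q *m invmx (\matrix_i X i q)) 0 i.
have sa i : smooth_fun (fun _ : M => a i) by exact: smooth_fun_cst.
pose U' : vfield M := fun r => \sum_i a i *: X i r.
have sU' : smooth_vf U' by apply: (smooth_vf_sum _ _ (X := fun i r => a i *: X i r)) => i; exact: (smooth_vfZ (f := fun=> a i)).
have UE : U' q = U q.
  rewrite -[RHS](mulmxKV uX) mulmx_sum_row; apply: eq_bigr => i _.
  by rewrite rowK.
rewrite -(torsion_tensor Hc sU' sU sV sV UE erefl) (torsion_antisym nabla U').
rewrite /torsion (lie_sum (f := fun i _ => a i) _ sV sa sX) (nabla_sum Hc q _ _ xpredT sa sX).
have -> : nabla q (U' q) V = \sum_i a i *: nabla q (X i q) V.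
  rewrite /U' (big_morph (fun u => nabla q u V) (fun u v => nabla_vD Hc q u v sV) (nabla_v0 Hc q sV)).
  by apply: eq_bigr => i _; rewrite (nabla_vZ Hc q _ _ sV).
rewrite -!sumrB -sumrN /torsion_mx mulmxA mulmx_sum_row; apply: eq_bigr => i _.
rewrite rowK -/(a i) !vder_cst !scale0r !add0r -!scalerBr -scalerN; congr (_ *: _).
rewrite -/(torsion nabla V (X i) q) -(torsion_antisym nabla (X i)).
by [].
Qed.

(* For V in E, the endomorphism T(., V) exchanges E and T. *)
Lemma trace_torsion : \tr torsion_mx = 0.
Proof.
set B := torsion_mx; pose ph := phi St q; pose P := - (ph *m ph); pose Q := 1%:M - P.
have cube : ph *m ph *m ph = - ph by exact: phi_cube.
have phP : ph *m P = ph by rewrite mulmxN mulmxA cube opprK.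
have Pph : P *m ph = ph by rewrite mulNmx cube opprK.
have PP : P *m P = P by rewrite {2}/P mulmxN mulmxA Pph.
have QQ : Q *m Q = Q by rewrite /Q mulmxBr mulmx1 mulmxBl PP mul1mx subrr subr0.
have PBP : P *m B *m P = 0.
  apply/row_matrixP => i; rewrite row0 !row_mul.
  have [U [sU Uq]] := vfield_extension q (row i P).
  rewrite -Uq (torsion_mxE sU) (torsionE_E Hf HT sU sV).
  - rewrite -scalemxAl mulmx_suml big1 ?scaler0// => j _.
    by rewrite /P mulmxN mulmxA (xi_phi Hf) mul0mx oppr0.
  - by rewrite Uq; apply: (submx_trans (row_sub i P)); rewrite /P -mulNmx submxMl.
  exact: submxMl.
have QBQ : Q *m B *m Q = 0.
  have phQ : ph *m Q = 0 by rewrite /Q mulmxBr mulmx1 phP subrr.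
  have QE : Q = \sum_j eta St j q *m xi St j q.
    by rewrite /Q /P opprK (phi_sqr Hf) addrA subrr add0r.
  rewrite {1}QE !mulmx_suml big1// => j _.
  have [_ _ [_ h _]] := HT.
  have [_ sxi _ _ _] := Hf.
  have xB : xi St j q *m B = - (torsion nabla (xi St j) V' q *m ph).
    by rewrite (torsion_mxE (sxi j)) (h j V' sV' q).
  transitivity (eta St j q *m (xi St j q *m B) *m Q); first by rewrite !mulmxA.
  by rewrite xB mulmxN mulNmx -!mulmxA phQ !mulmx0 oppr0.
rewrite -[B]mulmx1 -(subrK P 1%:M) -/Q mulmxDr mxtraceD.
rewrite -{1}QQ -PP !mulmxA mxtrace_mulC mulmxA QBQ mxtrace0 add0r.
by rewrite mxtrace_mulC mulmxA PBP mxtrace0.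
Qed.

End Torsion.

(** By Leibniz the right side splits into derivatives of the density [rho] along [V], which give the
    trace of nabla_V X_i because the volume is parallel, and derivatives of the components of [V],
    which give the trace of [X_i, V]. The sum of nabla_V X_i, [X_i, V] and T(X_i, V) is nabla_{X_i}
    V, and the torsion term is traceless. *)
Lemma divergence_formula c q : in_maximal_atlas c -> cdom c q ->
  trace_nabla V q * volume St q (coord_frame c q) =
  \sum_i 'D_(delta_mx 0 i)
     ((fun r => volume St r (coord_frame c r) * vder r (V r) (ccoord c i)) \o cinv c) (cmap c q).
Proof.
move=> ac cq; have [X [sX XE]] := frame_extension ac cq.
have Xq := nbhs_singleton XE.
have XK : \matrix_i X i q = coord_frame c q by apply/row_matrixP => i; rewrite rowK Xq.
have uX : \matrix_i X i q \in unitmx by rewrite XK coord_frame_unit.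
have srho := smooth_volume_frame Hf ac cq.
have sx i : smooth_at (ccoord c i) q by exact: smooth_at_ccoord.
have sv i : smooth_at (fun r => vder r (V r) (ccoord c i)) q.
  exact: (iffLR (smooth_vfP _) sV _ _ (sx i)).
set rho := fun r => volume St r (coord_frame c r).
pose vi i := vder q (V q) (ccoord c i).
have VE : V q = \sum_i vi i *: X i q.
  rewrite -[LHS](dcoordK (V q) ac cq) mulmx_sum_row; apply: eq_bigr => i _.
  by rewrite Xq mxE.
have drho : \sum_i vi i * vder q (X i q) rho =
    rho q * \sum_i dcoord c q (nabla q (V q) (X i)) 0 i.
  transitivity (vder q (V q) rho).
    rewrite VE (big_morph (fun w => vder q w rho) (fun u v => vderDv u v srho) (vder0 q rho)).
    by apply: eq_bigr => i _; rewrite (vderZv _ _ srho).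
  transitivity (vder q (V q) (fun r => volume St r (\matrix_i X i r))).
    apply: vder_near_eq; apply: filterS XE => r h; congr (volume St r _).
    by apply/row_matrixP => i; rewrite rowK h.
  rewrite (vder_volume Hf HT _ sX uX) XK; congr (_ * _); apply: eq_bigr => i _.
  by rewrite (dcoordE _ ac cq).
have dv i : vder q (X i q) (fun r => vder r (V r) (ccoord c i)) = dcoord c q (lie (X i) V q) 0 i.
  rewrite mxE (vder_lie (sX i) sV (sx i)).
  rewrite [X in _ - X](_ : _ = 0) ?subr0//.
  transitivity (vder q (V q) (fun _ : M => (i == i)%:R : R)); last exact: vder_cst.
  apply: vder_near_eq; have N := cdom_near ac.1 cq.
  apply: filterS2 XE N => r h cr; rewrite h.
  have := dcoord_coord_frame i ac cr => /(congr1 (fun u : 'rV[R]_m => u 0 i)).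
  by rewrite !mxE eqxx.
have T0 : \sum_i dcoord c q (torsion nabla (X i) V q) 0 i = 0.
  rewrite -[RHS](trace_torsion sX uX) /torsion_mx mxtrace_mulC.
  apply: eq_bigr => i _; rewrite (dcoordE _ ac cq) XK [LHS]mxE [RHS]mxE.
  by apply: eq_bigr => l _; rewrite [in RHS]mxE.
have dB u v i : dcoord c q (u - v) 0 i = dcoord c q u 0 i - dcoord c q v 0 i.
  by rewrite !(dcoordE _ ac cq) mulmxBl !mxE.
have trE : trace_nabla V q = \sum_i dcoord c q (nabla q (V q) (X i)) 0 i +
    \sum_i dcoord c q (lie (X i) V q) 0 i.
  transitivity (\sum_i (dcoord c q (nabla q (V q) (X i)) 0 i + dcoord c q (lie (X i) V q) 0 i +
      dcoord c q (torsion nabla (X i) V q) 0 i)); last by rewrite !big_split /= T0 addr0.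
  rewrite (trace_nabla_dcoord ac cq sV); apply: eq_bigr => i _.
  have tE : torsion nabla (X i) V q = nabla q (X i q) V - nabla q (V q) (X i) - lie (X i) V q by [].
  rewrite tE -(Xq i).
  exact: (additive_split (D := fun u => dcoord c q u 0 i) _ _ _ (fun u v => dB u v i)).
rewrite trE mulrDl (mulrC _ (volume _ _ _)) -[volume St q _]/(rho q) -drho mulr_suml -big_split.
apply: eq_bigr => i _ /=.
rewrite -(vder_coord_frame i ac cq (smooth_atM srho (sv i))) -Xq (vderM _ srho (sv i)) dv -/rho -/(vi i).
by rewrite addrC mulrC.
Qed.

Lemma integral_divergence c S : in_maximal_atlas c -> compact S -> S `<=` cdom c ->
  (forall q, ~ S q -> V q = 0) ->
  integral_Rn (zext c (fun q => trace_nabla V q * volume St q (coord_frame c q))) = 0.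
Proof.
move=> ac cS Sc V0.
pose f i r := volume St r (coord_frame c r) * vder r (V r) (ccoord c i).
have f0 i q : ~ S q -> f i q = 0 by move=> nS; rewrite /f V0// vder0 mulr0.
have sf i q : cdom c q -> smooth_at (f i) q.
  move=> cq; apply: smooth_atM; first exact: smooth_volume_frame.
  exact: (iffLR (smooth_vfP _) sV _ _ (smooth_at_ccoord i ac cq)).
have [B B0 HB] := compact_image_bound ac cS Sc.
pose G i := 'D_(delta_mx 0 i) (zext c (f i)).
have HG i : lip_supp B (G i) /\ integral_Rn (G i) = 0.
  apply: integral_Rn_partial => //; first exact: (zext_smooth ac cS Sc (f0 i) (sf i)).
  exact: (zext_bounded ac Sc HB (f0 i)).
have [_ <-] := integral_Rn_sum0 (index_enum _) B0 HG.
congr integral_Rn; apply/funext => x.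
(* Off the chart image the extended components vanish near [x], so both sides are zero there. *)
have [cx|ncx] := pselect (cimg c x).
  rewrite /zext mem_set//; have [q cq qx] := cx.
  have K : cinv c x = q by rewrite -qx; case: ac => [[_ _ K _ _] _]; exact: K.
  rewrite K (divergence_formula ac cq) qx; apply: eq_bigr => i _.
  by apply: near_eq_derive; have E := zext_near (f i) ac cx; apply: filterS E => y ->.
rewrite {1}/zext memNset// big1// => i _; rewrite /G.
have nx : ~ (cmap c @` S) x by move=> [q Sq qx]; apply: ncx; exists q => //; exact: Sc.
have E := zext_near0 ac cS Sc (f0 i) nx.
transitivity ('D_(delta_mx 0 i) (fun _ : 'rV[R]_m => 0 : R) x); last exact: derive_cst.
by apply: near_eq_derive.
Qed.

End Divergence.

(** * The formal adjoint *)

Local Open Scope complex_scope.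

Section Positivity.
Variables (R : realType) (n k : nat).
Local Notation m := (k + n * 2)%N.
Variables (M : manifold R m) (St : fpk_data M).
Local Notation C := R[i].
Hypothesis Hf : is_metric_fpk St.

Lemma rpair_zerol p (s t : cform R n k) : (forall q A, s q A = 0) -> rpair St p s t = 0.
Proof.
move=> s0; rewrite /rpair /hpair big1// => q _; rewrite big1 ?mulr0// => I _; rewrite big1// => J _.
by rewrite s0 rmorph0 mul0r mulr0.
Qed.

Lemma rpairZl p (a : R) (s t : cform R n k) :
  rpair St p (fun q A => a%:C * s q A) t = a * rpair St p s t.
Proof.
have -> : rpair St p (fun q A => a%:C * s q A) t = complex.Re (a%:C * hpair St p s t).
  congr (complex.Re _); rewrite /hpair mulr_sumr; apply: eq_bigr => q _.
  rewrite mulrCA; congr (_ * _); rewrite mulr_sumr; apply: eq_bigr => I _.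
  rewrite mulr_sumr; apply: eq_bigr => J _; rewrite [RHS]mulrCA; congr (_ * _).
  by rewrite rmorphM mulrA; congr (_ * _ * _); exact: conjc_real.
by rewrite /rpair; case: (hpair _ _ _ _) => x y /=; rewrite mul0r subr0.
Qed.

Lemma orthonormal_frame p : exists2 F : 'M[R]_m, F \in unitmx & F *m metric St p *m F^T = 1%:M.
Proof.
have pg : posdef (metric St p).
  split; first exact: metric_sym.
  by case: Hf => _ _ _ [_ _ +] _ => h v v0; exact: h.
have [L uL gL] := cholesky pg; exists (invmx L); first by rewrite unitmx_inv.
by rewrite gL mulmxA mulVmx// mul1mx trmx_inv mulmxV// unitmx_tr.
Qed.

Lemma rpair_sqr p (s : cform R n k) (F : 'M[R]_m) : multilinear_family s -> F \in unitmx ->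
  F *m metric St p *m F^T = 1%:M ->
  rpair St p s s = \sum_(q < n.+1) (q`!%:R)^-1 *
    \sum_I (complex.Re (frame_values F (s q) I) ^+ 2 + complex.Im (frame_values F (s q) I) ^+ 2).
Proof.
move=> ms uF F1; rewrite (rpair_frame Hf p ms ms uF) F1 invmx1; apply: eq_bigr => q _.
by congr (_ * _); rewrite -hform1 Re_hform.
Qed.

Let term_ge0 q (f : {ffun 'I_q -> 'I_m} -> C) :
  0 <= \sum_I (complex.Re (f I) ^+ 2 + complex.Im (f I) ^+ 2).
Proof. by apply: sumr_ge0 => I _; rewrite addr_ge0// sqr_ge0. Qed.

Lemma rpair_ge0 p (s : cform R n k) : multilinear_family s -> 0 <= rpair St p s s.
Proof.
move=> ms; have [F uF F1] := orthonormal_frame p; rewrite (rpair_sqr ms uF F1).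
by apply: sumr_ge0 => q _; rewrite mulr_ge0// invr_ge0 ler0n.
Qed.

(** In an orthonormal frame the pairing is a sum of squares of components; degrees above [n], absent
    from that sum, vanish for rank reasons. *)
Lemma rpair_eq0 p (s : cform R n k) : in_spinor St p s -> rpair St p s s = 0 ->
  forall q A, s q A = 0.
Proof.
move=> hs s0 q A.
have [nq|qn] := ltnP n q; first exact: (spinor_eq0 Hf A hs nq).
have ms : multilinear_family s by move=> q'; have [] := hs q'.
have [F uF F1] := orthonormal_frame p; move: s0; rewrite (rpair_sqr ms uF F1).
move=> /eqP; rewrite psumr_eq0; last by move=> i _; rewrite mulr_ge0// invr_ge0 ler0n.
move=> /allP/(_ (Ordinal (qn : (q < n.+1)%N)) (mem_index_enum _)) /=.
rewrite mulf_eq0 invr_eq0 pnatr_eq0 (gtn_eqF (fact_gt0 q)) /= => /eqP h0.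
have fv0 I : frame_values F (s q) I = 0.
  move/eqP: h0; rewrite psumr_eq0; last by move=> J _; rewrite addr_ge0// sqr_ge0.
  move=> /allP/(_ I (mem_index_enum _)) /=.
  rewrite paddr_eq0 ?sqr_ge0// !sqrf_eq0 => /andP[/eqP a /eqP b].
  by rewrite (complexE (frame_values F (s q) I)) a b mulr0 addr0.
have -> : A = (A *m cplx (invmx F)) *m cplx F by rewrite -mulmxA -cplxM mulVmx// cplx1 mulmx1.
rewrite (multilinear_expand _ _ (ms q)) big1// => I _.
by rewrite [X in _ * X](fv0 I) mulr0.
Qed.

End Positivity.

Section FormalAdjoint.
Variables (R : realType) (n k : nat).
Local Notation m := (k + n * 2)%N.
Variables (M : manifold R m) (St : fpk_data M) (nabla : connection M).
Variable nablaS : spinor_connection M.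
Arguments nablaS : clear implicits.
Local Notation C := R[i].
Hypothesis Hf : is_metric_fpk St.
Hypothesis HT : is_tanaka_webster St nabla.
Hypothesis HI : is_induced St nabla nablaS.

Let Hc : is_connection nabla. Proof. by case: HT. Qed.

Lemma nabla_zero_off (S : set M) (V : vfield M) q v : compact S -> smooth_vf V ->
  (forall r, ~ S r -> V r = 0) -> ~ S q -> nabla q v V = 0.
Proof.
move=> cS sV V0 nS; rewrite -(nabla0 Hc q v).
apply: (nabla_near_eq Hc) => //; first exact: smooth_vf0.
have cK : closed S by apply: compact_closed => //; exact: (@points_hausdorff _ _ M).
by have := open_nbhs_nbhs (conj (closed_openC cK) nS); apply: filterS => r; exact: V0.
Qed.

Variables (I : (M -> mform R m m) -> R) (dbarb_star : csection M -> csection M).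
Arguments dbarb_star : clear implicits.
Hypothesis HInt : is_integral (volume St) I.
Hypothesis Hadj : is_formal_adjoint St I (dbarb St) dbarb_star.
Variable zeta : csection M.
Hypothesis sz : spinor_section St zeta.

Local Notation adj := (dbarb_adjoint St nablaS zeta).
Local Notation vol f := (fun q A => f q * volume St q A).

(** The scalar -1 gives the shape [a * t + t'] on which [rpair_cplxlinear] and [spinor_sectionZ]
    act. *)
Let delta : csection M := fun r q A => (-1 : R)%:C * adj r q A + dbarb_star zeta r q A.
Arguments delta : clear implicits.

Let sadj : spinor_section St adj. Proof. exact: (dbarb_adjoint_section Hf HT HI sz). Qed.
Let sstar : spinor_section St (dbarb_star zeta). Proof. exact: (Hadj.1 _ sz). Qed.

Let sdelta : spinor_section St delta.
Proof.
apply: (spinor_sectionD (s := fun r q A => (-1 : R)%:C * adj r q A)); last exact: sstar.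
apply: (spinor_sectionZ (a := fun=> -1)); [exact: smooth_fun_cst | exact: sadj].
Qed.

(* Real parts suffice: the adjunction is tested against psi = chi * delta. *)
Lemma integral_test (chi : M -> R) (S : set M) c : smooth_fun chi -> in_maximal_atlas c ->
  (forall q, cdom c q -> 0 < volume St q (coord_frame c q)) -> compact S -> S `<=` cdom c ->
  (forall r, ~ S r -> chi r = 0) ->
  integral_Rn (zext c (fun q => chi q * rpair St q (delta q) (delta q) * volume St q (coord_frame c q))) = 0.
Proof.
move=> schi ac pos cS Sc chi0.
pose psi : csection M := fun r q A => (chi r)%:C * delta r q A.
have sp : spinor_section St psi by exact: spinor_sectionZ.
have psi0 r : ~ S r -> forall q A, psi r q A = 0.
  by move=> nS q A; rewrite /psi chi0// mul0r.
pose V := dual_field St psi zeta.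
have sV : smooth_vf V by exact: (smooth_dual_field Hf sp sz).
have V0 r : ~ S r -> V r = 0.
  move=> nS; rewrite /V /dual_field (_ : \row_l _ = 0) ?mul0mx//.
  by apply/rowP => l; rewrite !mxE; apply: rpair_zerol; exact: psi0.
(* As [V] is tangent to E, -phi^2 fixes it, so -phi V is a preimage of [V] under [phi]. *)
pose V' r := - (V r *m phi St r).
have sV' : smooth_vf V'.
  by apply: smooth_vfN; case: Hf => h _ _ _ _; exact: h.
have VE : V = (fun r => V' r *m phi St r).
  apply/funext => r; rewrite /V' mulNmx (phi_sqr_row Hf) big1 ?addr0 ?opprK// => i _.
  have : gprod St r (V r) (xi St i r) = 0 by exact: (dual_field_xi Hf psi sz).
  rewrite (metric_phi Hf) (xi_phi Hf) (gprod_sym Hf) gprod0 add0r.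
  rewrite (bigD1 i)//= (eta_xi Hf) eqxx mulr1 big1 ?addr0 => [->|j ji]; first by rewrite scale0r.
  by rewrite (eta_xi Hf) (negPf ji) mulr0.
pose f1 r := rpair St r (dbarb St psi r) (zeta r).
pose f2 r := rpair St r (psi r) (dbarb_star zeta r).
pose f3 r := rpair St r (psi r) (adj r).
have mpsi r : multilinear_family (psi r) := multilinear_spinor r sp.
have s2 : smooth_fun f2.
  exact: (smooth_rpair Hf mpsi (fun r => multilinear_spinor r sstar) (smooth_spinor sp) (smooth_spinor sstar)).
have s3 : smooth_fun f3.
  exact: (smooth_rpair Hf mpsi (fun r => multilinear_spinor r sadj) (smooth_spinor sp) (smooth_spinor sadj)).
have st : smooth_fun (trace_nabla nabla V) by exact: (smooth_trace_nabla HT sV).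
have trE r : trace_nabla nabla V r = f1 r - f3 r by exact: (trace_nabla_dual_field Hf HT HI sz r sp).
have t2 := topform_volume Hf s2; have t3 := topform_volume Hf s3; have tt := topform_volume Hf st.
have [Ilin Ichart] := HInt.
have I12 : I (vol f1) = I (vol f2).
  exact: (congr1 (fun z : C => complex.Re z) (Hadj.2 psi zeta sp sz)).
(* [vol f1] is written as a sum of two forms already known to be smooth, so that the linearity of
   [I] applies. *)
have I1 : I (vol f1) = 1 * I (vol (trace_nabla nabla V)) + I (vol f3).
  rewrite -(Ilin 1 _ _ tt t3); congr (I _); apply/funext => r; apply/funext => A.
  by rewrite trE mul1r -mulrDl subrK.
have It : I (vol (trace_nabla nabla V)) = 0.
  rewrite (Ichart c S _ ac pos cS Sc tt); last first.
    move=> q A nS; rewrite /trace_nabla big1 ?mul0r// => l _.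
    by rewrite (nabla_zero_off _ cS sV V0 nS) mxE.
  rewrite VE; apply: (integral_divergence Hf HT sV' ac cS Sc) => q nS.
  by rewrite -[LHS]/((fun r => V' r *m phi St r) q) -VE V0.
pose f4 q := chi q * rpair St q (delta q) (delta q).
have f4E q : f4 q = -1 * f3 q + f2 q.
  by rewrite /f4 /f3 /f2 -(rpair_cplxlinear _ _ (-1)) -rpairZl.
have s4 : smooth_fun f4.
  apply/smooth_funP => q; rewrite (_ : f4 = (fun q => -1 * f3 q + f2 q)); last by apply/funext.
  apply: smooth_atD; last exact: (iffLR (smooth_funP _) s2).
  by apply: smooth_atM; [exact: smooth_at_cst | exact: (iffLR (smooth_funP _) s3)].
have I4 : I (vol f4) = 0.
  have -> : vol f4 = (fun q A => -1 * (f3 q * volume St q A) + f2 q * volume St q A).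
    have e (a b v : R) : (-1 * a + b) * v = -1 * (a * v) + b * v by ring.
    apply/funext => q; apply/funext => A.
    exact: (etrans (congr1 (fun x => x * volume St q A) (f4E q)) (e _ _ _)).
  by rewrite (Ilin (-1) _ _ t3 t2) -I12 I1 It mulr0 add0r mulN1r addNr.
rewrite -I4 (Ichart c S _ ac pos cS Sc (topform_volume Hf s4)) => [//|q A nS].
by rewrite /f4 chi0// !mul0r.
Qed.

Lemma dbarb_star_adjoint p q A : dbarb_star zeta p q A = adj p q A.
Proof.
have [c [ac cp pos]] := positive_chart Hf p.
have [chi [S [schi chi0 /nbhs_singleton chi1 [cS Sc chiS]]]] := cutoff ac cp.
have int0 := integral_test schi ac pos cS Sc chiS.
set f := fun q => _ in int0.
have md r : multilinear_family (delta r) := multilinear_spinor r sdelta.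
have fS r : ~ S r -> f r = 0 by move=> nS; rewrite /f chiS// !mul0r.
have sf r : cdom c r -> smooth_at f r.
  move=> cr; apply: smooth_atM; last exact: smooth_volume_frame.
  apply: smooth_atM; first exact: (iffLR (smooth_funP _) schi).
  exact: (iffLR (smooth_funP _) (smooth_rpair Hf md md (smooth_spinor sdelta) (smooth_spinor sdelta))).
have [B B0 HB] := compact_image_bound ac cS Sc.
have lf := C1_lip_supp B0 (zext_smooth ac cS Sc fS sf 1%N) (zext_bounded ac Sc HB fS).
have pf x : 0 <= zext c f x.
  rewrite /zext; case: ifP => // /set_mem [r cr <-].
  have K : cinv c (cmap c r) = r by case: ac => [[_ _ K _ _] _]; exact: K.
  rewrite K /f mulr_ge0//; last exact: ltW (pos r cr).
  by rewrite mulr_ge0// (rpair_ge0 Hf).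
(* A nonnegative Lipschitz integrand with zero integral vanishes everywhere; at [p] the cutoff is 1
   and the density positive, which leaves |delta|^2 = 0. *)
have := integral_Rn_eq0 B0 lf pf int0 (cmap c p).
rewrite /zext mem_set; last by exists p.
have K : cinv c (cmap c p) = p by case: ac => [[_ _ K _ _] _]; exact: K.
rewrite K /f [chi p]chi1 mul1r => /eqP; rewrite mulf_eq0 (gt_eqF (pos p cp)) orbF => /eqP d0.
have := rpair_eq0 Hf (sdelta.1 p) d0 A.
rewrite /delta rmorphN1 mulN1r addrC => /eqP; rewrite subr_eq0 => /eqP.
by [].
Qed.

End FormalAdjoint.

Local Close Scope complex_scope.

Theorem theorem3p6 (R : realType) (n k : nat) (M : manifold R (k + n * 2))
    (St : fpk_data M) (nabla : connection M) (nablaS : spinor_connection M)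
    (I : (M -> mform R (k + n * 2) (k + n * 2)) -> R)
    (dbarb_star : csection M -> csection M) :
  compact [set: M] ->
  almost_S St -> CR_integrable St ->
  is_tanaka_webster St nabla ->
  is_induced St nabla nablaS ->
  is_integral (volume St) I ->
  is_formal_adjoint St I (dbarb St) dbarb_star ->
  forall zeta : csection M, spinor_section St zeta ->
    D_b St dbarb_star zeta = Dirac St nablaS zeta.
Proof.
move=> _ [Hf _] _ HT HI HInt Hadj zeta sz.
apply/funext => p; apply: functional_extensionality_dep => q; apply/funext => A.
rewrite (DiracE Hf HI p A sz) /D_b (dbarb_star_adjoint Hf HT HI HInt Hadj sz p A).
congr (_ * (_ + _)); exact: (dbarb_dirac_wedge Hf HT HI).
Qed.
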